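(* Let \[ f(t,x):=\mathbb{E}\Big[\exp\Big(\int_t^T\sum_{i=1}^3u_i(s)p_i(X_s)ds+v(T)q(X_T)\Big)\,\Big|\,X_t=x\Big]. \] Then $f$ is $C^\infty$ in $x$, $C^1$ in $t$, and solves \[ f_t(t,x)+f_x(t,x)(a+bx)+\tfrac12c^2f_{xx}(t,x)+f(t,x)\sum_{i=1}^3u_i(t)p_i(x)=0,\qquad f(T,x)=\exp(v(T)q(x)). \]
   Context: Let $W$ be a Brownian motion on a filtered probability space with usual conditions; $a,b\in\mathbb{R}$, $c\ne0$, $T>0$; $dX_t=(a+bX_t)dt+c\,dW_t$. A power series $p=\sum p_kx^k$ is negligible to double factorial if $\limsup_k(|p_k|(k-1)!!)^{1/k}=0$, $(-1)!!=0!!=1$. Standing assumptions: $u_1,u_2,u_3,v:[0,T]\to\mathbb{C}$ continuous with $\Re(u_1)\le0$, $\Re(u_2)=\Re(u_3)=\Re(v)=0$; $p_1=p^2$ for a real-coefficient power series $p$ negligible to double factorial; $p_2,p_3,q$ real-coefficient power series negligible to double factorial. ''$C^\infty$ in $x$'': all $x$-derivatives exist and are jointly continuous in $(t,x)$; ''$C^1$ in $t$'': $\partial_t$ exists and is jointly continuous. *)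

(* Defs.v *)
From HB Require Import structures.
From mathcomp Require Import all_boot all_order all_algebra.
From mathcomp Require Import all_classical all_reals all_analysis.
From mathcomp Require complex.
Import complex.ComplexField.
Set Implicit Arguments.
Unset Strict Implicit.
Unset Printing Implicit Defensive.
Import Order.TTheory GRing.Theory Num.Theory.
Import numFieldNormedType.Exports.
Local Open Scope classical_set_scope.
Local Open Scope ring_scope.

Notation Cx R := (complex.complex R).
Notation cRe := complex.Re.
Notation cIm := complex.Im.
Notation mkC := complex.Complex.

Section Defs.
Context {R : realType}.

(** [dfact_m1 k] = (k-1)!!, with (-1)!! = 0!! = 1. *)
Fixpoint dfact_m1 (k : nat) : nat :=
  match k with
  | 0 => 1
  | 1 => 1
  | (j.+1).+1 => (j.+1 * dfact_m1 j)%N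
  end.

Definition negligible_df (p : nat -> R) : Prop :=
  limn_esup (fun k : nat => ((`|p k| * (dfact_m1 k)%:R) `^ (k%:R^-1))%:E) = 0%E.

Definition pser (p : nat -> R) (x : R) : R := limn (series (fun k : nat => p k * x ^+ k)).

Definition pser_sq (p : nat -> R) (k : nat) : R :=
  \sum_(i < k.+1) p i * p (k - i)%N.

Definition cexp (z : Cx R) : Cx R :=
  mkC (expR (cRe z) * cos (cIm z)) (expR (cRe z) * sin (cIm z)).

Definition ccont_on (D : set R) (g : R -> Cx R) : Prop :=
  {within D, continuous (fun s => cRe (g s))} /\
  {within D, continuous (fun s => cIm (g s))}.

Definition ccont2_on (D : set (R * R)) (g : R -> R -> Cx R) : Prop :=
  {within D, continuous (fun z : R * R => cRe (g z.1 z.2))} /\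
  {within D, continuous (fun z : R * R => cIm (g z.1 z.2))}.

Definition cintegral (g : R -> Cx R) (t T : R) : Cx R :=
  mkC (Rintegral lebesgue_measure `[t, T] (fun s => cRe (g s)))
      (Rintegral lebesgue_measure `[t, T] (fun s => cIm (g s))).

Definition cexpectation d (Omega : measurableType d) (P : probability Omega R)
  (Z : Omega -> Cx R) : Cx R :=
  mkC (Rintegral P setT (fun w => cRe (Z w)))
      (Rintegral P setT (fun w => cIm (Z w))).

(** real derivative of g at t relative to the set D
    (one-sided at boundary points of an interval D) *)
Definition deriv_within (D : set R) (g : R -> R) (t l : R) : Prop :=
  (fun h : R => h^-1 * (g (h + t) - g t)) @ within (fun h => D (h + t)) (0:R)^'
    --> l.

Definition usual_filtration d (Omega : measurableType d) (P : probability Omega R)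
  (F : R -> set (set Omega)) : Prop :=
  [/\ (forall t, 0 <= t -> sigma_algebra setT (F t)),
      (forall t, 0 <= t -> F t `<=` measurable),
      (forall s t, 0 <= s -> s <= t -> F s `<=` F t),
      (forall t, 0 <= t -> F t = [set A | forall s, t < s -> F s A]) &
      (forall N A, measurable N -> P N = 0%E -> A `<=` N -> F 0 A)].

Definition brownian_motion d (Omega : measurableType d) (P : probability Omega R)
  (F : R -> set (set Omega)) (W : R -> Omega -> R) : Prop :=
  [/\ (forall w, W 0 w = 0),
      (forall w, {within `[0, +oo[, continuous (fun t => W t w)}),
      (forall t, 0 <= t -> forall B : set R, measurable B -> F t (W t @^-1` B)),
      (forall s t, 0 <= s -> s < t -> forall A (B : set R), F s A -> measurable B ->
          P (A `&` ((fun w => W t w - W s w) @^-1` B)) =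
          (P A * P ((fun w => (W t w - W s w)%R) @^-1` B))%E) &
      (forall s t, 0 <= s -> s < t -> forall B : set R, measurable B ->
          P ((fun w => W t w - W s w) @^-1` B) = normal_prob 0 (Num.sqrt (t - s)) B)].

Definition cR (r : R) : Cx R := mkC r 0.

(** Y is the solution flow of dX = (a + b X) dt + c dW started at time t from x:
    for every path w, s |-> Y t x s w is continuous on [t, T] and solves
    Y_s = x + int_t^s (a + b Y_r) dr + c (W_s - W_t) for s in [t, T]. *)
Definition ou_flow d (Omega : measurableType d) (W : R -> Omega -> R)
  (a b c T : R) (Y : R -> R -> R -> Omega -> R) : Prop :=
  forall t x w, (0 <= t <= T) ->
    {within `[t, T], continuous (fun s => Y t x s w)} /\
    (forall s, (t <= s <= T) ->
       Y t x s w = x + Rintegral lebesgue_measure `[t, s] (fun r => a + b * Y t x r w)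
                     + c * (W s w - W t w)).

(** f(t,x) = E[ exp( int_t^T sum_i u_i(s) p_i(X_s) ds + v(T) q(X_T) ) | X_t = x ],
    computed along the flow started at (t, x). *)
Definition fk_f d (Omega : measurableType d) (P : probability Omega R)
  (Y : R -> R -> R -> Omega -> R) (T : R) (u1 u2 u3 v : R -> Cx R)
  (p1 p2 p3 q : nat -> R) (t x : R) : Cx R :=
  cexpectation P (fun w =>
    cexp (cintegral (fun s => u1 s * cR (pser p1 (Y t x s w))
                             + u2 s * cR (pser p2 (Y t x s w))
                             + u3 s * cR (pser p3 (Y t x s w))) t T
          + v T * cR (pser q (Y t x T w)))).

End Defs.

(* Main.v *)
(* Because [X] is linear, [Y t x s = X s + exp (b (s - t)) (x - X t)] for the single
   solution [X = Y 0 0], so that [f(t, x)] is the expectation of an explicit smooth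
   functional of [x] and of one Gaussian path. Negligibility to double factorial
   makes [p(x)] and all its derivatives [O(exp (eps x^2))] for every [eps], while [X s] and
   [(W s - W t) / sqrt (s - t)] have uniformly bounded [exp (eps x^2)]-moments; since
   the real part of the exponent is nonpositive, every [x]-derivative of the
   integrand has uniformly bounded moments, and differentiation and limits pass
   under the expectation by uniform integrability.
   For [t], take [lo < hi] and let [y] be the position at [hi] of the solution
   started from [(lo, x)]. The exponent at [(lo, x)] is the one at [(hi, y)] plus an
   integral over [[lo, hi]], which gives the zeroth-order term. A second-order
   Taylor expansion at [x] of the functional started at [hi] gives the other terms,
   because it only depends on increments of [W] after [hi], hence is independent of
   [W hi - W lo], whose first two moments are [0] and [hi - lo]. *)
Require Import Defs.
From HB Require Import structures.
From mathcomp Require Import all_boot all_order all_algebra.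
From mathcomp Require Import all_classical all_reals all_analysis.
From mathcomp Require Import measurable_realfun ring lra zify.
From mathcomp Require complex.
Import complex.ComplexField.
Import Order.TTheory GRing.Theory Num.Theory.
Import numFieldNormedType.Exports.
Set Implicit Arguments.
Unset Strict Implicit.
Unset Printing Implicit Defensive.
Local Open Scope classical_set_scope.
Local Open Scope ring_scope.

(** * Averages over the unit interval *)

(** The delicate point is the time derivative. Over a step [h = hi - lo] the displacement [dx] has
    size [sqrt h], so [dx ^+ 2 / h] has bounded moments but need not converge along a path. Two
    devices settle this. The part [(W hi - W lo) ^+ 2 - h] is split off and has mean zero against
    anything that depends on the future only. What remains is a factor with bounded moments times a
    Taylor error that tends to 0 on each path, and such products get a limit lemma of their own.
    Growth below [exp (eps x^2)] is needed for every [eps], since the path has Gaussian moments for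
    one fixed exponent only, while higher powers of the integrand multiply [eps]. Integrals are
    rescaled to the unit interval, and increments and remainders are written as averages: unlike the
    intermediate points of mean value theorems, averages are measurable in the path, continuous down
    to [lo = hi], and inherit moment bounds by convexity. All estimates are made on real and
    imaginary parts; products and derivatives of these are described by a small syntax, so that one
    induction bounds all derivatives. *)

Section antiderivative.
Context {R : realType}.
Notation mu := (@lebesgue_measure R).
Implicit Types (f g G : R -> R) (s t : R).

Definition RI t s g : R := \int[mu]_(x in `[t, s]) g x.

Lemma cont_integrable g t s : continuous g ->
  mu.-integrable `[t, s] (EFin \o g).
Proof.
move=> cg; apply: continuous_compact_integrable; first exact: segment_compact.
exact: continuous_subspaceT.
Qed.

(** The base point -1 puts every time in [[0, T]], including 0, inside the domain, so that
    derivatives there are two-sided. *)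
Definition Ant g s : R := RI (-1) s g.

Lemma is_derive_Ant g s : continuous g -> -1 < s -> is_derive s 1 (Ant g) (g s).
Proof.
move=> cg s1.
have [||dF F'] := @continuous_FTC1_closed _ g (-1) s (s + 1) _ _ s1 (cg s).
- by rewrite ltrDl.
- exact: cont_integrable.
- rewrite -F' derive1E; exact: derivableP.
Qed.

Lemma RI_Ant g t s : continuous g -> -1 <= t -> t <= s ->
  RI t s g = Ant g s - Ant g t.
Proof.
move=> cg t1 ts; rewrite /Ant /RI Rintegral_itvB ?bnd_simp//.
- rewrite Rintegral_itv_obnd_cbnd//.
  apply: integrableS (cont_integrable t s cg) => //.
  by apply: subset_itvr; rewrite bnd_simp.
- exact: cont_integrable.
Qed.

Lemma derive_continuous g (dg : R -> R) t s :
  (forall x, t <= x <= s -> is_derive x 1 g (dg x)) ->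
  {within `[t, s], continuous g}.
Proof.
move=> dG; apply: derivable_within_continuous => x.
by rewrite in_itv/= => xts; have [] := dG _ xts.
Qed.

Lemma RI_FTC g G t s : continuous g -> -1 < t -> t <= s ->
  (forall x, t <= x <= s -> is_derive x 1 G (g x)) ->
  RI t s g = G s - G t.
Proof.
move=> cg t1 ts dG; rewrite RI_Ant ?(ltW t1)//.
pose H := fun x => Ant g x - G x.
have dH x : t <= x <= s -> is_derive x 1 H 0.
  move=> /[dup] xts /andP[tx xs].
  have dA := is_derive_Ant cg (lt_le_trans t1 tx).
  have dGx := dG _ xts.
  rewrite -(subrr (g x)); exact: is_deriveB.
have [c _ /eqP] := MVT_segment ts
  (fun x (xts : x \in `]t, s[%R) => dH x
    (subset_itv_oo_cc xts)) (derive_continuous dH).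
rewrite mul0r subr_eq0 /H => /eqP h; lra.
Qed.

Definition avg g : R := RI 0 1 g.

Lemma avgE g G : continuous g -> (forall x : R, is_derive x 1 G (g x)) ->
  avg g = G 1 - G 0.
Proof. by move=> cg dG; apply: RI_FTC => //; rewrite ltrN10. Qed.

Lemma is_derive_comp_aff G (dG m k x : R) : is_derive (m + k * x) 1 G dG ->
  is_derive x 1 (fun y => G (m + k * y)) (k * dG).
Proof.
move=> dGx.
have da : is_derive x 1 (fun y : R => m + k * y) k.
  have := @is_deriveD _ _ _ (cst m) (fun y => k * y) x 1 0 k.
  rewrite add0r; apply.
  rewrite -[X in is_derive _ _ _ X]mulr1; exact: is_deriveZ.
have := @is_derive1_comp _ G (fun y : R => m + k * y) x _ _ dGx da.
by rewrite [_ * k]mulrC.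
Qed.


Lemma is_derive_quotient (f : R -> R) (x df : R) :
  (h^-1 * (f (h + x) - f x)) @[h --> 0^'] --> df -> is_derive x 1 f df.
Proof.
move=> fdf.
have fdf' : h^-1 *: ((f \o shift x) (h *: (1 : R)) - f x) @[h --> 0^'] --> df.
  under eq_fun do rewrite /= [_ *: 1]mulr1.
  exact: fdf.
apply: DeriveDef; first by apply/cvg_ex; exists df.
by apply/cvg_lim => //; exact: fdf'.
Qed.

Lemma quotient_is_derive (f : R -> R) (x df : R) :
  is_derive x 1 f df -> (h^-1 * (f (h + x) - f x)) @[h --> 0^'] --> df.
Proof.
move=> [fd fE].
have := fd; rewrite /derivable -fE /derive.
under eq_fun do rewrite /= [_ *: 1]mulr1.
by [].
Qed.

Lemma is_derive_continuous (f : R -> R) (x df : R) :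
  is_derive x 1 f df -> {for x, continuous f}.
Proof. by move=> [fd _]; exact/differentiable_continuous/derivable1_diffP. Qed.

Lemma avg_mean g : continuous g -> exists2 c, 0 <= c <= 1 & avg g = g c.
Proof.
move=> cg.
have dA (x : R) : 0 <= x <= 1 -> is_derive x 1 (Ant g) (g x).
  by move=> /andP[x0 _]; apply: is_derive_Ant => //; lra.
have [c] := MVT_segment (ler01 : 0 <= 1 :> R)
  (fun x (xts : x \in `]0, 1[%R) => dA x (subset_itv_oo_cc xts)) (derive_continuous dA).
by rewrite in_itv/= => c01 E; exists c => //; rewrite /avg RI_Ant ?lerN10// E subr0 mulr1.
Qed.

Lemma avgD f g : continuous f -> continuous g ->
  avg (fun x => f x + g x) = avg f + avg g.
Proof. by move=> cf cg; apply: RintegralD => //; exact: cont_integrable. Qed.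

Lemma avgB f g : continuous f -> continuous g ->
  avg (fun x => f x - g x) = avg f - avg g.
Proof. by move=> cf cg; apply: RintegralB => //; exact: cont_integrable. Qed.

Lemma avgZ k g : continuous g -> avg (fun x => k * g x) = k * avg g.
Proof. by move=> cg; apply: RintegralZl => //; exact: cont_integrable. Qed.

(** Compactness of the unit interval: each [x] has a neighbourhood on which both [F z'] and [F z]
    are within [e / 2] of [F z x], and finitely many of these suffice. *)
Lemma near_unit_uniform (Z : topologicalType) (F : Z -> R -> R) (z : Z) (e : R) :
  continuous (fun p : Z * R => F p.1 p.2) -> 0 < e ->
  \forall z' \near z, forall x, 0 <= x <= 1 -> `|F z' x - F z x| < e.
Proof.
move=> cF e0.
have nc := (compact_near_coveringP _).1 (@segment_compact R 0 1).
have : \forall z' \near z, `[0, 1] `<=` [set x | `|F z' x - F z x| < e].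
  apply: nc => x _.
  have e20 : 0 < e / 2 by rewrite divr_gt0.
  have /cvgrPdist_lt/(_ _ e20) := cF (z, x).
  move=> [[A B] /= [zA xB] AB].
  exists (B, A) => //= -[x' z'] /= [Bx' Az'].
  have h1 := AB (z', x') (conj Az' Bx').
  have h2 := AB (z, x') (conj (nbhs_singleton zA) Bx').
  move: h1 h2 => /=; rewrite !ltr_norml => /andP[? ?] /andP[? ?]; apply/andP; split; lra.
by apply: filterS => z' h x x01; apply: h; rewrite /= in_itv.
Qed.

Lemma continuous_snd (Z : topologicalType) (F : Z -> R -> R) (z : Z) :
  continuous (fun p : Z * R => F p.1 p.2) -> continuous (F z).
Proof.
move=> cF x P /(cF (z, x)) [[A B] /= [zA xB] AB].
by apply: filterS xB => y By; apply: (AB (z, y)); split => //; exact: nbhs_singleton zA.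
Qed.

Lemma avg_continuous (Z : topologicalType) (F : Z -> R -> R) :
  continuous (fun p : Z * R => F p.1 p.2) -> continuous (fun z => avg (F z)).
Proof.
move=> cF z; apply/cvgrPdist_lt => /= e e0.
apply: filterS (near_unit_uniform z cF e0) => z' h.
have cz := @continuous_snd _ _ z cF; have cz' := @continuous_snd _ _ z' cF.
rewrite distrC -avgB//.
have [|c c01 ->] := @avg_mean (fun x => F z' x - F z x); last exact: h.
by move=> x; apply: cvgB; [exact: cz'|exact: cz].
Qed.

(** Left Riemann sums present an average as a limit of finite sums, through which measurability and
    Jensen's inequality are obtained. *)
Definition rsum (n : nat) g : R := n.+1%:R^-1 * \sum_(i < n.+1) g (i%:R / n.+1%:R).

Lemma grid_unit (n i : nat) : (i <= n.+1)%N -> 0 <= (i%:R / n.+1%:R : R) <= 1.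
Proof.
by move=> iN; rewrite divr_ge0//= ler_pdivrMr ?ltr0n// mul1r ler_nat.
Qed.

Lemma near_unif_osc g (e : R) : continuous g -> 0 < e ->
  \forall n \near \oo, forall x, 0 <= x <= 1 ->
    forall y, `|y - x| <= n.+1%:R^-1 -> `|g y - g x| < e.
Proof.
move=> cg e0.
have nc := (compact_near_coveringP _).1 (@segment_compact R 0 1).
have : \forall n \near \oo, `[0, 1] `<=`
    [set x | forall y, `|y - x| <= n.+1%:R^-1 -> `|g y - g x| < e].
  apply: nc => x _.
  have e20 : 0 < e / 2 by rewrite divr_gt0.
  have /cvgrPdist_lt/(_ _ e20)/nbhs_ballP[d /= d0 dP] := cg x.
  have d20 : 0 < d / 2 by rewrite divr_gt0.
  have [N _ NP] := @near_infty_natSinv_lt R (PosNum d20).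
  exists (ball x (d / 2), [set n | (N <= n)%N]).
    by split => /=; [exact: nbhsx_ballx|exists N].
  move=> [x' n] /= [xx' Nn] y yx'.
  have nd := NP _ Nn; rewrite /= in nd.
  rewrite -ball_normE /= in xx'.
  have h1 : `|g x - g x'| < e / 2.
    by apply: dP; rewrite -ball_normE /=; apply: lt_trans xx' _; lra.
  have h2 : `|g x - g y| < e / 2.
    apply: dP; rewrite -ball_normE /=.
    rewrite (_ : x - y = (x - x') - (y - x')); last by ring.
    apply: le_lt_trans (ler_normB _ _) _; rewrite [ltRHS]splitr.
    by apply: ltrD => //; exact: le_lt_trans yx' nd.
  rewrite (_ : g y - g x' = (g x - g x') - (g x - g y)); last by ring.
  by apply: le_lt_trans (ler_normB _ _) _; rewrite [ltRHS]splitr; exact: ltrD.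
by apply: filterS => n h x x01; apply: h; rewrite /= in_itv.
Qed.

Lemma cvg_rsum g : continuous g -> rsum n g @[n --> \oo] --> avg g.
Proof.
move=> cg; apply/cvgrPdist_le => /= e e0.
apply: filterS (near_unif_osc cg e0) => n osc.
have N0 : 0 < n.+1%:R :> R by rewrite ltr0n.
have avgS : avg g = \sum_(i < n.+1)
    (Ant g (i.+1%:R / n.+1%:R) - Ant g (i%:R / n.+1%:R)).
  rewrite -(big_mkord xpredT (fun i => Ant g (i.+1%:R / n.+1%:R) - Ant g (i%:R / n.+1%:R))).
  rewrite telescope_sumr// mul0r divff ?gt_eqF//.
  by rewrite /avg RI_Ant// lerN10.
rewrite avgS /rsum mulr_sumr -sumrB.
apply: le_trans (ler_norm_sum _ _ _) _.
have -> : e = \sum_(i < n.+1) n.+1%:R^-1 * e.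
  by rewrite sumr_const card_ord -(mulr_natl (_ * _)) mulrA divff ?mul1r// gt_eqF.
apply: ler_sum => i _.
have li : i%:R / n.+1%:R <= i.+1%:R / n.+1%:R :> R.
  by rewrite ler_pM2r ?invr_gt0// ler_nat.
have [i0 i1] : 0 <= i%:R / n.+1%:R :> R /\ i%:R / n.+1%:R <= 1 :> R.
  by apply/andP/grid_unit/ltnW.
have dA (x : R) : i%:R / n.+1%:R <= x <= i.+1%:R / n.+1%:R ->
    is_derive x 1 (Ant g) (g x).
  move=> /andP[x0 _]; apply: is_derive_Ant => //.
  by apply: lt_le_trans (le_trans i0 x0); rewrite ltrN10.
have [c] := MVT_segment li
  (fun x (xts : x \in `]_, _[%R) => dA x (subset_itv_oo_cc xts)) (derive_continuous dA).
rewrite in_itv/= => /andP[c0 c1] ->.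
have -> : i.+1%:R / n.+1%:R - i%:R / n.+1%:R = n.+1%:R^-1 :> R.
  by rewrite -mulrBl -natrB// subSnn mul1r.
rewrite mulrC -mulrBr normrM gtr0_norm ?invr_gt0// ler_pM2l ?invr_gt0//.
apply/ltW/osc; first by rewrite i0.
rewrite ger0_norm ?subr_ge0//.
by rewrite lerBlDl; move: c1; rewrite -(natr1 i) mulrDl mul1r.
Qed.

Lemma RI_avg g t s : continuous g -> -1 < t -> t <= s ->
  RI t s g = (s - t) * avg (fun x => g (t + (s - t) * x)).
Proof.
move=> cg t1 ts; have caff : continuous (fun x : R => g (t + (s - t) * x)).
  move=> x; apply: (cvg_comp (fun x => t + (s - t) * x) g); last exact: cg.
  by apply: cvgD; [exact: cvg_cst|apply: cvgM; [exact: cvg_cst|exact: cvg_id]].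
rewrite -avgZ//.
have -> : avg (fun x => (s - t) * g (t + (s - t) * x)) =
    Ant g (t + (s - t) * 1) - Ant g (t + (s - t) * 0).
  apply: (@RI_FTC _ (fun x => Ant g (t + (s - t) * x))) => //; last first.
  - move=> x /andP[x0 x1]; apply: is_derive_comp_aff; apply: is_derive_Ant => //.
    by apply: lt_le_trans t1 _; rewrite lerDl mulr_ge0// subr_ge0.
  - by move=> x; apply: cvgM; [exact: cvg_cst|exact: caff].
by rewrite mulr0 addr0 mulr1 subrKC RI_Ant// ltW.
Qed.

(** Mean value theorems are used twice: in the averaged variable, giving [c], then in the parameter,
    giving [u] between [x] and [h + x]. The point [c] depends on [h], which is harmless because the
    continuity of [F'] in its parameter is uniform over the unit interval. *)
Lemma is_derive_avg (F F' : R -> R -> R) (x : R) :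
  (forall x, continuous (F x)) -> continuous (fun p : R * R => F' p.1 p.2) ->
  (forall x y : R, is_derive x 1 (F^~ y) (F' x y)) ->
  is_derive x 1 (fun x => avg (F x)) (avg (F' x)).
Proof.
move=> cF cF' dF; apply: is_derive_quotient; apply/cvgrPdist_lt => /= e e0.
have /nbhs_ballP[d /= d0 dP] := near_unit_uniform x cF' e0.
have cx' := @continuous_snd _ _ x cF'.
apply/nbhs_ballP; exists d => //= h; rewrite -ball_normE/= sub0r normrN => hd h0.
have cq : continuous (fun y => h^-1 * (F (h + x) y - F x y)).
  by move=> y; apply: cvgM; [exact: cvg_cst|apply: cvgB; exact: cF].
rewrite -avgB// -avgZ; last by move=> y; apply: cvgB; exact: cF.
rewrite -avgB//.
have [|c c01 ->] := @avg_mean (fun y => F' x y - h^-1 * (F (h + x) y - F x y)).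
  by move=> y; apply: cvgB; [exact: cx'|exact: cq].
have [u ux ->] : exists2 u, `|u - x| <= `|h| & F (h + x) c - F x c = F' u c * h.
  have cont a b : {within `[a, b], continuous (F^~ c)}.
    by apply: derive_continuous => z _; exact: dF.
  case: (ltP 0 h) => h00.
    have [|u] := @MVT_segment _ (F^~ c) (F'^~ c) x (h + x) _ (fun z _ => dF z c) (cont _ _).
      by rewrite lerDr ltW.
    rewrite in_itv/= => /andP[xu uh] ->; exists u; last by rewrite addrK.
    by rewrite !ger0_norm ?subr_ge0 ?(ltW h00)// lerBlDr.
  have [|u] := @MVT_segment _ (F^~ c) (F'^~ c) (h + x) x _ (fun z _ => dF z c) (cont _ _).
    by rewrite gerDr.
  rewrite in_itv/= => /andP[hu ux] E; exists u; last first.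
    by apply: oppr_inj; rewrite opprB E; ring.
  by rewrite !ler0_norm ?subr_le0// lerN2 lerBrDr.
rewrite mulrC -mulrA divff// mulr1 distrC; apply: dP => //.
by rewrite -ball_normE/= distrC (le_lt_trans ux).
Qed.

End antiderivative.

(** * Power series negligible to double factorial *)

Section power_series.
Context {R : realType}.
Implicit Types (p : nat -> R) (x y e K : R).

(* Consequence of negligibility to double factorial which, unlike the latter, is
   visibly stable under differentiation and squaring. *)
Definition superexp p := forall e, 0 < e ->
  exists2 K : R, 0 <= K & forall k, `|p k| <= K * e ^+ k / (k./2)`!%:R.

(** Passing from [k] to [k + 2] multiplies [(k./2)!] by [k./2 + 1] and the double factorial by
    [k + 1], which is at least as large. *)
Lemma dfact_m1_ge k : (0 < dfact_m1 k)%N && ((k./2)`! <= dfact_m1 k)%N.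
Proof.
elim/ltn_ind: k => -[//|[//|k]] IH.
have /andP[k0 kf] := IH k (leqW (leqnn _)).
rewrite [dfact_m1 _]/= muln_gt0 k0/= factS leq_mul//.
by rewrite ltnS -divn2 leq_div.
Qed.

Lemma negligible_df_superexp p : negligible_df p -> superexp p.
Proof.
rewrite /negligible_df limn_esup_lim => lim0 e e0.
set u := (fun k : nat => _) in lim0.
have cu : esups u @ \oo --> 0%E by rewrite -lim0; exact: is_cvg_esups.
have [N _ NP] : \forall n \near \oo, (esups u n < e%:E)%E.
  by apply: (cu [set y | (y < e%:E)%E]); exact: (@nbhs_open_ereal_lt _ 0 (fun=> e)).
have f0 k : 0 < (k./2)`!%:R :> R by rewrite ltr0n fact_gt0.
(* Index 0 is excluded: there the exponent [k%:R^-1] is 0 by convention, so the root carries no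
   information about the coefficient. *)
have bnd k : (maxn N 1 <= k)%N -> `|p k| <= e ^+ k / (k./2)`!%:R.
  rewrite geq_max => /andP[Nk k1].
  have := NP _ (leqnn _ : N <= N)%N; rewrite /= => esN.
  have : (u k < e%:E)%E.
    by apply: le_lt_trans esN; apply: ereal_sup_ubound; exists k.
  rewrite /u lte_fin => uk.
  have a0 : 0 <= `|p k| * (dfact_m1 k)%:R by rewrite mulr_ge0.
  have : `|p k| * (dfact_m1 k)%:R <= e ^+ k.
    have -> : `|p k| * (dfact_m1 k)%:R =
        ((`|p k| * (dfact_m1 k)%:R) `^ (k%:R^-1)) ^+ k.
      by rewrite -powR_mulrn ?powR_ge0// -powRrM mulVf ?powRr1// pnatr_eq0 -lt0n.
    by rewrite lerXn2r ?nnegrE ?powR_ge0// ltW.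
  rewrite ler_pdivlMr//; apply: le_trans; rewrite ler_wpM2l// ler_nat.
  by have /andP[] := dfact_m1_ge k.
(* [S] adds up the constants that the finitely many remaining coefficients require. *)
pose S := \sum_(k < maxn N 1) `|p k| * (k./2)`!%:R / e ^+ k.
have S0 : 0 <= S by apply: sumr_ge0 => i _; rewrite !mulr_ge0 ?invr_ge0 ?exprn_ge0// ltW.
exists (1 + S); first by rewrite addr_ge0.
move=> k; have [kN|Nk] := ltnP k (maxn N 1); last first.
  apply: le_trans (bnd _ Nk) _; rewrite ler_pM2r ?invr_gt0// ler_peMl ?exprn_ge0 ?(ltW e0)//.
  by rewrite lerDl.
rewrite ler_pdivlMr// -ler_pdivrMr ?exprn_gt0//.
rewrite /S (bigD1 (Ordinal kN))//= addrCA lerDl addr_ge0// sumr_ge0// => i _.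
by rewrite !mulr_ge0 ?invr_ge0 ?exprn_ge0// ltW.
Qed.

(** Differentiation multiplies coefficients by [k + 1], at most [2 ^ k], which is paid for by
    starting from [e / 2]. *)
Lemma superexp_diffs p : superexp p -> superexp (pseries_diffs p).
Proof.
move=> sp e e0; have e20 : 0 < e / 2 by rewrite divr_gt0.
have [K K0 KP] := sp _ e20; exists (K * (e / 2)).
  by rewrite mulr_ge0// ltW.
move=> k; rewrite /pseries_diffs normrM ger0_norm//.
have f0 j : 0 < (j./2)`!%:R :> R by rewrite ltr0n fact_gt0.
apply: le_trans (ler_wpM2l _ (KP _)) _ => //.
rewrite [leLHS]mulrA; apply: ler_pM => //.
- by rewrite !mulr_ge0// exprn_ge0 ?ltW.
- rewrite exprS expr_div_n -exprVn !mulrA [leRHS]mulrC ![_%:R * _]mulrC.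
  rewrite [leLHS](_ : _ = e ^+ k * K * (e / 2) * (k.+1%:R * 2^-1 ^+ k)); last by ring.
  rewrite !mulrA -[leRHS]mulr1 [leLHS](_ : _ = e ^+ k * K * e / 2 * (k.+1%:R * 2^-1 ^+ k)); last by ring.
  apply: ler_wpM2l; first by rewrite !mulr_ge0 ?exprn_ge0 ?invr_ge0// ltW.
  by rewrite exprVn ler_pdivrMr ?exprn_gt0// mul1r -natrX ler_nat ltn_expl.
- by rewrite lef_pV2 ?posrE// ler_nat leq_fact// half_leq.
Qed.

(** With [m] and [n] the two halves, [k./2] is [m + n] or [m + n + 1]. The binomial coefficient of
    [m + n] over [m] is at most [2 ^ k], and the factor [k + 1] covers the unit lost when both parts
    are odd. *)
Lemma fact_half_le i k : (i <= k)%N ->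
  ((k./2)`! <= k.+1 * 2 ^ k * ((i./2)`! * ((k - i)./2)`!))%N.
Proof.
move=> ik; set m := i./2; set n := (k - i)./2.
have mk : (m + n <= k./2)%N by rewrite /m /n; lia.
have km : (k./2 <= (m + n).+1)%N by rewrite /m /n; lia.
have h1 : ((m + n)`! <= 2 ^ k * (m`! * n`!))%N.
  rewrite -(@bin_fact (m + n) m) ?leq_addr// addKn leq_mul//.
  apply: leq_trans (_ : 2 ^ (m + n) <= _)%N; last by rewrite leq_pexp2l//; lia.
  rewrite -[X in (_ <= X ^ _)%N]/(1 + 1)%N expnDn.
  have mo : (m < (m + n).+1)%N by rewrite ltnS leq_addr.
  by rewrite (bigD1 (Ordinal mo))//= !exp1n !muln1 leq_addr.
apply: leq_trans (_ : k.+1 * (m + n)`! <= _)%N; last by rewrite -mulnA leq_mul2l h1 orbT.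
apply: leq_trans (leq_fact km) _.
by rewrite factS leq_mul2r ltnS (leq_trans mk) ?orbT//; lia.
Qed.

(** The loss [8 ^ k] is [2 ^ k] from the factorials and [4 ^ k] for [(k + 1) ^ 2]: one [k + 1]
    counts the terms of the convolution, the other comes from [fact_half_le]. *)
Lemma superexp_sq p : superexp p -> superexp (pser_sq p).
Proof.
move=> sp e e0; have e80 : 0 < e / 8 by rewrite divr_gt0.
have [K K0 KP] := sp _ e80; exists (K ^+ 2); first exact: sqr_ge0.
move=> k; have f0 j : 0 < (j./2)`!%:R :> R by rewrite ltr0n fact_gt0.
apply: le_trans (ler_norm_sum _ _ _) _.
have bnd (i : 'I_k.+1) : `|p i * p (k - i)%N| <=
    K ^+ 2 * (e / 8) ^+ k * (k.+1%:R * 2 ^+ k / (k./2)`!%:R).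
  rewrite normrM; apply: le_trans (ler_pM _ _ (KP _) (KP _)) _ => //.
  have ik : (i <= k)%N by rewrite -ltnS.
  rewrite [leLHS](_ : _ = K ^+ 2 * ((e / 8) ^+ i * (e / 8) ^+ (k - i)) *
     ((i./2)`!%:R^-1 * ((k - i)./2)`!%:R^-1)); last by ring.
  rewrite -exprD subnKC//; apply: ler_wpM2l.
    by rewrite mulr_ge0 ?sqr_ge0// exprn_ge0// ltW.
  rewrite -invfM ler_pdivlMr// mulrC ler_pdivrMr ?mulr_gt0//.
  by rewrite -natrX -!natrM ler_nat fact_half_le.
apply: le_trans (ler_sum _ (fun i _ => bnd i)) _.
rewrite sumr_const card_ord -[leLHS]mulr_natl.
rewrite [leLHS](_ : _ = K ^+ 2 * ((e / 8) ^+ k * (k.+1%:R ^+ 2 * 2 ^+ k)) / (k./2)`!%:R); last by ring.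
rewrite ler_pM2r ?invr_gt0// ler_wpM2l ?sqr_ge0//.
rewrite expr_div_n -mulrA ler_piMr ?exprn_ge0 ?(ltW e0)//.
rewrite ler_pdivrMl ?exprn_gt0// mulr1.
have -> : 8 ^+ k = (2 ^+ k) ^+ 2 * 2 ^+ k :> R.
  by rewrite -exprM -exprD [(k * 2)%N]mulnC -mulSnr exprM; congr (_ ^+ _); ring.
rewrite ler_pM2r ?exprn_gt0// lerXn2r ?nnegrE//.
by rewrite -natrX ler_nat ltn_expl.
Qed.

(** Pairing the indices [2j] and [2j + 1] gives [1 + y] times a partial exponential series at
    [y ^ 2]; then [1 + y <= exp y] and [y <= 1 + y ^ 2]. *)
Lemma sum_half_fact_le y n : 0 <= y ->
  \sum_(k < n) y ^+ k / (k./2)`!%:R <= expR (1 + 2 * y ^+ 2).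
Proof.
move=> y0; have f0 j : 0 < (j`!)%:R :> R by rewrite ltr0n fact_gt0.
apply: le_trans (_ : \sum_(k < n.*2) y ^+ k / (k./2)`!%:R <= _).
  rewrite -!(big_mkord xpredT (fun k => y ^+ k / (k./2)`!%:R)).
  rewrite [leRHS](@big_cat_nat _ _ _ n)//=; last by rewrite -addnn leq_addr.
  by rewrite lerDl sumr_ge0// => i _; rewrite divr_ge0// exprn_ge0.
have -> : \sum_(k < n.*2) y ^+ k / (k./2)`!%:R =
    (1 + y) * series (exp_coeff (y ^+ 2)) n.
  elim: n => [|n IH]; first by rewrite /series/= !big_ord0 big_geq// mulr0.
  rewrite doubleS !big_ord_recr/= IH seriesSr mulrDr -addrA; congr (_ + _).
  rewrite /exp_coeff/= uphalf_double doubleK exprS -!exprM mul2n; ring.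
apply: le_trans (_ : (1 + y) * expR (y ^+ 2) <= _).
  apply: ler_wpM2l; first by rewrite addr_ge0.
  apply: nondecreasing_cvgn_le; last exact: is_cvg_series_exp_coeff.
  apply/nondecreasing_seqP => m; rewrite seriesSr lerDl.
  by rewrite /exp_coeff divr_ge0// exprn_ge0// sqr_ge0.
apply: le_trans (_ : expR y * expR (y ^+ 2) <= _).
  by rewrite ler_wpM2r ?expR_ge0// expR_ge1Dx.
rewrite -expRD ler_expR; nra.
Qed.

Lemma superexp_partial p : superexp p -> forall e, 0 < e -> exists2 K : R, 0 <= K &
  forall x n, \sum_(k < n) `|p k * x ^+ k| <= K * expR (e * x ^+ 2).
Proof.
(* This [d] solves [2 * (d * x) ^ 2 = e * x ^ 2], the exponent produced by [sum_half_fact_le]. *)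
move=> sp e e0; pose d := Num.sqrt (e / 2).
have d0 : 0 < d by rewrite sqrtr_gt0 divr_gt0.
have [K K0 KP] := sp _ d0; exists (K * expR 1); first by rewrite mulr_ge0 ?expR_ge0.
move=> x n; apply: le_trans (_ : K * \sum_(k < n) (d * `|x|) ^+ k / (k./2)`!%:R <= _).
  rewrite mulr_sumr; apply: ler_sum => k _; rewrite normrM normrX.
  apply: le_trans (ler_wpM2r _ (KP k)) _; first exact: exprn_ge0.
  by rewrite exprMn le_eqVlt; apply/orP; left; apply/eqP; ring.
rewrite -mulrA ler_wpM2l//; apply: le_trans (sum_half_fact_le _ _) _.
  by rewrite mulr_ge0// ltW.
rewrite exprMn sqr_sqrtr ?divr_ge0 ?(ltW e0)// real_normK ?num_real// -expRD.
by rewrite [2 * _](_ : _ = e * x ^+ 2)//; field.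
Qed.

Lemma superexp_cvg p x : superexp p -> cvgn (pseries p x).
Proof.
move=> sp; have [K _ KP] := superexp_partial sp ltr01.
apply: normed_cvg; apply: nondecreasing_is_cvgn.
  by apply/nondecreasing_seqP => n; rewrite /= seriesSr lerDl.
exists (K * expR (1 * x ^+ 2)) => _ [n _ <-].
by rewrite /normed_series_of/= /series/= big_mkord; exact: KP.
Qed.

Lemma pser_growth p : superexp p -> forall e, 0 < e ->
  exists2 K : R, 0 <= K & forall x, `|pser p x| <= K * expR (e * x ^+ 2).
Proof.
move=> sp e e0; have [K K0 KP] := superexp_partial sp e0; exists K => // x.
have cN : `|pseries p x n| @[n --> \oo] --> `|pser p x|.
  by apply: cvg_norm; exact: superexp_cvg.
apply: (cvgr_to_le cN); apply: nearW => n; rewrite /pseries/series/= big_mkord.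
by apply: le_trans (ler_norm_sum _ _ _) (KP _ _).
Qed.

Lemma is_derive_pser p x : superexp p ->
  is_derive x 1 (pser p) (pser (pseries_diffs p) x).
Proof.
move=> sp; apply: (@pseries_snd_diffs _ _ (`|x| + 1)).
- exact: superexp_cvg.
- exact/superexp_cvg/superexp_diffs.
- exact/superexp_cvg/superexp_diffs/superexp_diffs.
- by rewrite [ltRHS]ger0_norm ?addr_ge0// ltrDl.
Qed.

Lemma triangular_sum (f : nat -> R) n :
  \sum_(k < n) \sum_(i < k.+1) f i * f (k - i)%N =
  \sum_(i < n) f i * \sum_(j < n - i) f j.
Proof.
elim: n => [|n IH]; first by rewrite !big_ord0.
rewrite big_ord_recr/= IH big_ord_recr [in RHS]big_ord_recr/=.
rewrite !subSnn big_ord1 subnn addrA; congr (_ + _).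
rewrite -big_split/=; apply: eq_bigr => i _.
by rewrite subSn 1?ltnW// big_ord_recr/= mulrDr.
Qed.

(** Cauchy product. Its purpose is the sign of [p1]: a square of a real series is nonnegative
    pointwise, so the exponent has nonpositive real part. *)
Lemma pser_sqE p x : superexp p -> pser (pser_sq p) x = pser p x ^+ 2.
Proof.
move=> sp; pose a k := p k * x ^+ k.
have cS := superexp_cvg (x:=x) sp.
have cQ := superexp_cvg (x:=x) (superexp_sq sp).
(* This exponent makes the terms at [x] decay like [16 ^- k]; adding 1 keeps the inverse meaningful
   at [x = 0]. *)
have e0 : 0 < (16 * (`|x| + 1))^-1 by rewrite invr_gt0 mulr_gt0// ltr_wpDl.
have [K K0 KP] := sp _ e0.
have ak k : `|a k| <= K * 16^-1 ^+ k.
  rewrite /a normrM normrX; apply: le_trans (ler_wpM2r _ (KP _)) _; first exact: exprn_ge0.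
  rewrite [leLHS](_ : _ = K * 16^-1 ^+ k *
      ((`|x| / (`|x| + 1)) ^+ k * (k./2)`!%:R^-1)); last first.
    by rewrite invfM !exprMn; ring.
  have x1 : `|x| / (`|x| + 1) <= 1.
    by rewrite ler_pdivrMr ?mul1r ?lerDl// ltr_wpDl.
  have x0 : 0 <= `|x| / (`|x| + 1) by rewrite divr_ge0// addr_ge0.
  rewrite ler_piMr ?mulr_ge0 ?exprn_ge0 ?invr_ge0//.
  rewrite mulr_ile1 ?exprn_ge0 ?invr_ge0 ?exprn_ile1//.
  by rewrite invf_le1 ?ltr0n ?fact_gt0// ler1n fact_gt0.
have QE n : pseries (pser_sq p) x n = \sum_(i < n) a i * \sum_(j < n - i) a j.
  rewrite -triangular_sum /pseries/series/= big_mkord; apply: eq_bigr => k _.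
  rewrite /pser_sq mulr_suml; apply: eq_bigr => i _.
  have ik : (i <= k)%N by rewrite -ltnS.
  by rewrite /a mulrACA -exprD subnKC.
have SE n : pseries p x n = \sum_(i < n) a i by rewrite /pseries/series/= big_mkord.
(* The square of the partial sum exceeds the partial Cauchy product by at most [n ^ 2] terms with
   [i + j >= n], each at most [K ^ 2 * 16 ^- n], and [n ^ 2 <= 4 ^ n]. *)
have diff n : `|pseries p x n ^+ 2 - pseries (pser_sq p) x n| <= K ^+ 2 * 4^-1 ^+ n.
  rewrite QE SE expr2 mulr_suml -sumrB; apply: le_trans (ler_norm_sum _ _ _) _.
  have bnd (i : 'I_n) : `|a i * \sum_(j < n) a j - a i * \sum_(j < n - i) a j| <=
      n%:R * (K ^+ 2 * 16^-1 ^+ n).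
    rewrite -mulrBr -!(big_mkord xpredT a) (@big_cat_nat _ _ _ (n - i))//= ?leq_subr//.
    rewrite addrAC subrr add0r mulr_sumr; apply: le_trans (ler_norm_sum _ _ _) _.
    apply: le_trans (_ : \sum_(n - i <= j < n) (K ^+ 2 * 16^-1 ^+ n) <= _); last first.
      rewrite sumr_const_nat -[leLHS]mulr_natl ler_wpM2r ?mulr_ge0 ?sqr_ge0 ?exprn_ge0 ?invr_ge0//.
      by rewrite ler_nat leq_subr.
    rewrite big_nat_cond [leRHS]big_nat_cond; apply: ler_sum => j /andP[/andP[nij jn] _].
    rewrite normrM; apply: le_trans (ler_pM _ _ (ak _) (ak _)) _ => //.
    rewrite mulrACA -expr2 -exprD ler_wpM2l ?sqr_ge0// ler_wiXn2l ?invr_ge0//.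
      by rewrite invf_le1// ler1n.
    by rewrite -leq_subLR.
  apply: le_trans (ler_sum _ (fun i _ => bnd i)) _.
  rewrite sumr_const card_ord -[leLHS]mulr_natl.
  have -> : 16^-1 ^+ n = 4^-1 ^+ n * (2^-1 ^+ n) ^+ 2 :> R.
    by rewrite -exprM mulnC exprM -exprMn; congr (_ ^+ _); field.
  rewrite [leLHS](_ : _ = K ^+ 2 * 4^-1 ^+ n * (n%:R * 2^-1 ^+ n) ^+ 2); last by ring.
  rewrite ler_piMr ?mulr_ge0 ?sqr_ge0 ?exprn_ge0 ?invr_ge0//.
  rewrite exprn_ile1 ?mulr_ge0 ?exprn_ge0 ?invr_ge0//.
  by rewrite exprVn ler_pdivrMr ?exprn_gt0// mul1r -natrX ler_nat ltnW// ltn_expl.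
apply/esym/eqP; rewrite -subr_eq0; apply/eqP.
have c1 : pseries p x n ^+ 2 - pseries (pser_sq p) x n @[n --> \oo] -->
    pser p x ^+ 2 - pser (pser_sq p) x.
  by apply: cvgB; [apply: cvgM; exact: cS|exact: cQ].
have c2 : K ^+ 2 * 4^-1 ^+ n @[n --> \oo] --> 0.
  rewrite -[0](mulr0 (K ^+ 2)); apply: cvgM; first exact: cvg_cst.
  by apply: cvg_expr; rewrite ger0_norm ?invr_ge0// invf_lt1// ltr1n.
have c0 : pseries p x n ^+ 2 - pseries (pser_sq p) x n @[n --> \oo] --> 0.
  apply/norm_cvg0P; apply: (squeeze_cvgr _ (cvg_cst 0) c2).
  by apply: nearW => n; rewrite normr_ge0 diff.
exact: (cvg_unique _ c1 c0).
Qed.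

End power_series.

(** * Families with bounded moments *)

Section moment_families.
Context {R : realType} {d : measure_display} {Omega : measurableType d}.
Variable P : probability Omega R.
Implicit Types (f g : Omega -> R) (phi psi : R -> R) (K M e : R).

(** Extended-valued, for bounds on nonnegative functions before integrability is known; [mE] is its
    finite counterpart, used for limits and linearity. *)
Definition eE f : \bar R := (\int[P]_w (f w)%:E)%E.
Definition mE f : R := Rintegral P setT f.
Notation mfun f := (measurable_fun setT f).

Lemma eE_le f g : mfun f -> mfun g -> (forall w, 0 <= f w <= g w) ->
  (eE f <= eE g)%E.
Proof.
move=> mf mg fg; apply: ge0_le_integral => //.
- by move=> w _; rewrite lee_fin; have /andP[] := fg w.
- exact/measurable_EFinP.
- exact/measurable_EFinP.
- by move=> w _; rewrite lee_fin; have /andP[] := fg w.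
Qed.

Lemma eE_D f g : mfun f -> mfun g -> (forall w, 0 <= f w) -> (forall w, 0 <= g w) ->
  eE (fun w => f w + g w) = (eE f + eE g)%E.
Proof.
move=> mf mg f0 g0; rewrite /eE -ge0_integralD//.
- by move=> w _; rewrite lee_fin.
- exact/measurable_EFinP.
- by move=> w _; rewrite lee_fin.
- exact/measurable_EFinP.
Qed.

Lemma eE_Z (k : R) f : mfun f -> 0 <= k -> (forall w, 0 <= f w) ->
  eE (fun w => k * f w) = (k%:E * eE f)%E.
Proof.
move=> mf k0 f0; rewrite /eE -ge0_integralZl_EFin//.
- by move=> w _; rewrite lee_fin.
- exact/measurable_EFinP.
Qed.

Lemma eE_cst (k : R) : eE (fun=> k) = k%:E.
Proof. by rewrite /eE (integral_cst P measurableT k%:E) [X in (_ * X)%E]probability_setT mule1. Qed.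

Lemma eE_fatou (f_ : nat -> Omega -> R) f K : (forall n, mfun (f_ n)) ->
  (forall n w, 0 <= f_ n w) -> (forall w, f_ n w @[n --> \oo] --> f w) ->
  (forall n, (eE (f_ n) <= K%:E)%E) -> (eE f <= K%:E)%E.
Proof.
move=> mf f0 cf fK.
have -> : eE f = (\int[P]_w limn_einf (fun n => (f_ n w)%:E))%E.
  apply: eq_integral => w _; apply/esym.
  have cw : (f_ n w)%:E @[n --> \oo] --> (f w)%:E by apply: cvg_EFin; [exact: nearW|exact: cf].
  by rewrite (cvg_limn_einf_sup cw).1.
apply: (@le_trans _ _ (limn_einf (fun n => eE (f_ n)))).
  apply: fatou => // [n|n w _]; first exact/measurable_EFinP.
  by rewrite lee_fin.
rewrite limn_einf_lim; apply: lime_le; first exact: is_cvg_einfs.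
apply: nearW => n; apply: le_trans (fK n).
by apply: ereal_inf_lbound; exists n => /=.
Qed.

(* Bounds that are uniform over an arbitrary index type: sequences serve for
   passing to the limit, the index [I * unit_itv] for averages of a process. *)
Definition bdd_mom phi (I : Type) (z : I -> Omega -> R) :=
  exists K, forall i, (eE (fun w => phi (z i w)) <= K%:E)%E.

(** Even powers, written [(x ^+ 2) ^+ k], are nonnegative and convex without absolute values. The
    class is closed under sums and products, as the induction over expressions requires. *)
Definition BddF (I : Type) (z : I -> Omega -> R) :=
  (forall i, mfun (z i)) /\ forall k, bdd_mom (fun x => (x ^+ 2) ^+ k) z.

(** One exponent [e] serves the whole family. The class is closed under sums and bounded factors but
    not under products, hence the separate class [BddF]. *)
Definition SubG (I : Type) (z : I -> Omega -> R) :=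
  (forall i, mfun (z i)) /\
  exists2 e : R, 0 < e & bdd_mom (fun x => expR (e * x ^+ 2)) z.

Lemma mfun_comp phi f : continuous phi -> mfun f -> mfun (fun w => phi (f w)).
Proof.
by move=> cphi mf; apply: (measurableT_comp _ mf); exact: continuous_measurable_fun.
Qed.

Lemma continuous_powk k : continuous (fun x : R => (x ^+ 2) ^+ k).
Proof.
by move=> x; apply: (cvg_comp (fun x : R => x ^+ 2) (fun x => x ^+ k)); exact: exprn_continuous.
Qed.

Lemma continuous_gauss e : continuous (fun x : R => expR (e * x ^+ 2)).
Proof.
move=> x; apply: (cvg_comp (fun x : R => e * x ^+ 2) expR); last exact: continuous_expR.
by apply: cvgM; [exact: cvg_cst|exact: exprn_continuous].
Qed.

Lemma powk_ge0 k (x : R) : 0 <= (x ^+ 2) ^+ k.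
Proof. by rewrite exprn_ge0// sqr_ge0. Qed.

(** Domination; the map [r] lets the dominating family have fewer indices, for instance none for an
    averaging variable. *)
Lemma bdd_mom_le phi psi I J (z : I -> Omega -> R) (y : J -> Omega -> R) (r : I -> J) M :
  0 <= M -> continuous phi -> continuous psi ->
  (forall i, mfun (z i)) -> (forall i, mfun (y i)) ->
  (forall x, 0 <= phi x) -> (forall x, 0 <= psi x) ->
  (forall i w, phi (z i w) <= M * psi (y (r i) w)) ->
  bdd_mom psi y -> bdd_mom phi z.
Proof.
move=> M0 cphi cpsi mz my phi0 psi0 le [K KP]; exists (M * K) => i.
apply: (@le_trans _ _ (eE (fun w => M * psi (y (r i) w)))); last first.
  by rewrite eE_Z//; [rewrite EFinM lee_wpmul2l// lee_fin|exact: mfun_comp].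
apply: eE_le; first exact: mfun_comp.
  by apply: measurable_funM => //; exact: mfun_comp.
by move=> w; rewrite phi0 le.
Qed.

Lemma bdd_mom_leD phi psi I J J' (z : I -> Omega -> R)
    (y : J -> Omega -> R) (y' : J' -> Omega -> R) (r : I -> J) (r' : I -> J') M :
  0 <= M -> continuous phi -> continuous psi ->
  (forall i, mfun (z i)) -> (forall i, mfun (y i)) -> (forall i, mfun (y' i)) ->
  (forall x, 0 <= phi x) -> (forall x, 0 <= psi x) ->
  (forall i w, phi (z i w) <= M * (psi (y (r i) w) + psi (y' (r' i) w))) ->
  bdd_mom psi y -> bdd_mom psi y' -> bdd_mom phi z.
Proof.
move=> M0 cphi cpsi mz my my' phi0 psi0 le [K KP] [K' KP']; exists (M * (K + K')) => i.
have m1 j : mfun (fun w => psi (y j w)) by exact: mfun_comp.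
have m2 j : mfun (fun w => psi (y' j w)) by exact: mfun_comp.
apply: (@le_trans _ _ (eE (fun w => M * (psi (y (r i) w) + psi (y' (r' i) w))))).
  apply: eE_le; first exact: mfun_comp.
    by apply: measurable_funM => //; exact: measurable_funD.
  by move=> w; rewrite phi0 le.
rewrite eE_Z//; last 2 first.
- exact: measurable_funD.
- by move=> w; rewrite addr_ge0.
by rewrite EFinM lee_wpmul2l ?lee_fin// eE_D// EFinD leeD.
Qed.

Lemma BddF_le I J (z : I -> Omega -> R) (y : J -> Omega -> R) (r : I -> J) :
  (forall i, mfun (z i)) -> (forall i w, `|z i w| <= `|y (r i) w|) ->
  BddF y -> BddF z.
Proof.
move=> mz le [my by_]; split => // k.
apply: (@bdd_mom_le _ _ _ _ _ _ r 1 _ _ _ _ _ _ _ _ (by_ k)) => //.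
- exact: continuous_powk.
- exact: continuous_powk.
- exact: powk_ge0.
- exact: powk_ge0.
move=> i w; rewrite mul1r lerXn2r ?nnegrE ?sqr_ge0//.
by rewrite -real_normK ?num_real// -[leRHS]real_normK ?num_real// lerXn2r ?nnegrE.
Qed.

Lemma BddF_reindex I J (y : J -> Omega -> R) (r : I -> J) :
  BddF y -> BddF (fun i => y (r i)).
Proof.
move=> By.
exact: (BddF_le (r := r) (fun i => By.1 (r i)) (fun i w => lexx _) By).
Qed.

Lemma BddF_cst I (c : I -> R) M : (forall i, `|c i| <= M) -> BddF (fun i _ => c i).
Proof.
move=> cM; split; first by move=> i; exact: measurable_cst.
move=> k; exists ((M ^+ 2) ^+ k) => i; rewrite eE_cst lee_fin.
rewrite lerXn2r ?nnegrE ?sqr_ge0// -real_normK ?num_real//.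
by rewrite lerXn2r ?nnegrE// (le_trans _ (cM i)).
Qed.

(** The square of a sum is at most 4 times the larger of the two squares, whence the constant
    [4 ^ k]. *)
Lemma BddF_D I (y z : I -> Omega -> R) : BddF y -> BddF z ->
  BddF (fun i w => y i w + z i w).
Proof.
move=> [my By] [mz Bz]; split; first by move=> i; exact: measurable_funD.
move=> k; apply: (@bdd_mom_leD _ _ _ _ _ _ _ _ id id (4 ^+ k) _ _ _ _ _ _ _ _ _ (By k) (Bz k)) => //.
- exact: continuous_powk.
- exact: continuous_powk.
- by move=> i; exact: measurable_funD.
- exact: powk_ge0.
- exact: powk_ge0.
move=> i w /=; set a := y i w; set b := z i w.
wlog ab : a b / a ^+ 2 <= b ^+ 2.
  move=> H; have [|/ltW] := leP (a ^+ 2) (b ^+ 2); first exact: H.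
  by move=> /H; rewrite (addrC b) (addrC (_ ^+ k)).
apply: le_trans (_ : (4 * b ^+ 2) ^+ k <= _).
  have b4 : 0 <= 4 * b ^+ 2 by rewrite pmulr_rge0// sqr_ge0.
  rewrite lerXn2r ?nnegrE ?sqr_ge0//.
  by have := sqr_ge0 (a - b); nra.
by rewrite exprMn ler_wpM2l ?exprn_ge0// lerDr powk_ge0.
Qed.

(** A product is bounded by the sum of the squares, so the moment of index [k] of the product uses
    those of index [2k] of the factors. *)
Lemma BddF_M I (y z : I -> Omega -> R) : BddF y -> BddF z ->
  BddF (fun i w => y i w * z i w).
Proof.
move=> [my By] [mz Bz]; split; first by move=> i; exact: measurable_funM.
move=> k; apply: (@bdd_mom_leD _ _ _ _ _ _ _ _ id id 1 _ _ _ _ _ _ _ _ _ (By (k.*2)) (Bz (k.*2))) => //.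
- exact: continuous_powk.
- exact: continuous_powk.
- by move=> i; exact: measurable_funM.
- exact: powk_ge0.
- exact: powk_ge0.
move=> i w /=; rewrite mul1r !exprMn -muln2 !exprM.
set a := (y i w ^+ 2) ^+ k; set b := (z i w ^+ 2) ^+ k.
by have := sqr_ge0 (a - b); have := sqr_ge0 (a + b); nra.
Qed.

Lemma BddF_N I (y : I -> Omega -> R) : BddF y -> BddF (fun i w => - y i w).
Proof.
move=> By; apply: (BddF_le (r := id) _ _ (By)) => [i|i w]; last by rewrite normrN.
exact: measurable_funN (By.1 i).
Qed.

Lemma BddF_Z I (c : I -> R) M (y : I -> Omega -> R) : (forall i, `|c i| <= M) ->
  BddF y -> BddF (fun i w => c i * y i w).
Proof. by move=> cM; apply: BddF_M; exact: BddF_cst cM. Qed.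

Lemma SubG_le I J (z : I -> Omega -> R) (y : J -> Omega -> R) (r : I -> J) M :
  (forall i, mfun (z i)) -> (forall i w, `|z i w| <= M * `|y (r i) w|) ->
  SubG y -> SubG z.
Proof.
move=> mz le [my [e e0 By]]; split => //.
(* [M] may vanish or have any sign; the shifted absolute value is a positive bound by which to
   divide. *)
have M0 : 0 < `|M| + 1 by rewrite ltr_wpDl.
exists (e / (`|M| + 1) ^+ 2); first by rewrite divr_gt0 ?exprn_gt0.
apply: (@bdd_mom_le _ _ _ _ _ _ r 1 _ _ _ _ _ _ _ _ By) => //.
- exact: continuous_gauss.
- exact: continuous_gauss.
move=> i w; rewrite mul1r ler_expR -mulrA ler_wpM2l ?(ltW e0)//.
rewrite mulrC ler_pdivrMr ?exprn_gt0// -real_normK ?num_real// -[y _ _ ^+ 2]real_normK ?num_real//.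
rewrite -exprMn lerXn2r ?nnegrE ?mulr_ge0 ?addr_ge0//.
apply: le_trans (le i w) _; rewrite mulrC ler_wpM2l//.
by apply: le_trans (ler_norm _) _; rewrite lerDl.
Qed.

Lemma SubG_reindex I J (y : J -> Omega -> R) (r : I -> J) :
  SubG y -> SubG (fun i => y (r i)).
Proof.
move=> By; apply: (SubG_le (r := r) (M := 1) _ _ (By)) => [i|i w].
  exact: By.1.
by rewrite mul1r.
Qed.

Lemma SubG_cst I (c : I -> R) M : (forall i, `|c i| <= M) -> SubG (fun i _ => c i).
Proof.
move=> cM; split; first by move=> i; exact: measurable_cst.
exists 1 => //; exists (expR (M ^+ 2)) => i; rewrite eE_cst lee_fin ler_expR mul1r.
rewrite -real_normK ?num_real//.
by rewrite lerXn2r ?nnegrE// (le_trans _ (cM i)).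
Qed.

(** Since [(a + b) ^ 2] is at most 4 times the larger square, a quarter of the smaller exponent is
    dominated by one of the two exponentials. *)
Lemma SubG_D I (y z : I -> Omega -> R) : SubG y -> SubG z ->
  SubG (fun i w => y i w + z i w).
Proof.
move=> [my [e e0 [K KP]]] [mz [e' e'0 [K' KP']]].
split; first by move=> i; exact: measurable_funD.
pose m := Num.min e e'; have m0 : 0 < m by rewrite lt_min e0.
exists (m / 4); first by rewrite divr_gt0.
exists (K + K') => i; rewrite EFinD.
have mg f c : mfun f -> mfun (fun w => expR (c * f w ^+ 2)).
  by move=> mf; apply: (@mfun_comp (fun x => expR (c * x ^+ 2))) => //; exact: continuous_gauss.
apply: le_trans (leeD (KP i) (KP' i)); rewrite -eE_D; last 4 first.
- exact: mg.
- exact: mg.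
- by move=> w; exact: expR_ge0.
- by move=> w; exact: expR_ge0.
apply: eE_le.
- by apply: (mg (fun w => y i w + z i w)); exact: measurable_funD.
- by apply: measurable_funD; exact: mg.
move=> w; rewrite expR_ge0/=; set a := y i w; set b := z i w.
have me : m <= e by rewrite ge_min lexx.
have me' : m <= e' by rewrite ge_min lexx orbT.
have [ab|/ltW ab] := leP (a ^+ 2) (b ^+ 2).
  apply: le_trans (_ : expR (e' * b ^+ 2) <= _); last by rewrite lerDr expR_ge0.
  rewrite ler_expR; apply: le_trans (ler_wpM2r (sqr_ge0 b) me').
  by rewrite -mulrA ler_wpM2l ?(ltW m0)//; have := sqr_ge0 (a - b); nra.
apply: le_trans (_ : expR (e * a ^+ 2) <= _); last by rewrite lerDl expR_ge0.
rewrite ler_expR; apply: le_trans (ler_wpM2r (sqr_ge0 a) me).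
by rewrite -mulrA ler_wpM2l ?(ltW m0)//; have := sqr_ge0 (a - b); nra.
Qed.

(** The growth hypothesis is used at [e / (2 (k + 1))]: raised to the power [2k], the exponential
    stays below [exp (e x^2)], whose mean is bounded. *)
Lemma BddF_growth I (f : I -> R -> R) (z : I -> Omega -> R) :
  (forall e, 0 < e -> exists K, forall i x, `|f i x| <= K * expR (e * x ^+ 2)) ->
  (forall i, continuous (f i)) -> SubG z -> BddF (fun i w => f i (z i w)).
Proof.
move=> gf cf [mz [e e0 Bz]]; split; first by move=> i; exact: mfun_comp.
move=> k; have e10 : 0 < e / (2 * k.+1%:R) by rewrite divr_gt0// mulr_gt0.
have [K KP] := gf _ e10.
have {Bz} [B BP] := Bz; exists ((K ^+ 2) ^+ k * B) => i.
have mg : mfun (fun w => expR (e * z i w ^+ 2)).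
  by apply: (@mfun_comp (fun x => expR (e * x ^+ 2))) => //; exact: continuous_gauss.
apply: (@le_trans _ _ (eE (fun w => (K ^+ 2) ^+ k * expR (e * z i w ^+ 2)))); last first.
  rewrite eE_Z ?powk_ge0//.
  by rewrite EFinM lee_wpmul2l// lee_fin powk_ge0.
apply: eE_le.
- apply: (@mfun_comp (fun x => (x ^+ 2) ^+ k)); first exact: continuous_powk.
  exact: mfun_comp.
- exact: measurable_funM.
move=> w; rewrite powk_ge0/= ; set x := z i w.
have fx := KP i x.
have KE0 : 0 <= K * expR (e / (2 * k.+1%:R) * x ^+ 2) by exact: le_trans fx.
apply: le_trans (_ : ((K * expR (e / (2 * k.+1%:R) * x ^+ 2)) ^+ 2) ^+ k <= _).
  rewrite lerXn2r ?nnegrE ?sqr_ge0// -real_normK ?num_real//.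
  by rewrite lerXn2r ?nnegrE.
set c := expR _; rewrite [(K * c) ^+ 2]exprMn [(_ * _) ^+ k]exprMn.
rewrite ler_wpM2l ?powk_ge0// -exprM -expRM_natl ler_expR.
rewrite mulrA ler_wpM2r ?sqr_ge0// mulrCA ler_piMr ?(ltW e0)//.
by rewrite ler_pdivrMr ?mulr_gt0// mul1r -natrM ler_nat leq_mul2l leqnSn.
Qed.

End moment_families.

(** * Convexity and averages of processes *)

Section averages.
Context {R : realType}.
Implicit Types (phi : R -> R) (K M e : R).

Definition unit_itv := {x : R | 0 <= x <= 1}.
Definition unit_pt (x : R) (x01 : 0 <= x <= 1) : unit_itv := exist _ x x01.

(** Convexity as a supporting line at each point, the form in which Jensen's inequality follows by
    summing. *)
Definition subgrad phi := forall m : R, exists s : R, forall y : R,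
  phi m + s * (y - m) <= phi y.

(** Summed over the grid, the linear terms of the supporting line at the mean cancel. *)
Lemma subgrad_rsum phi n (g : R -> R) : subgrad phi ->
  phi (rsum n g) <= rsum n (fun x => phi (g x)).
Proof.
move=> /(_ (rsum n g)) [s sP].
have N0 : 0 < n.+1%:R :> R by rewrite ltr0n.
rewrite {2}/rsum ler_pdivlMl//.
have H : \sum_(i < n.+1) (phi (rsum n g) + s * (g (i%:R / n.+1%:R) - rsum n g)) <=
    \sum_(i < n.+1) phi (g (i%:R / n.+1%:R)) by apply: ler_sum => i _; exact: sP.
apply: le_trans H.
rewrite big_split/= sumr_const card_ord -mulr_sumr sumrB sumr_const card_ord.
rewrite -[X in _ + s * (_ - X)]mulr_natl {3}/rsum mulrA divff ?gt_eqF// mul1r subrr mulr0 addr0.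
by rewrite mulr_natl.
Qed.

Lemma subgrad_gauss e : 0 <= e -> subgrad (fun x => expR (e * x ^+ 2)).
Proof.
move=> e0 m; exists (expR (e * m ^+ 2) * (e * (2 * m))) => y.
apply: le_trans (_ : expR (e * m ^+ 2) * (1 + e * (y ^+ 2 - m ^+ 2)) <= _).
  rewrite [leRHS]mulrDr mulr1 lerD2l -!mulrA ler_wpM2l ?expR_ge0// ler_wpM2l//.
  by have := sqr_ge0 (y - m); nra.
apply: le_trans (ler_wpM2l (expR_ge0 _) (expR_ge1Dx _)) _.
by rewrite -expRD -mulrDr addrCA subrr addr0.
Qed.

Lemma pow_tangent (u m : R) k : 0 <= u -> 0 <= m ->
  m ^+ k.+1 + k.+1%:R * m ^+ k * (u - m) <= u ^+ k.+1.
Proof.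
move=> u0 m0; elim: k => [|k IH]; first by rewrite !expr1 expr0 mulr1 mul1r; lra.
rewrite [leRHS]exprS; apply: le_trans (ler_wpM2l u0 IH).
rewrite -subr_ge0 [X in 0 <= X](_ : _ = k.+1%:R * m ^+ k * (u - m) ^+ 2); last first.
  by rewrite -[in k.+2%:R]natr1 !exprS; ring.
by rewrite mulr_ge0 ?sqr_ge0// mulr_ge0// exprn_ge0.
Qed.

Lemma subgrad_powk k : subgrad (fun x => (x ^+ 2) ^+ k).
Proof.
case: k => [|k] m; first by exists 0 => y; rewrite !expr0 mul0r addr0.
exists (k.+1%:R * (m ^+ 2) ^+ k * (2 * m)) => y.
apply: le_trans (pow_tangent k (sqr_ge0 y) (sqr_ge0 m)).
rewrite lerD2l -!mulrA ler_wpM2l// ler_wpM2l ?powk_ge0//.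
by have := sqr_ge0 (y - m); nra.
Qed.

(** The measurable space is a parameter here because the lemma is also applied to the sigma-algebra
    of future Brownian increments. *)
Lemma mfun_avg {d : measure_display} {Omega : measurableType d} (z : R -> Omega -> R) :
  (forall w, continuous (fun x => z x w)) ->
  (forall x, 0 <= x <= 1 -> measurable_fun setT (z x)) ->
  measurable_fun setT (fun w => avg (fun x => z x w)).
Proof.
move=> cz mz.
apply: (@measurable_fun_cvg _ _ _ _ (fun n w => rsum n (fun x => z x w))); last first.
  by move=> w _; exact: cvg_rsum.
move=> n; rewrite /rsum; apply: measurable_funM => //.
by apply: measurable_sum => i; apply: mz; apply: grid_unit; exact/ltnW.
Qed.

Context {d : measure_display} {Omega : measurableType d}.
Variable P : probability Omega R.
Notation mfun f := (measurable_fun setT f).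

(** Jensen's inequality for Riemann sums bounds their moments by the common [K], and Fatou's lemma
    passes to the average. *)
Lemma bdd_mom_avg phi I (z : I -> R -> Omega -> R) : continuous phi -> subgrad phi ->
  (forall x, 0 <= phi x) -> (forall i w, continuous (fun x => z i x w)) ->
  (forall i x, 0 <= x <= 1 -> mfun (z i x)) ->
  bdd_mom P phi (fun p : I * unit_itv => z p.1 (sval p.2)) ->
  bdd_mom P phi (fun i w => avg (fun x => z i x w)).
Proof.
move=> cphi sphi phi0 cz mz [K KP]; exists K => i.
apply: (@eE_fatou _ _ _ _ (fun n w => phi (rsum n (fun x => z i x w)))).
- move=> n; apply: mfun_comp => //; rewrite /rsum; apply: measurable_funM => //.
  by apply: measurable_sum => j; apply: mz; apply: grid_unit; exact/ltnW.
- by move=> n w; exact: phi0.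
- by move=> w; apply: (cvg_comp _ _ (cvg_rsum (cz i w))); exact: cphi.
move=> n.
have gu (j : 'I_n.+1) : 0 <= (j%:R / n.+1%:R : R) <= 1 by apply: grid_unit; exact/ltnW.
have mphi (j : 'I_n.+1) : mfun (fun w => phi (z i (j%:R / n.+1%:R) w)).
  by apply: mfun_comp => //; apply: mz.
apply: (@le_trans _ _ (eE P (fun w => rsum n (fun x => phi (z i x w))))).
  apply: eE_le.
  - apply: mfun_comp => //; rewrite /rsum; apply: measurable_funM => //.
    by apply: measurable_sum => j; apply: mz.
  - rewrite /rsum; apply: measurable_funM => //.
    by apply: measurable_sum => j.
  - by move=> w; rewrite phi0 subgrad_rsum.
rewrite /rsum eE_Z//; last 2 first.
- by apply: measurable_sum => j.
- by move=> w; apply: sumr_ge0 => j _.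
pose y (j : 'I_n.+1) w := phi (z i (j%:R / n.+1%:R) w).
have -> : eE P (fun w => \sum_(j < n.+1) y j w) = (\sum_(j < n.+1) eE P (y j))%E.
  rewrite /eE -ge0_integral_sum//.
  - by apply: eq_integral => w _; rewrite sumEFin.
  - by move=> j; apply/measurable_EFinP; exact: mphi.
  - by move=> j w _; rewrite lee_fin /y.
apply: (@le_trans _ _ (n.+1%:R^-1%:E * (\sum_(j < n.+1) K%:E))%E).
  rewrite lee_wpmul2l ?lee_fin ?invr_ge0//; apply: lee_sum => j _.
  exact: (KP (i, unit_pt (gu j))).
by rewrite sumEFin -EFinM lee_fin sumr_const card_ord -(mulr_natl K) mulrA mulVf ?mul1r ?pnatr_eq0.
Qed.

Lemma BddF_avg I (z : I -> R -> Omega -> R) :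
  (forall i w, continuous (fun x => z i x w)) ->
  BddF P (fun p : I * unit_itv => z p.1 (sval p.2)) ->
  BddF P (fun i w => avg (fun x => z i x w)).
Proof.
move=> cz [mz Bz].
have mz' i x : 0 <= x <= 1 -> mfun (z i x).
  by move=> x01; exact: (mz (i, unit_pt x01)).
split; first by move=> i; exact: (mfun_avg (cz i) (mz' i)).
move=> k; apply: bdd_mom_avg => //.
- exact: continuous_powk.
- exact: subgrad_powk.
- exact: powk_ge0.
Qed.

Lemma SubG_avg I (z : I -> R -> Omega -> R) :
  (forall i w, continuous (fun x => z i x w)) ->
  SubG P (fun p : I * unit_itv => z p.1 (sval p.2)) ->
  SubG P (fun i w => avg (fun x => z i x w)).
Proof.
move=> cz [mz [e e0 Bz]].
have mz' i x : 0 <= x <= 1 -> mfun (z i x).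
  by move=> x01; exact: (mz (i, unit_pt x01)).
split; first by move=> i; exact: (mfun_avg (cz i) (mz' i)).
exists e => //; apply: bdd_mom_avg => //.
- exact: continuous_gauss.
- by apply: subgrad_gauss; exact: ltW.
Qed.

End averages.

(** * Limits of expectations under bounded moments *)

Section uniform_integrability.
Context {R : realType} {d : measure_display} {Omega : measurableType d}.
Variable P : probability Omega R.
Notation mfun f := (measurable_fun setT f).
Implicit Types (f g : Omega -> R) (K M e : R).

Lemma ler_1Dsqr (a : R) : a <= 1 + a ^+ 2.
Proof. by have := sqr_ge0 (a - 1); have := sqr_ge0 a; nra. Qed.

Lemma sqrB_le (a b : R) : (a - b) ^+ 2 <= 2 * (a ^+ 2 + b ^+ 2).
Proof. by have := sqr_ge0 (a + b); nra. Qed.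

Lemma half_frac_le (e K : R) : 0 <= e -> 0 <= K -> e / (2 * (K + 1)) * K <= e / 2.
Proof.
move=> e0 K0; rewrite -mulrA ler_wpM2l// mulrC.
by rewrite ler_pdivrMr ?mulr_gt0 ?ltr_wpDl// mulKf// lerDl.
Qed.

Lemma integrable_sq f K : mfun f -> (eE P (fun w => (f w ^+ 2)%R) <= K%:E)%E ->
  P.-integrable setT (EFin \o f).
Proof.
move=> mf fK; apply/integrableP; split; first exact/measurable_EFinP.
apply: (@le_lt_trans _ _ (eE P (fun w => 1 + f w ^+ 2))).
  apply: (@eE_le _ _ _ P (fun w => `|f w|) (fun w => 1 + f w ^+ 2)).
  - exact: measurableT_comp.
  - by apply: measurable_funD => //; exact: measurable_funX.
  - move=> w; rewrite normr_ge0/= -real_normK ?num_real//.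
    exact: ler_1Dsqr.
rewrite eE_D//; last 2 first.
- exact: measurable_funX.
- by move=> w; exact: sqr_ge0.
by rewrite eE_cst (le_lt_trans (leeD (lexx _) fK))// -EFinD ltry.
Qed.

Lemma mE_abs f K : mfun f -> (eE P (fun w => `|f w|%R) <= K%:E)%E -> `|mE P f| <= K.
Proof.
move=> mf fK; have intf : P.-integrable setT (EFin \o f).
  apply/integrableP; split; first exact/measurable_EFinP.
  exact: le_lt_trans fK (ltry _).
apply: le_trans (le_normr_Rintegral measurableT intf) _.
rewrite -lee_fin /Rintegral fineK//.
by rewrite ge0_fin_numE ?(le_lt_trans fK (ltry _))// integral_ge0.
Qed.

Lemma BddF_sq I (z : I -> Omega -> R) : BddF P z ->
  exists2 K : R, 0 <= K & forall i, (eE P (fun w => (z i w ^+ 2)%R) <= K%:E)%E.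
Proof.
move=> [mz Bz]; have [K KP] := Bz 1%N; exists `|K| => // i.
apply: le_trans (_ : K%:E <= _)%E; last by rewrite lee_fin ler_norm.
apply: le_trans (KP i); rewrite le_eqVlt; apply/orP; left; apply/eqP.
by apply: eq_integral => w _; rewrite expr1.
Qed.

Lemma BddF_integrable I (z : I -> Omega -> R) i : BddF P z ->
  P.-integrable setT (EFin \o z i).
Proof. by move=> Bz; have [K _ KP] := BddF_sq Bz; exact: integrable_sq (Bz.1 i) (KP i). Qed.

(* Truncation at level [1/e]: where [|D| > 1/e] one has [|D| <= e D^2]. *)
Lemma mE_cvg (z : nat -> Omega -> R) f : BddF P z ->
  (forall w, z n w @[n --> \oo] --> f w) -> mE P (z n) @[n --> \oo] --> mE P f.
Proof.
move=> Bz zf; have [K K0 KP] := BddF_sq Bz; have mz := Bz.1.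
have mf : mfun f by apply: measurable_fun_cvg mz _ => w _; exact: zf.
have fK : (eE P (fun w => (f w ^+ 2)%R) <= K%:E)%E.
  apply: (@eE_fatou _ _ _ _ (fun n w => z n w ^+ 2)) => //.
  - by move=> n; exact: measurable_funX.
  - by move=> n w; exact: sqr_ge0.
  - move=> w; apply: (cvg_comp _ (fun x : R => x ^+ 2) (zf w)).
    exact: exprn_continuous.
pose D n w := f w - z n w.
have mD n : mfun (D n) by exact: measurable_funB.
have DK n : (eE P (fun w => (D n w ^+ 2)%R) <= (2 * (K + K))%:E)%E.
  apply: (@le_trans _ _ (eE P (fun w => 2 * (f w ^+ 2 + z n w ^+ 2)))).
    apply: eE_le; first exact: measurable_funX.
      by apply: measurable_funM => //; apply: measurable_funD; exact: measurable_funX.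
    move=> w; rewrite sqr_ge0/=; exact: sqrB_le.
  rewrite eE_Z//; last 2 first.
  - by apply: measurable_funD; exact: measurable_funX.
  - by move=> w; rewrite addr_ge0 ?sqr_ge0.
  rewrite EFinM lee_wpmul2l// ?lee_fin// eE_D//; last 4 first.
  - exact: measurable_funX.
  - exact: measurable_funX.
  - by move=> w; exact: sqr_ge0.
  - by move=> w; exact: sqr_ge0.
  by rewrite EFinD leeD.
apply/cvgrPdist_le => /= eps eps0.
pose e := eps / (2 * (2 * (K + K) + 1)).
have KK0 : 0 < 2 * (K + K) + 1 by rewrite ltr_wpDl// mulr_ge0// addr_ge0.
have e0 : 0 < e by rewrite divr_gt0// mulr_gt0.
pose m n w : R := Num.min `|D n w| e^-1.
have mm n : mfun (m n).
  by apply: measurable_minr => //; exact: measurableT_comp.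
have m0 n w : 0 <= m n w by rewrite le_min normr_ge0 invr_ge0 ltW.
have cm : eE P (m n) @[n --> \oo] --> (0 : \bar R)%E.
  have -> : (0 : \bar R)%E = (\int[P]_w (fun=> 0%E) w)%E by rewrite integral0.
  apply: (@dominated_cvg _ _ _ P setT measurableT
     (fun n w => (m n w)%:E) (fun=> 0%E) (fun=> (e^-1)%:E)) => //.
  - by move=> n; exact/measurable_EFinP.
  - move=> w _; apply: cvg_EFin; first exact: nearW.
    apply/cvgrPdist_lt => /= r r0.
    have := zf w => /cvgrPdist_lt/(_ _ r0); apply: filterS => n nr.
    by rewrite sub0r normrN ger0_norm ?m0// gt_min nr.
  - exact: finite_measure_integrable_cst.
  - by move=> n w _; rewrite /= lee_fin ger0_norm ?m0// ge_min lexx orbT.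
have : \forall n \near \oo, (eE P (m n) < (eps / 2)%:E)%E.
  apply: (cm [set y | (y < (eps / 2)%:E)%E]).
  by apply: (@nbhs_open_ereal_lt _ 0 (fun=> eps / 2)); rewrite divr_gt0.
apply: filterS => n mn.
have -> : mE P f - mE P (z n) = mE P (D n).
  rewrite /mE -RintegralB//; first exact: integrable_sq fK.
  exact: BddF_integrable.
apply: mE_abs => //.
apply: (@le_trans _ _ (eE P (fun w => e * D n w ^+ 2 + m n w))).
  apply: eE_le; first exact: measurableT_comp.
    by apply: measurable_funD => //; apply: measurable_funM => //; exact: measurable_funX.
  move=> w; rewrite normr_ge0/= /m; case: (leP `|D n w| e^-1) => h.
    by rewrite lerDr mulr_ge0 ?sqr_ge0// ltW.
  rewrite ler_wpDr ?invr_ge0 ?(ltW e0)// -real_normK ?num_real// expr2 mulrA ler_peMl//.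
  by rewrite mulrC -ler_pdivrMr// mul1r ltW.
rewrite eE_D//; last 2 first.
- by apply: measurable_funM => //; exact: measurable_funX.
- by move=> w; rewrite mulr_ge0 ?sqr_ge0// ltW.
rewrite [eps]splitr EFinD leeD ?(ltW mn)//.
rewrite eE_Z ?(ltW e0)//; last 2 first.
- exact: measurable_funX.
- by move=> w; exact: sqr_ge0.
apply: le_trans (lee_wpmul2l _ (DK n)) _; first by rewrite lee_fin ltW.
by rewrite -EFinM lee_fin half_frac_le ?(ltW eps0)// mulr_ge0// addr_ge0.
Qed.

(** The factor [y] is not assumed to converge. By [|y z| <= e y^2 + z^2 / e], the first term is
    small uniformly in [n] by choice of [e], the second because the mean of [z^2] tends to 0. *)
Lemma mE_cvg_prod0 (y z : nat -> Omega -> R) : BddF P y -> BddF P z ->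
  (forall w, z n w @[n --> \oo] --> (0 : R)) ->
  mE P (fun w => y n w * z n w) @[n --> \oo] --> (0 : R).
Proof.
move=> By Bz z0; have [K K0 KP] := BddF_sq By.
have c2 : mE P (fun w => z n w * z n w) @[n --> \oo] --> (0 : R).
  rewrite [X in _ --> X](_ : _ = mE P (fun=> 0)).
    apply: mE_cvg; first exact: BddF_M.
    by move=> w; rewrite -[X in _ --> X](mulr0 0); apply: cvgM; exact: z0.
  by rewrite /mE Rintegral_cst// mul0r.
apply/cvgrPdist_le => /= eps eps0.
pose e := eps / (2 * (K + 1)).
have K1 : 0 < K + 1 by rewrite ltr_wpDl.
have e0 : 0 < e by rewrite divr_gt0// mulr_gt0.
have r0 : 0 < e * eps / 2 by rewrite divr_gt0// mulr_gt0.
have := c2 => /cvgrPdist_lt/(_ _ r0); apply: filterS => n.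
rewrite sub0r normrN => zn.
have my := By.1 n; have mz := Bz.1 n.
rewrite sub0r normrN; apply: mE_abs; first exact: measurable_funM.
apply: (@le_trans _ _ (eE P (fun w => e * y n w ^+ 2 + e^-1 * (z n w * z n w)))).
  apply: eE_le.
  - by apply: measurableT_comp => //; exact: measurable_funM.
  - apply: measurable_funD.
      by apply: measurable_funM => //; exact: measurable_funX.
    by do 2 apply: measurable_funM => //.
  move=> w; rewrite normr_ge0/= normrM.
  rewrite -[y n w ^+ 2]real_normK ?num_real// -[z n w * _]expr2 -[z n w ^+ 2]real_normK ?num_real//.
  set a := `|y n w|; set b := `|z n w|.
  rewrite -subr_ge0 [X in 0 <= X](_ : _ = e^-1 * ((e * a - b / 2) ^+ 2 + 3 / 4 * b ^+ 2)); last first.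
    by field; rewrite gt_eqF.
  by rewrite mulr_ge0 ?invr_ge0 ?(ltW e0)// addr_ge0 ?sqr_ge0// mulr_ge0 ?sqr_ge0// divr_ge0.
rewrite eE_D//; last 4 first.
- by apply: measurable_funM => //; exact: measurable_funX.
- by do 2 apply: measurable_funM => //.
- by move=> w; rewrite mulr_ge0 ?sqr_ge0// ltW.
- by move=> w; rewrite -expr2 mulr_ge0 ?sqr_ge0// invr_ge0 ltW.
rewrite [eps]splitr EFinD leeD//.
  rewrite eE_Z ?(ltW e0)//; last 2 first.
  - exact: measurable_funX.
  - by move=> w; exact: sqr_ge0.
  apply: le_trans (lee_wpmul2l _ (KP n)) _; first by rewrite lee_fin ltW.
  by rewrite -EFinM lee_fin half_frac_le ?(ltW eps0).
rewrite eE_Z ?invr_ge0 ?(ltW e0)//; last 2 first.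
- exact: measurable_funM.
- by move=> w; rewrite -expr2 sqr_ge0.
have izz : P.-integrable setT (EFin \o (fun w => z n w * z n w)).
  exact: (BddF_integrable n (BddF_M Bz Bz)).
have -> : eE P (fun w => z n w * z n w) = (mE P (fun w => z n w * z n w))%:E.
  by rewrite /mE /Rintegral fineK//; exact: integrable_fin_num.
rewrite -EFinM lee_fin mulrC ler_pdivrMr// mulrC mulrA.
exact: le_trans (ler_norm _) (ltW zn).
Qed.

End uniform_integrability.

(** * Functionals of a path and their derivatives *)

Section continuity_closure.
Context {R : realType} {Z : topologicalType}.
Implicit Types f g : Z -> R.

Lemma cont_cst (c : R) : continuous (fun _ : Z => c).
Proof. by move=> z; exact: cvg_cst. Qed.

Lemma contD f g : continuous f -> continuous g -> continuous (fun z => f z + g z).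
Proof. by move=> cf cg z; apply: cvgD; [exact: cf|exact: cg]. Qed.

Lemma contN f : continuous f -> continuous (fun z => - f z).
Proof. by move=> cf z; apply: cvgN; exact: cf. Qed.

Lemma contB f g : continuous f -> continuous g -> continuous (fun z => f z - g z).
Proof. by move=> cf cg z; apply: cvgB; [exact: cf|exact: cg]. Qed.

Lemma contM f g : continuous f -> continuous g -> continuous (fun z => f z * g z).
Proof. by move=> cf cg z; apply: cvgM; [exact: cf|exact: cg]. Qed.

Lemma cont_comp (h : R -> R) f : continuous h -> continuous f ->
  continuous (fun z => h (f z)).
Proof. by move=> ch cf z; apply: (cvg_comp f h (cf z)); exact: ch. Qed.

Lemma contX f n : continuous f -> continuous (fun z => f z ^+ n).
Proof. by move=> cf; apply: (@cont_comp (fun x => x ^+ n)) => //; exact: exprn_continuous. Qed.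

Lemma cont_pair {U V : topologicalType} (f : Z -> U) (g : Z -> V) :
  continuous f -> continuous g -> continuous (fun z => (f z, g z)).
Proof.
move=> cf cg z A [[B C] /= [fB gC] BC].
have h1 := cf z B fB; have h2 := cg z C gC.
have : nbhs z ((f @^-1` B) `&` (g @^-1` C)) by exact: filterI.
by apply: filterS => y [By Cy]; exact: (BC (f y, g y)).
Qed.

Lemma cont_comp2 (h : R -> R -> R) f g :
  continuous (fun p : R * R => h p.1 p.2) -> continuous f -> continuous g ->
  continuous (fun z => h (f z) (g z)).
Proof.
move=> ch cf cg z A /(ch (f z, g z)) chA.
exact: (cont_pair cf cg chA).
Qed.

End continuity_closure.

Lemma cont_fst {U V : topologicalType} : continuous (@fst U V).
Proof. by move=> z; exact: cvg_fst. Qed.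

Lemma cont_snd {U V : topologicalType} : continuous (@snd U V).
Proof. by move=> z; exact: cvg_snd. Qed.

Section clamp.
Context {R : realType}.
Variable T : R.
Hypothesis T0 : 0 <= T.

(* Precomposing with [clamp] extends data given on [[0, T]] to globally continuous
   functions, so that no continuity within [[0, T]] is needed until the end. *)
Definition clamp (t : R) : R := Num.max 0 (Num.min T t).

Lemma clamp_itv t : 0 <= clamp t <= T.
Proof. by rewrite /clamp le_max lexx/= ge_max T0/= ge_min lexx. Qed.

Lemma clamp_id t : 0 <= t <= T -> clamp t = t.
Proof. by move=> /andP[t0 tT]; rewrite /clamp min_r// max_r. Qed.

Lemma clamp_continuous : continuous clamp.
Proof.
move=> t; apply: continuous_max; first exact: cvg_cst.
by apply: continuous_min; [exact: cvg_cst|exact: cvg_id].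
Qed.

End clamp.

Section sequential_limits.
Context {R : realType}.

(** Convergence of expectations is available along sequences only; this transfers it to filters,
    choosing counterexamples in balls of radius [1 / (n + 1)]. *)
Lemma cvg_within_seq (Z : pseudoMetricType R) (D : set Z) (p : Z) (f : Z -> R) (l : R) :
  (forall u : nat -> Z, (forall n, D (u n)) -> u n @[n --> \oo] --> p ->
    f (u n) @[n --> \oo] --> l) ->
  f @ within D (nbhs p) --> l.
Proof.
move=> H; apply: contrapT => nf.
have [e e0 he] : exists2 e : R, 0 < e & forall n : nat, exists z,
    [/\ D z, ball p (n.+1%:R^-1) z & e <= `|l - f z|].
  apply: contrapT => nex; apply: nf; apply/cvgrPdist_lt => /= e e0.
  apply: contrapT => nn; apply: nex; exists e => // n.
  apply: contrapT => nz; apply: nn; rewrite /within /=.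
  apply/nbhs_ballP; exists n.+1%:R^-1 => //=.
  move=> z bz Dz; rewrite ltNge; apply/negP => le; apply: nz.
  by exists z; split.
have [u uP] := choice he.
have cu : u n @[n --> \oo] --> p.
  apply/cvg_ballP => r r0.
  have [N _ NP] := @near_infty_natSinv_lt R (PosNum r0).
  exists N => // n Nn /=.
  have [_ + _] := uP n; apply: le_ball.
  by rewrite ltW//; exact: (NP n Nn).
have /cvgrPdist_lt/(_ _ e0)[N _ NP] := H u (fun n => let: And3 a _ _ := uP n in a) cu.
by have := NP N (leqnn N); have [_ _ h] := uP N; rewrite ltNge h.
Qed.

Lemma seq_continuous (Z : pseudoMetricType R) (f : Z -> R) :
  (forall p (u : nat -> Z), u n @[n --> \oo] --> p -> f (u n) @[n --> \oo] --> f p) ->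
  continuous f.
Proof.
move=> H p; have := @cvg_within_seq Z setT p f (f p) (fun u _ => H p u).
by move=> h A /h; rewrite /nbhs/= /within/=; apply: filterS => z; exact.
Qed.

End sequential_limits.

Section expressions.
Context {R : realType}.
Variables (b T : R).
Hypothesis T0 : 0 <= T.
Implicit Types (V Q : nat -> R -> R -> R) (xi X : R -> R) (t x : R).

Local Notation cl := (clamp T).

(* [V k s y] is the [k]-th derivative in [y] of a coefficient [V 0 s y]. *)
Definition jet V :=
  [/\ forall k, continuous (fun p : R * R => V k p.1 p.2),
      forall k (s y : R), is_derive y 1 (V k s) (V k.+1 s y) &
      forall k (e : R), 0 < e -> exists K : R, forall s y : R,
        `|V k s y| <= K * expR (e * y ^+ 2)].

Definition ecoef (t s : R) : R := expR (b * (s - t)).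

Definition tgrid t x : R := cl t + (T - cl t) * x.

(* [k]-th derivative in the starting point of
   [int_t^T V 0 s (xi s) ds + Q 0 T (xi T)] along [xi = flow X t x]; the integral is
   rescaled to [[0, 1]] so that its domain does not move with [t]. *)
Definition functional V Q k t xi : R :=
  (T - cl t) * avg (fun x => ecoef (cl t) (tgrid t x) ^+ k * V k (tgrid t x) (xi (tgrid t x)))
  + ecoef (cl t) T ^+ k * Q k T (xi T).

(* The solution through [(t, x)] in terms of a reference solution [X]: the
   difference of two solutions solves [y' = b y]. *)
Definition flow X t x : R -> R := fun s => X s + ecoef (cl t) s * (x - X (cl t)).

(* Reified random variables: [XA k] and [XB k] are the [k]-th derivatives of the real
   and imaginary parts [A], [B] of the exponent, [XC] is [e^A cos B], [XS] is
   [e^A sin B]. The derivative in the starting point becomes [deriv_expr]. *)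
Inductive expr := XA of nat | XB of nat | XC | XS
  | XAdd of expr & expr | XMul of expr & expr | XOpp of expr.

Fixpoint deriv_expr (e : expr) : expr :=
  match e with
  | XA k => XA k.+1
  | XB k => XB k.+1
  | XC => XAdd (XMul (XA 1) XC) (XOpp (XMul (XB 1) XS))
  | XS => XAdd (XMul (XA 1) XS) (XMul (XB 1) XC)
  | XAdd e1 e2 => XAdd (deriv_expr e1) (deriv_expr e2)
  | XMul e1 e2 => XAdd (XMul (deriv_expr e1) e2) (XMul e1 (deriv_expr e2))
  | XOpp e1 => XOpp (deriv_expr e1)
  end.

Variables VA QA VB QB : nat -> R -> R -> R.
Hypotheses (jVA : jet VA) (jQA : jet QA) (jVB : jet VB) (jQB : jet QB).

Fixpoint eval (e : expr) t xi : R :=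
  match e with
  | XA k => functional VA QA k t xi
  | XB k => functional VB QB k t xi
  | XC => expR (functional VA QA 0 t xi) * cos (functional VB QB 0 t xi)
  | XS => expR (functional VA QA 0 t xi) * sin (functional VB QB 0 t xi)
  | XAdd e1 e2 => eval e1 t xi + eval e2 t xi
  | XMul e1 e2 => eval e1 t xi * eval e2 t xi
  | XOpp e1 => - eval e1 t xi
  end.

Lemma tgrid_itv t x : 0 <= x <= 1 -> cl t <= tgrid t x <= T.
Proof.
move=> /andP[x0 x1]; have /andP[c0 cT] := clamp_itv T0 t.
rewrite /tgrid lerDl mulr_ge0 ?subr_ge0//=.
by rewrite -lerBrDl ler_piMr// subr_ge0.
Qed.

Lemma ecoef_cont {Z : topologicalType} (f g : Z -> R) :
  continuous f -> continuous g -> continuous (fun z => ecoef (f z) (g z)).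
Proof.
move=> cf cg; apply: (cont_comp (h := expR)); first exact: continuous_expR.
by apply: contM; [exact: cont_cst|exact: contB].
Qed.

Lemma clamp_cont {Z : topologicalType} (f : Z -> R) :
  continuous f -> continuous (fun z => cl (f z)).
Proof. by move=> cf; apply: cont_comp => //; exact: clamp_continuous. Qed.

Lemma tgrid_cont {Z : topologicalType} (f g : Z -> R) :
  continuous f -> continuous g -> continuous (fun z => tgrid (f z) (g z)).
Proof.
move=> cf cg; apply: contD; first exact: clamp_cont.
by apply: contM => //; apply: contB; [exact: cont_cst|exact: clamp_cont].
Qed.

Lemma flow_cont {Z : topologicalType} X (f g h : Z -> R) : continuous X ->
  continuous f -> continuous g -> continuous h ->
  continuous (fun z => flow X (f z) (g z) (h z)).
Proof.
move=> cX cf cg ch; rewrite /flow; apply: contD; first exact: cont_comp.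
apply: contM; first by apply: ecoef_cont => //; exact: clamp_cont.
by apply: contB => //; apply: cont_comp => //; exact: clamp_cont.
Qed.

Lemma functional_integrand_cont V k t xi : jet V -> continuous xi ->
  continuous (fun x => ecoef (cl t) (tgrid t x) ^+ k * V k (tgrid t x) (xi (tgrid t x))).
Proof.
move=> [cV _ _] cxi; have ct : continuous (tgrid t).
  by apply: tgrid_cont; [exact: cont_cst|move=> x; exact: cvg_id].
apply: contM; first by apply: contX; apply: ecoef_cont => //; exact: cont_cst.
by apply: (cont_comp2 (h := V k)) => //; exact: cont_comp.
Qed.

Lemma functional_cont V Q k X : jet V -> jet Q -> continuous X ->
  continuous (fun p : R * R => functional V Q k p.1 (flow X p.1 p.2)).
Proof.
move=> [cV _ _] [cQ _ _] cX.
have c1 : continuous (fun p : R * R => p.1) by exact: cont_fst.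
have c2 : continuous (fun p : R * R => p.2) by exact: cont_snd.
apply: contD.
  apply: contM; first by apply: contB; [exact: cont_cst|exact: clamp_cont].
  apply: (@avg_continuous R (R * R)%type (fun p x => ecoef (cl p.1) (tgrid p.1 x) ^+ k *
     V k (tgrid p.1 x) (flow X p.1 p.2 (tgrid p.1 x)))).
  have c11 : continuous (fun q : R * R * R => q.1.1).
    by move=> q A nA; exact: (@cont_fst _ _ q _ (@cont_fst _ _ q.1 A nA)).
  have c12 : continuous (fun q : R * R * R => q.1.2).
    by move=> q A nA; exact: (@cont_fst _ _ q _ (@cont_snd _ _ q.1 A nA)).
  have c2' : continuous (fun q : R * R * R => q.2) by exact: cont_snd.
  apply: contM; first by apply: contX; apply: ecoef_cont; [exact: clamp_cont|exact: tgrid_cont].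
  apply: (cont_comp2 (h := V k)) => //; first exact: tgrid_cont.
  by apply: flow_cont => //; exact: tgrid_cont.
apply: contM.
  by apply: contX; apply: ecoef_cont; [exact: clamp_cont|exact: cont_cst].
apply: (cont_comp2 (h := Q k)) => //; first exact: cont_cst.
by apply: flow_cont => //; exact: cont_cst.
Qed.

Lemma is_derive_flow_comp (G : R -> R) (dG : R) X t x s :
  is_derive (flow X t x s) 1 G dG ->
  is_derive x 1 (fun x => G (flow X t x s)) (ecoef (cl t) s * dG).
Proof.
have E y : flow X t y s = (X s - ecoef (cl t) s * X (cl t)) + ecoef (cl t) s * y.
  by rewrite /flow; ring.
rewrite E => dGx; have := is_derive_comp_aff dGx.
by under eq_fun do rewrite -E.
Qed.

Lemma is_deriveZl (f : R -> R) (df c x : R) : is_derive x 1 f df ->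
  is_derive x 1 (fun y => c * f y) (c * df).
Proof. by move=> dfx; exact: is_deriveZ. Qed.

Lemma is_deriveMr (f g : R -> R) (df dg x : R) : is_derive x 1 f df ->
  is_derive x 1 g dg -> is_derive x 1 (fun y => f y * g y) (df * g x + f x * dg).
Proof.
move=> dfx dgx; have := is_deriveM dfx dgx; rewrite !/GRing.scale/=.
by rewrite addrC [g x * _]mulrC.
Qed.

(** The flow is affine in its starting point with slope [ecoef], so each derivative adds one such
    factor; this is the origin of the power [k] in [functional]. *)
Lemma functional_derive V Q k X t x : jet V -> jet Q -> continuous X ->
  is_derive x 1 (fun x => functional V Q k t (flow X t x))
    (functional V Q k.+1 t (flow X t x)).
Proof.
move=> jV jQ cX; have [cV dV _] := jV; have [cQ dQ _] := jQ.
have cflow y : continuous (flow X t y).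
  by apply: flow_cont => //; try exact: cont_cst; move=> z; exact: cvg_id.
apply: is_deriveD; last first.
  rewrite exprSr -mulrA; apply: is_deriveZl.
  exact: is_derive_flow_comp.
apply: is_deriveZl.
apply: (is_derive_avg (F' := fun x y => ecoef (cl t) (tgrid t y) ^+ k.+1 *
   V k.+1 (tgrid t y) (flow X t x (tgrid t y)))).
- by move=> y; exact: functional_integrand_cont.
- have ct : continuous (fun p : R * R => tgrid t p.2).
    by apply: tgrid_cont; [exact: cont_cst|exact: cont_snd].
  apply: contM; first by apply: contX; apply: ecoef_cont => //; exact: cont_cst.
  apply: (cont_comp2 (h := V k.+1)) => //.
  by apply: flow_cont => //; [exact: cont_cst|exact: cont_fst].
- move=> y z; rewrite exprSr -mulrA; apply: is_deriveZl.
  exact: is_derive_flow_comp.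
Qed.

Lemma eval_cont e X : continuous X ->
  continuous (fun p : R * R => eval e p.1 (flow X p.1 p.2)).
Proof.
move=> cX; have cA k := functional_cont (k:=k) jVA jQA cX.
have cB k := functional_cont (k:=k) jVB jQB cX.
elim: e => //=.
- apply: contM; first by apply: (cont_comp (h := expR)) => //; exact: continuous_expR.
  by apply: (cont_comp (h := cos)) => //; exact: continuous_cos.
- apply: contM; first by apply: (cont_comp (h := expR)) => //; exact: continuous_expR.
  by apply: (cont_comp (h := sin)) => //; exact: continuous_sin.
- by move=> e1 c1 e2 c2; exact: contD.
- by move=> e1 c1 e2 c2; exact: contM.
- by move=> e1 c1; exact: contN.
Qed.

Lemma eval_derive e X t x : continuous X ->
  is_derive x 1 (fun x => eval e t (flow X t x)) (eval (deriv_expr e) t (flow X t x)).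
Proof.
move=> cX; have dA k := functional_derive k t x jVA jQA cX.
have dB k := functional_derive k t x jVB jQB cX.
elim: e => [k|k|||e1 d1 e2 d2|e1 d1 e2 d2|e1 d1] /=.
- exact: dA.
- exact: dB.
- have dE := is_derive1_comp (is_derive_expR _) (dA 0%N).
  have dC := is_derive1_comp (is_derive_cos _) (dB 0%N).
  apply: is_derive_eq (is_deriveMr dE dC) _.
  by rewrite /=; ring.
- have dE := is_derive1_comp (is_derive_expR _) (dA 0%N).
  have dS := is_derive1_comp (is_derive_sin _) (dB 0%N).
  apply: is_derive_eq (is_deriveMr dE dS) _.
  by rewrite /=; ring.
- exact: is_deriveD.
- exact: is_deriveMr.
- exact: is_deriveN.
Qed.

End expressions.

(** * Expectations of path functionals *)

Section expected_expressions.
Context {R : realType}.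
Variables (b T : R).
Hypothesis T0 : 0 <= T.
Local Notation cl := (clamp T).
Implicit Types (V Q : nat -> R -> R -> R).

Lemma ecoef_gt0 t s : 0 < ecoef b t s.
Proof. exact: expR_gt0. Qed.

Lemma ecoef_le t s : 0 <= t <= T -> 0 <= s <= T -> ecoef b t s <= expR (`|b| * T).
Proof.
move=> /andP[t0 tT] /andP[s0 sT]; rewrite ler_expR.
apply: le_trans (ler_norm _) _; rewrite normrM ler_wpM2l// ler_norml; apply/andP; split; lra.
Qed.

Section measurability.
Context {d : measure_display} {Omega : measurableType d}.
Variable Xi : Omega -> R -> R.
Hypothesis cXi : forall w, continuous (Xi w).

Lemma functional_mfun V Q k t : jet V -> jet Q ->
  (forall s, cl t <= s <= T -> measurable_fun setT (fun w => Xi w s)) ->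
  measurable_fun setT (fun w => functional b T V Q k t (Xi w)).
Proof.
move=> jV jQ mXi; have [cV _ _] := jV; have [cQ _ _] := jQ.
have cVs s : continuous (V k s).
  by apply: (cont_comp2 (h := V k)) => //; [exact: cont_cst|move=> z; exact: cvg_id].
have cQs s : continuous (Q k s).
  by apply: (cont_comp2 (h := Q k)) => //; [exact: cont_cst|move=> z; exact: cvg_id].
apply: measurable_funD; apply: measurable_funM => //.
  apply: (@mfun_avg _ _ _ (fun x w => ecoef b (cl t) (tgrid T t x) ^+ k *
     V k (tgrid T t x) (Xi w (tgrid T t x)))).
    by move=> w; exact: (@functional_integrand_cont R b T V k t (Xi w) jV (@cXi w)).
  move=> x x01; apply: measurable_funM => //.
  by apply: (mfun_comp (cVs _)); apply: mXi; exact: tgrid_itv.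
apply: (mfun_comp (cQs _)); apply: mXi; rewrite lexx andbT.
by have /andP[] := clamp_itv T0 t.
Qed.

Lemma eval_mfun VA QA VB QB e t : jet VA -> jet QA -> jet VB -> jet QB ->
  (forall s, cl t <= s <= T -> measurable_fun setT (fun w => Xi w s)) ->
  measurable_fun setT (fun w => eval b T VA QA VB QB e t (Xi w)).
Proof.
move=> jVA jQA jVB jQB mXi.
have mA k := functional_mfun k jVA jQA mXi.
have mB k := functional_mfun k jVB jQB mXi.
elim: e => [k|k|||e1 d1 e2 d2|e1 d1 e2 d2|e1 d1] /=.
- exact: mA.
- exact: mB.
- apply: measurable_funM; first exact: (mfun_comp (@continuous_expR R)).
  exact: (mfun_comp (@continuous_cos R)).
- apply: measurable_funM; first exact: (mfun_comp (@continuous_expR R)).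
  exact: (mfun_comp (@continuous_sin R)).
- exact: measurable_funD.
- exact: measurable_funM.
- exact: measurable_funN.
Qed.

End measurability.

Context {d : measure_display} {Omega : measurableType d}.
Variable P : probability Omega R.
Variable X : Omega -> R -> R.
Hypothesis cX : forall w, continuous (X w).
Hypothesis sX : SubG P (fun (s : R) w => X w s).

(** The starting point [chi] may be random: it will be the position reached by another solution, or
    an intermediate point of a Taylor remainder. *)
Lemma SubG_flow J (t s : J -> R) (chi : J -> Omega -> R) :
  (forall j, 0 <= s j <= T) -> SubG P chi ->
  SubG P (fun j w => flow b T (X w) (t j) (chi j w) (s j)).
Proof.
move=> sT schi; apply: SubG_D; first exact: (SubG_reindex s sX).
have s1 : SubG P (fun j w => - X w (cl (t j))).
  apply: (SubG_le (r := fun j => cl (t j)) (M := 1) _ _ sX) => [j|j w].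
    by apply: measurable_funN; exact: (sX.1 (cl (t j))).
  by rewrite mul1r normrN.
have s2 := SubG_D schi s1.
apply: (SubG_le (r := id) (M := expR (`|b| * T)) _ _ s2) => [j|j w].
  by apply: measurable_funM => //; exact: (s2.1 j).
rewrite normrM ler_wpM2r// gtr0_norm ?ecoef_gt0//.
by apply: ecoef_le => //; exact: clamp_itv.
Qed.

Lemma functional_BddF V Q k I (t : I -> R) (chi : I -> Omega -> R) : jet V -> jet Q ->
  SubG P chi ->
  BddF P (fun i w => functional b T V Q k (t i) (flow b T (X w) (t i) (chi i w))).
Proof.
move=> jV jQ schi; have [cV _ gV] := jV; have [cQ _ gQ] := jQ.
have cVs s : continuous (V k s).
  by apply: (cont_comp2 (h := V k)) => //; [exact: cont_cst|move=> z; exact: cvg_id].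
have cQs s : continuous (Q k s).
  by apply: (cont_comp2 (h := Q k)) => //; [exact: cont_cst|move=> z; exact: cvg_id].
have cT r := clamp_itv T0 r.
have cflow i w : continuous (flow b T (X w) (t i) (chi i w)).
  by apply: flow_cont => //; try exact: cont_cst; move=> z; exact: cvg_id.
have TT : 0 <= T <= T by rewrite T0 lexx.
apply: BddF_D; last first.
  apply: (BddF_Z (M := expR (`|b| * T) ^+ k)).
    move=> i; rewrite normrX gtr0_norm ?ecoef_gt0// lerXn2r ?nnegrE ?expR_ge0//.
    exact: ecoef_le.
  apply: (BddF_growth (f := fun _ => Q k T)).
  - by move=> e e0; have [K KP] := gQ k _ e0; exists K => i x; exact: KP.
  - by move=> _; exact: cQs.
  - exact: (@SubG_flow _ t (fun=> T)).
apply: (BddF_Z (M := T)).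
  by move=> i; have /andP[? ?] := cT (t i); rewrite ger0_norm ?subr_ge0// gerBl.
apply: (@BddF_avg _ _ _ _ _ (fun i x w => ecoef b (cl (t i)) (tgrid T (t i) x) ^+ k *
    V k (tgrid T (t i) x) (flow b T (X w) (t i) (chi i w) (tgrid T (t i) x)))).
  by move=> i w; exact: (@functional_integrand_cont R b T V k (t i) _ jV (@cflow i w)).
have sgT (p : I * @unit_itv R) : 0 <= tgrid T (t p.1) (sval p.2) <= T.
  have /andP[h ->] := tgrid_itv T0 (t p.1) (svalP p.2); rewrite andbT.
  by apply: le_trans h; have /andP[] := cT (t p.1).
apply: (BddF_Z (M := expR (`|b| * T) ^+ k)
   (c := fun p : I * unit_itv => ecoef b (cl (t p.1)) (tgrid T (t p.1) (sval p.2)) ^+ k)).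
  move=> p; rewrite normrX gtr0_norm ?ecoef_gt0// lerXn2r ?nnegrE ?expR_ge0//.
  exact: ecoef_le.
apply: (BddF_growth (f := fun p : I * unit_itv => V k (tgrid T (t p.1) (sval p.2)))).
- by move=> e e0; have [K KP] := gV k _ e0; exists K => i x; exact: KP.
- by move=> p; exact: cVs.
apply: (@SubG_flow _ (fun p => t p.1) _ (fun p w => chi p.1 w)) => //.
exact: (SubG_reindex fst schi).
Qed.

Variables VA QA VB QB : nat -> R -> R -> R.
Hypotheses (jVA : jet VA) (jQA : jet QA) (jVB : jet VB) (jQB : jet QB).
Hypothesis VA_le0 : forall s y, VA 0 s y <= 0.
Hypothesis QA_le0 : forall s y, QA 0 s y <= 0.
Local Notation evalX := (eval b T VA QA VB QB).
Local Notation flowX := (flow b T).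

Lemma functional_le0 t xi : continuous xi -> functional b T VA QA 0 t xi <= 0.
Proof.
move=> cxi; rewrite /functional expr0 mul1r -[leRHS]addr0 lerD//.
have [c _ ->] := avg_mean (@functional_integrand_cont R b T VA 0%N t xi jVA cxi).
rewrite mulr_ge0_le0//; first by have /andP[_ ?] := clamp_itv T0 t; rewrite subr_ge0.
by rewrite expr0 mul1r.
Qed.

(** [XC] and [XS] are bounded by 1 because the real part of the exponent is nonpositive. Every other
    expression is a polynomial in them and in the derivatives of the exponent, which grow slower
    than any [exp (eps x^2)]. *)
Lemma eval_BddF e I (t : I -> R) (chi : I -> Omega -> R) : SubG P chi ->
  BddF P (fun i w => evalX e (t i) (flowX (X w) (t i) (chi i w))).
Proof.
move=> schi.
have BA k := functional_BddF k t jVA jQA schi.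
have BB k := functional_BddF k t jVB jQB schi.
have cf i w : continuous (flowX (X w) (t i) (chi i w)).
  by apply: flow_cont => //; try exact: cont_cst; move=> z; exact: cvg_id.
have mA i := (BA 0%N).1 i; have mB i := (BB 0%N).1 i.
have E1 i w : expR (functional b T VA QA 0 (t i) (flowX (X w) (t i) (chi i w))) <= 1.
  by rewrite -expR0 ler_expR functional_le0.
have B1 : BddF P (fun (i : I) (w : Omega) => 1 : R).
  by apply: (BddF_cst P (M := 1)) => i; rewrite normr1.
elim: e => [k|k|||e1 d1 e2 d2|e1 d1 e2 d2|e1 d1] /=.
- exact: BA.
- exact: BB.
- apply: (BddF_le (r := id) _ _ B1) => [i|i w].
    apply: measurable_funM; first exact: (mfun_comp (@continuous_expR R) (mA i)).
    exact: (mfun_comp (@continuous_cos R) (mB i)).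
  rewrite normr1 normrM mulr_ile1 ?normr_ge0//; first by rewrite ger0_norm ?expR_ge0.
  by rewrite ler_norml cos_geN1 cos_le1.
- apply: (BddF_le (r := id) _ _ B1) => [i|i w].
    apply: measurable_funM; first exact: (mfun_comp (@continuous_expR R) (mA i)).
    exact: (mfun_comp (@continuous_sin R) (mB i)).
  rewrite normr1 normrM mulr_ile1 ?normr_ge0//; first by rewrite ger0_norm ?expR_ge0.
  by rewrite ler_norml sin_geN1 sin_le1.
- exact: BddF_D.
- exact: BddF_M.
- exact: BddF_N.
Qed.

Definition mean_eval e t x : R := mE P (fun w => evalX e t (flowX (X w) t x)).

Lemma cvg_seq_normr_bounded (u : nat -> R) (l : R) : u n @[n --> \oo] --> l ->
  exists M : R, forall n, `|u n| <= M.
Proof.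
move=> ul; have [M [_ MP]] := cvg_seq_bounded (cvgP _ ul).
by exists (M + 1) => n; apply: MP => //; rewrite ltrDl.
Qed.

Lemma mean_eval_continuous e :
  continuous (fun p : R * R => mean_eval e p.1 p.2).
Proof.
apply: seq_continuous => p u up.
have [M MP] : exists M : R, forall n, `|(u n).2| <= M.
  apply: (@cvg_seq_normr_bounded _ p.2).
  exact: (cvg_comp _ _ up (@cont_snd _ _ p)).
apply: mE_cvg => [|w].
  exact: (eval_BddF e (fun n => (u n).1) (SubG_cst P MP)).
exact: (cvg_comp _ _ up (@eval_cont R b T VA QA VB QB jVA jQA jVB jQB e (X w) (@cX w) p)).
Qed.

(** The intermediate point of the mean value theorem would depend on the path with no control on
    measurability; the average does not have this defect. *)
Lemma increment_avg (g g' : R -> R) (x h : R) : continuous g' ->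
  (forall y : R, is_derive y 1 g (g' y)) ->
  g (x + h) - g x = h * avg (fun r => g' (x + h * r)).
Proof.
move=> cg' dg; have ca : continuous (fun r : R => g' (x + h * r)).
  apply: cont_comp => //; apply: contD; first exact: cont_cst.
  by apply: contM; [exact: cont_cst|move=> z; exact: cvg_id].
have c1 : continuous (fun r => h * g' (x + h * r)).
  by apply: contM => //; exact: cont_cst.
have d1 (r : R) : is_derive r 1 (fun r => g (x + h * r)) (h * g' (x + h * r)).
  exact: is_derive_comp_aff.
by rewrite -avgZ// (avgE c1 d1) mulr1 mulr0 addr0.
Qed.

Lemma eval_slice_cont e t w : continuous (fun x : R => evalX e t (flowX (X w) t x)).
Proof.
apply: (cont_comp2 (h := fun t x => evalX e t (flowX (X w) t x))).
- exact: (@eval_cont R b T VA QA VB QB jVA jQA jVB jQB e (X w) (@cX w)).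
- exact: cont_cst.
- by move=> z; exact: cvg_id.
Qed.

Lemma eval_mean_value e t w (x h : R) :
  evalX e t (flowX (X w) t (x + h)) - evalX e t (flowX (X w) t x) =
  h * avg (fun r => evalX (deriv_expr e) t (flowX (X w) t (x + h * r))).
Proof.
apply: (increment_avg (g := fun x => evalX e t (flowX (X w) t x))
  (g' := fun x => evalX (deriv_expr e) t (flowX (X w) t x))).
- exact: eval_slice_cont.
- by move=> y; exact: (eval_derive b T jVA jQA jVB jQB e t y (@cX w)).
Qed.

Lemma eval_integrable e t x : P.-integrable setT (EFin \o (fun w => evalX e t (flowX (X w) t x))).
Proof.
have s1 : SubG P (fun (_ : unit) (_ : Omega) => x) by apply: (SubG_cst _ (M := `|x|)).
exact: (BddF_integrable tt (eval_BddF e (fun=> t) s1)).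
Qed.

(** Along a sequence of steps the difference quotient is the average of the derivative over points
    near [x], a family with bounded moments. *)
Lemma mean_eval_derive e (t x : R) :
  is_derive x 1 (mean_eval e t) (mean_eval (deriv_expr e) t x).
Proof.
apply: is_derive_quotient; apply: cvg_within_seq => u u0 cu.
have [M MP] := cvg_seq_normr_bounded cu.
pose z n w := avg (fun r => evalX (deriv_expr e) t (flowX (X w) t (x + u n * r))).
have zE n w : z n w = (u n)^-1 *
    (evalX e t (flowX (X w) t (u n + x)) - evalX e t (flowX (X w) t x)).
  by rewrite [u n + x]addrC eval_mean_value mulKf//; exact: u0.
have -> : (fun n => (u n)^-1 * (mean_eval e t (u n + x) - mean_eval e t x)) =
    (fun n => mE P (z n)).
  apply/funext => n; rewrite (funext (zE n)).
  rewrite /mE RintegralZl//; last first.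
    exact: (integrableB measurableT (eval_integrable e t _) (eval_integrable e t _)).
  by rewrite RintegralB//; exact: eval_integrable.
apply: mE_cvg => [|w]; last first.
  under eq_fun do rewrite zE.
  have := quotient_is_derive (eval_derive b T jVA jQA jVB jQB e t x (@cX w)).
  move=> h A /h; rewrite /dnbhs /within /= => hA.
  have : \forall n \near \oo, u n != 0 -> A ((u n)^-1 *
     (evalX e t (flowX (X w) t (u n + x)) - evalX e t (flowX (X w) t x))).
    exact: (cu _ hA).
  by apply: filterS => n; apply; exact: u0.
apply: BddF_avg.
  move=> n w; apply: (cont_comp (h := fun x => evalX (deriv_expr e) t (flowX (X w) t x))).
    exact: eval_slice_cont.
  apply: contD; first exact: cont_cst.
  by apply: contM; [exact: cont_cst|move=> y; exact: cvg_id].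
apply: (eval_BddF (deriv_expr e) (fun=> t)).
apply: (SubG_cst _ (c := fun p : nat * unit_itv => x + u p.1 * sval p.2) (M := `|x| + M)).
move=> [n [r /= /andP[r0 r1]]].
apply: le_trans (ler_normD _ _) _; rewrite lerD2l normrM (ger0_norm r0).
by apply: le_trans (MP n); rewrite ler_piMr.
Qed.

End expected_expressions.

(** * Gaussian moments *)

Lemma growth_id {R : realType} (e : R) : 0 < e ->
  exists K : R, forall x : R, `|x| <= K * expR (e * x ^+ 2).
Proof.
move=> e0; exists (1 + e^-1) => x.
apply: le_trans (ler_1Dsqr `|x|) _; rewrite real_normK ?num_real// mulrDl mul1r lerD//.
  by rewrite -expR0 ler_expR mulr_ge0 ?sqr_ge0// ltW.
rewrite ler_pdivlMl//; apply: le_trans (expR_ge1Dx _); rewrite lerDr ler01.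
by [].
Qed.

Lemma SubG_BddF {R : realType} {d} {Omega : measurableType d} (P : probability Omega R)
  I (z : I -> Omega -> R) : SubG P z -> BddF P z.
Proof.
move=> sz; apply: (BddF_growth (f := fun _ x => x) _ _ sz).
- by move=> e e0; have [K KP] := growth_id e0; exists K.
- by move=> i x; exact: cvg_id.
Qed.

Section gaussian.
Context {R : realType}.
Variable sigma : R.
Hypothesis sigma0 : 0 < sigma.
Notation mu := (@lebesgue_measure R).
Let nu : probability (measurableTypeR R) R := normal_prob 0 sigma.
Let p : R -> R := normal_pdf 0 sigma.

Lemma integral_normal_prob (f : R -> \bar R) : nu.-integrable setT f ->
  (\int[nu]_x f x = \int[mu]_x (f x * (p x)%:E))%E.
Proof.
move=> intf; have mf := measurable_int _ intf.
have dom : nu `<< mu := normal_prob_dominates 0 sigma.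
rewrite -(Radon_Nikodym_change_of_variables dom)//=.
apply: ae_eq_integral => //.
- apply: emeasurable_funM => //; apply: (measurable_int mu).
- apply: emeasurable_funM => //=; apply/measurableT_comp => //=.
  exact: measurable_normal_pdf.
- apply: ae_eqe_mul2l => /=.
  rewrite Radon_NikodymE//=.
  case: cid => /= h [h1 h2 h3].
  apply: integral_ae_eq => //=.
  + by apply/measurableT_comp => //; exact: measurable_normal_pdf.
  + by move=> E E01 mE; rewrite -h3.
Qed.

Lemma normal_pdf0E x : p x = normal_peak sigma * expR (- x ^+ 2 / (sigma ^+ 2 *+ 2)).
Proof. by rewrite /p normal_pdfE ?gt_eqF// /normal_fun subr0. Qed.

(** [1 / (4 sigma^2)] is half the critical exponent [1 / (2 sigma^2)]: the product is again
    Gaussian, with doubled variance. *)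
Lemma gauss_exp_pdf x : expR ((4 * sigma ^+ 2)^-1 * x ^+ 2) * p x =
  Num.sqrt 2 * normal_pdf 0 (Num.sqrt 2 * sigma) x.
Proof.
have s2 : Num.sqrt 2 * sigma != 0 by rewrite mulf_neq0 ?gt_eqF// sqrtr_gt0.
rewrite normal_pdf0E normal_pdfE// /normal_fun subr0.
rewrite mulrCA -expRD [RHS]mulrA; congr (_ * expR _); last first.
  rewrite exprMn sqr_sqrtr//; field; rewrite gt_eqF//.
rewrite /normal_peak exprMn sqr_sqrtr//.
rewrite (_ : 2 * sigma ^+ 2 * pi *+ 2 = 2 * (sigma ^+ 2 * pi *+ 2)); last by ring.
by rewrite sqrtrM// invfM mulrA divff ?mul1r// gt_eqF// sqrtr_gt0.
Qed.

Lemma measurable_p : measurable_fun setT (p : measurableTypeR R -> R).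
Proof. exact: measurable_normal_pdf. Qed.

Lemma gauss_exp_moment :
  (eE nu (fun x => expR ((4 * sigma ^+ 2)^-1 * x ^+ 2)) <= 2%:E)%E.
Proof.
pose g (x : measurableTypeR R) := expR ((4 * sigma ^+ 2)^-1 * x ^+ 2).
have mg : measurable_fun setT g.
  by apply: (mfun_comp (@continuous_gauss R _)); exact: measurable_id.
(* Truncation gives the integrability required to pass to Lebesgue measure, and Fatou's lemma
   removes it. The bound 2 is a rounding of [sqrt 2], independent of [sigma]. *)
pose f_ (n : nat) x := Num.min (g x) n%:R.
have mf n : measurable_fun setT (f_ n) by exact: measurable_minr.
have f0 n x : 0 <= f_ n x by rewrite le_min expR_ge0/=.
apply: (eE_fatou mf f0) => [x|n].
  apply: cvg_near_cst; have [N _ NP] := nbhs_infty_ger (g x).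
  by exists N => // n Nn; rewrite /f_; apply: min_l; exact: (NP n Nn).
have intf : nu.-integrable setT (EFin \o f_ n).
  apply: measurable_bounded_integrable => //; first exact: (le_lt_trans (probability_le1 nu measurableT) (ltry _)).
  exists n%:R; split => // M nM x _ /=; rewrite ger0_norm ?f0//.
  by apply: le_trans (ltW nM); rewrite ge_min lexx orbT.
rewrite /eE (integral_normal_prob intf).
apply: (@le_trans _ _ (\int[mu]_x ((Num.sqrt 2)%:E * (normal_pdf 0 (Num.sqrt 2 * sigma) x)%:E))%E).
  apply: ge0_le_integral => //.
  - by move=> x _; rewrite -EFinM lee_fin mulr_ge0// normal_pdf_ge0.
  - apply/measurable_EFinP; apply: measurable_funM; last exact: measurable_p.
    exact: mf.
  - apply/measurable_EFinP; apply: measurable_funM => //.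
    exact: measurable_normal_pdf.
  - move=> x _; rewrite -!EFinM lee_fin -gauss_exp_pdf ler_wpM2r ?normal_pdf_ge0//.
    by rewrite ge_min lexx.
rewrite ge0_integralZl_EFin//.
- rewrite integral_normal_pdf mule1 lee_fin.
  by rewrite -[leRHS]ger0_norm// -sqrtr_sqr ler_wsqrtr// expr2; lra.
- by move=> x _; rewrite lee_fin normal_pdf_ge0.
- by apply/measurable_EFinP; exact: measurable_normal_pdf.
Qed.

Lemma gauss_SubG : SubG nu (fun (_ : unit) (x : measurableTypeR R) => x).
Proof.
split; first by move=> _; exact: measurable_id.
exists (4 * sigma ^+ 2)^-1; first by rewrite invr_gt0 mulr_gt0// exprn_gt0.
by exists 2 => _; exact: gauss_exp_moment.
Qed.

(** Unlike in [RI_FTC], the left end may lie below -1, as for the intervals [[- n, n]]. *)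
Lemma RI_FTC_line (g G : R -> R) (t s : R) : continuous g -> t < s ->
  (forall x : R, is_derive x 1 G (g x)) -> RI t s g = G s - G t.
Proof.
move=> cg ts dG; rewrite /RI /Rintegral (continuous_FTC2 (F := G) ts)//.
- exact: continuous_subspaceT.
- split; first by move=> x _; have [] := dG x.
  + by apply: cvg_at_right_filter; exact: is_derive_continuous (dG t).
  + by apply: cvg_at_left_filter; exact: is_derive_continuous (dG s).
- by move=> x _; rewrite derive1E; have [_ ->] := dG x.
Qed.

Lemma continuous_p : continuous p.
Proof. by apply: continuous_normal_pdf; rewrite gt_eqF. Qed.

Lemma is_derive_p (x : R) : is_derive x 1 p (- (x / sigma ^+ 2) * p x).
Proof.
have pE : p = fun x => normal_peak sigma * expR (- (2 * sigma ^+ 2)^-1 * x ^+ 2).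
  by apply/funext => y; rewrite normal_pdf0E; congr (_ * expR _); field; rewrite gt_eqF.
rewrite pE; have s0 : sigma != 0 by rewrite gt_eqF.
have d2 : is_derive x 1 (fun y : R => - (2 * sigma ^+ 2)^-1 * y ^+ 2) (- (x / sigma ^+ 2)).
  have dx := @is_derive_id R R x 1.
  apply: is_derive_eq (is_deriveZl (- (2 * sigma ^+ 2)^-1) (is_deriveMr dx dx)) _.
  by field.
have de := is_derive1_comp (is_derive_expR _) d2.
by apply: is_derive_eq (is_deriveZl (normal_peak sigma) de) _; ring.
Qed.

Lemma gauss_truncated (g : R -> R) (n : nat) : continuous g ->
  BddF nu (fun (_ : unit) (x : measurableTypeR R) => g x * \1_(`[- n%:R, n%:R]) x) ->
  mE nu (fun x : measurableTypeR R => g x * \1_(`[- n%:R, n%:R]) x) =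
  RI (- n%:R) n%:R (fun x => g x * p x).
Proof.
move=> cg Bg; rewrite /mE /RI /Rintegral; congr fine.
rewrite integral_normal_prob; last exact: (BddF_integrable tt Bg).
rewrite [RHS]integral_mkcond; apply: eq_integral => x _.
rewrite -EFinM /= patchE indicE; case: ifPn => _ /=; first by rewrite mulr1.
by rewrite mulr0 mul0r.
Qed.

Lemma BddF_truncated (g : R -> R) :
  BddF nu (fun (_ : unit) (x : measurableTypeR R) => g x) ->
  BddF nu (fun (n : nat) (x : measurableTypeR R) => g x * \1_(`[- n%:R, n%:R]) x).
Proof.
move=> Bg; apply: (BddF_le (r := fun=> tt) _ _ Bg) => [n|n x].
  by apply: measurable_funM; [exact: (Bg.1 tt)|exact: measurable_indic].
by rewrite normrM ler_piMr// indicE; case: (_ \in _); rewrite ?normr1// normr0.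
Qed.

(** Gaussian moments become limits of boundary values: truncate to [[- n, n]], integrate the
    derivative of [G], and let [n] grow. *)
Lemma gauss_moment_lim (g G : R -> R) : continuous g ->
  BddF nu (fun (_ : unit) (x : measurableTypeR R) => g x) ->
  (forall x : R, is_derive x 1 G (g x * p x)) ->
  G n%:R - G (- n%:R) @[n --> \oo] --> mE nu (g : measurableTypeR R -> R).
Proof.
move=> cg Bg dG; have Bt := BddF_truncated Bg.
have -> : (fun n : nat => G n%:R - G (- n%:R)) =
    (fun n => mE nu (fun x : measurableTypeR R => g x * \1_(`[- n%:R, n%:R]) x)).
  apply/funext => n; rewrite gauss_truncated//; last exact: (BddF_reindex (fun=> n) Bt).
  have [->|n0] := posnP n.
    by rewrite oppr0 subrr /RI set_itv1 Rintegral_set1.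
  rewrite (RI_FTC_line _ _ dG)//.
    by apply: contM => //; exact: continuous_p.
  by apply: gtrN; rewrite ltr0n.
apply: mE_cvg => // x; apply: cvg_near_cst.
have [N _ NP] := nbhs_infty_ger `|x|; exists N => // n Nn /=.
rewrite indicE mem_set ?mulr1//= in_itv/= -ler_norml; exact: (NP n Nn).
Qed.

(** The antiderivative [- sigma^2 p] is even, so the boundary values cancel. *)
Lemma gauss_mean0 : mE nu (fun x : measurableTypeR R => x) = 0.
Proof.
have c1 : continuous (fun x : R => x) by move=> x; exact: cvg_id.
have dG (x : R) : is_derive x 1 (fun x => - sigma ^+ 2 * p x) (x * p x).
  apply: is_derive_eq (is_deriveZl _ (is_derive_p x)) _.
  by field; rewrite gt_eqF.
have := gauss_moment_lim c1 (SubG_BddF gauss_SubG) dG.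
have -> : (fun n : nat => - sigma ^+ 2 * p n%:R - - sigma ^+ 2 * p (- n%:R)) = fun=> 0.
  by apply/funext => n; rewrite !normal_pdf0E sqrrN subrr.
by move=> h; exact: (cvg_unique _ h (cvg_cst 0)).
Qed.

Lemma gauss_variance : mE nu (fun x : measurableTypeR R => x ^+ 2 - sigma ^+ 2) = 0.
Proof.
have B1 := SubG_BddF gauss_SubG.
have c2 : continuous (fun x : R => x ^+ 2 - sigma ^+ 2).
  by apply: contB; [exact: exprn_continuous|exact: cont_cst].
have B2 : BddF nu (fun (_ : unit) (x : measurableTypeR R) => x ^+ 2 - sigma ^+ 2).
  apply: BddF_D; first exact: (BddF_M B1 B1).
  by apply: (BddF_cst _ (c := fun=> - sigma ^+ 2) (M := `|sigma ^+ 2|)) => _; rewrite normrN.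
have dG (x : R) : is_derive x 1 (fun x => - sigma ^+ 2 * (x * p x)) ((x ^+ 2 - sigma ^+ 2) * p x).
  apply: is_derive_eq (is_deriveZl _ (is_deriveMr (is_derive_id x 1) (is_derive_p x))) _.
  by field; rewrite gt_eqF.
have h := gauss_moment_lim c2 B2 dG.
suff h0 : - sigma ^+ 2 * (n%:R * p n%:R) - - sigma ^+ 2 * (- n%:R * p (- n%:R))
    @[n --> \oo] --> (0 : R) by exact: (cvg_unique _ h h0).
apply/norm_cvg0P.
pose K := sigma ^+ 2 * (2 * (normal_peak sigma * (sigma ^+ 2 *+ 2))).
have cK : K * n%:R^-1 @[n --> \oo] --> (0 : R).
  rewrite -[X in _ --> X](mulr0 K); apply: cvgM; first exact: cvg_cst.
  by rewrite -cvg_shiftS; exact: cvg_harmonic.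
apply: (squeeze_cvgr _ (cvg_cst 0) cK); near=> n; rewrite normr_ge0/=.
have n0 : 0 < n%:R :> R by rewrite ltr0n; near: n; exists 1%N.
rewrite !normal_pdf0E sqrrN.
set E := expR _.
(* From [u <= exp u] at [u = n^2 / (2 sigma^2)]: the boundary terms decay like [1 / n]. *)
have nE : n%:R * E <= (sigma ^+ 2 *+ 2) * n%:R^-1.
  rewrite ler_pdivlMr// mulrAC -expr2 /E mulNr expRN ler_pdivrMr ?expR_gt0//.
  rewrite -ler_pdivrMl; last by rewrite mulrn_wgt0// exprn_gt0.
  by rewrite mulrC; apply: le_trans (expR_ge1Dx _); rewrite lerDr ler01.
rewrite [X in `|X|](_ : _ = - (sigma ^+ 2 * (2 * (normal_peak sigma * (n%:R * E))))); last by ring.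
rewrite normrN ger0_norm; last first.
  by rewrite mulr_ge0 ?sqr_ge0// mulr_ge0// mulr_ge0 ?normal_peak_ge0// mulr_ge0// expR_ge0.
rewrite [leRHS](_ : _ = sigma ^+ 2 * (2 * (normal_peak sigma * ((sigma ^+ 2 *+ 2) / n%:R)))); last by rewrite /K; ring.
apply: ler_wpM2l; first exact: sqr_ge0.
by apply: ler_wpM2l => //; apply: ler_wpM2l => //; exact: normal_peak_ge0.
Unshelve. all: by end_near. Qed.

Context {d : measure_display} {Omega : measurableType d}.
Variables (P : probability Omega R) (N : Omega -> R).
Hypothesis mN : measurable_fun setT N.
Hypothesis lawN : forall B : set R, measurable B -> P (N @^-1` B) = normal_prob 0 sigma B.

Let mN' : measurable_fun setT (N : Omega -> measurableTypeR R).
Proof. by move=> mD Y mY; exact: (mN mD mY). Qed.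

Lemma gauss_law_eE (phi : R -> R) : continuous phi -> (forall x, 0 <= phi x) ->
  eE P (fun w => phi (N w)) = eE nu (phi : measurableTypeR R -> R).
Proof.
move=> cphi phi0; rewrite /eE.
have mphi : measurable_fun setT (phi : measurableTypeR R -> R).
  exact: continuous_measurable_fun.
have := @ge0_integral_pushforward _ _ Omega (measurableTypeR R) R N mN' P setT (fun x => (phi x)%:E) measurableT.
move=> H; transitivity (\int[P]_(x in N @^-1` setT) ((fun x => (phi x)%:E) \o N) x)%E.
  by rewrite preimage_setT.
rewrite -H//; last 2 first.
- exact/measurable_EFinP.
- by move=> x _; rewrite lee_fin.
by apply: eq_measure_integral => A mA _; exact: lawN.
Qed.

Lemma gauss_law_mE (phi : R -> R) : continuous phi ->
  P.-integrable setT (EFin \o (fun w => phi (N w))) ->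
  mE P (fun w => phi (N w)) = mE nu (phi : measurableTypeR R -> R).
Proof.
move=> cphi intphi; rewrite /mE /Rintegral; congr fine.
have mphi : measurable_fun setT (EFin \o (phi : measurableTypeR R -> R)).
  by apply/measurable_EFinP; exact: continuous_measurable_fun.
have intphi' : P.-integrable (N @^-1` setT) ((EFin \o phi) \o N).
  by rewrite preimage_setT.
have := @integral_pushforward _ _ Omega (measurableTypeR R) R N mN' P setT _ mphi intphi' measurableT.
rewrite preimage_setT => <-.
by apply: eq_measure_integral => A mA _; exact: lawN.
Qed.

Lemma gauss_law_exp_moment : (eE P (fun w => expR ((4 * sigma ^+ 2)^-1 * N w ^+ 2)) <= 2%:E)%E.
Proof.
rewrite (gauss_law_eE (phi := fun x => expR ((4 * sigma ^+ 2)^-1 * x ^+ 2))).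
- exact: gauss_exp_moment.
- exact: continuous_gauss.
- by move=> x; exact: expR_ge0.
Qed.

Lemma gauss_law_SubG : SubG P (fun _ : unit => N).
Proof.
split => //; exists (4 * sigma ^+ 2)^-1; first by rewrite invr_gt0 mulr_gt0// exprn_gt0.
by exists 2 => _; exact: gauss_law_exp_moment.
Qed.

Lemma gauss_law_mean0 : mE P N = 0.
Proof.
rewrite (gauss_law_mE (phi := fun x => x)); first exact: gauss_mean0.
- by move=> x; exact: cvg_id.
- exact: (BddF_integrable tt (SubG_BddF gauss_law_SubG)).
Qed.

Lemma gauss_law_variance : mE P (fun w => N w ^+ 2 - sigma ^+ 2) = 0.
Proof.
have B1 := SubG_BddF gauss_law_SubG.
rewrite (gauss_law_mE (phi := fun x => x ^+ 2 - sigma ^+ 2)); first exact: gauss_variance.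
- by apply: contB; [exact: exprn_continuous|exact: cont_cst].
- have B2 : BddF P (fun (_ : unit) w => N w ^+ 2 - sigma ^+ 2).
    apply: BddF_D; first exact: (BddF_M B1 B1).
    by apply: (BddF_cst _ (c := fun=> - sigma ^+ 2) (M := `|sigma ^+ 2|)) => _; rewrite normrN.
  exact: (BddF_integrable tt B2).
Qed.

End gaussian.

(** * The Ornstein-Uhlenbeck flow *)

Section clip.
Context {R : realType}.
Implicit Types (f g : R -> R) (t s lo hi x : R).

(** [clamp] with an arbitrary lower end: a solution started at [t] is continuous on [[t, T]]
    only. *)
Definition clip lo hi s : R := Num.max lo (Num.min hi s).

Lemma clip_itv lo hi s : lo <= hi -> lo <= clip lo hi s <= hi.
Proof. by move=> lh; rewrite /clip le_max lexx/= ge_max lh/= ge_min lexx. Qed.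

Lemma clip_id lo hi s : lo <= s <= hi -> clip lo hi s = s.
Proof. by move=> /andP[t0 tT]; rewrite /clip min_r// max_r. Qed.

Lemma clip_continuous lo hi : continuous (clip lo hi).
Proof.
move=> t; apply: continuous_max; first exact: cvg_cst.
by apply: continuous_min; [exact: cvg_cst|exact: cvg_id].
Qed.

Lemma within_clip f lo hi : lo <= hi -> {within `[lo, hi], continuous f} ->
  continuous (fun s => f (clip lo hi s)).
Proof.
move=> lh cf s; have cl := clip_itv s lh.
have /subspace_continuousP/(_ (clip lo hi s)) cfs := cf.
have {}cfs := cfs _; rewrite /= in_itv/= in cfs.
move=> A /(cfs cl); rewrite /within /= => hA.
have := @clip_continuous lo hi s _ hA.
apply: (@filterS _ (nbhs s)) => r /=; apply; rewrite in_itv/=; exact: clip_itv.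
Qed.

End clip.

Section linear_ode.
Context {R : realType}.
Variable b : R.
Implicit Types (f g y : R -> R) (t s lo hi x : R).

Lemma is_derive_expRl (k x : R) : is_derive x 1 (fun y : R => expR (k * y)) (k * expR (k * x)).
Proof.
have dl : is_derive x 1 (fun y : R => k * y) k.
  by apply: is_derive_eq (is_deriveZl k (is_derive_id x 1)) _; rewrite mulr1.
by apply: is_derive_eq (is_derive1_comp (is_derive_expR _) dl) _; rewrite mulrC.
Qed.

Lemma expRl_cont (k : R) : continuous (fun r : R => expR (k * r)).
Proof. by move=> r; exact: is_derive_continuous (is_derive_expRl k r). Qed.

(* Variation of constants, stated for the integral of [y], which stays
   differentiable when [g] is merely continuous. *)
Lemma linear_ode_integral y g t T : continuous y -> continuous g -> -1 < t ->
  (forall s, t <= s <= T -> y s = g s + b * RI t s y) ->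
  forall s, t <= s <= T ->
    RI t s y = expR (b * s) * RI t s (fun r => expR (- b * r) * g r).
Proof.
move=> cy cg t1 E s /andP[ts sT].
have cg' : continuous (fun r : R => expR (- b * r) * g r).
  by apply: contM => //; exact: expRl_cont.
pose H := fun r : R => expR (- b * r) * (Ant y r - Ant y t).
have dH r : t <= r <= s -> is_derive r 1 H (expR (- b * r) * g r).
  move=> /andP[tr rs]; have r1 := lt_le_trans t1 tr.
  have dA : is_derive r 1 (fun r => Ant y r - Ant y t) (y r).
    apply: is_derive_eq (is_deriveB (is_derive_Ant cy r1) (is_derive_cst (Ant y t) r 1)) _.
    by rewrite subr0.
  apply: is_derive_eq (is_deriveMr (is_derive_expRl (- b) r) dA) _.
  rewrite E ?tr ?(le_trans rs)// RI_Ant ?(ltW t1)//; ring.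
rewrite (RI_FTC cg' t1 ts dH) /H subrr mulr0 subr0 mulrA -expRD mulNr subrr expR0 mul1r.
by rewrite RI_Ant// ltW.
Qed.

Lemma RI_D f g t s : continuous f -> continuous g ->
  RI t s (fun r => f r + g r) = RI t s f + RI t s g.
Proof. by move=> cf cg; apply: RintegralD => //; exact: cont_integrable. Qed.

Lemma RI_Z k g t s : continuous g -> RI t s (fun r => k * g r) = k * RI t s g.
Proof. by move=> cg; apply: RintegralZl => //; exact: cont_integrable. Qed.

Lemma RI_cst k t s : -1 < t -> t <= s -> RI t s (fun=> k) = k * (s - t).
Proof.
move=> t1 ts; have dG (x : R) : t <= x <= s -> is_derive x 1 (fun x => k * x) k.
  by move=> _; apply: is_derive_eq (is_deriveZl k (is_derive_id x 1)) _; rewrite mulr1.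
by rewrite (RI_FTC (@cont_cst _ _ k) t1 ts dG) mulrBr.
Qed.

Lemma eq_RI f g t s : (forall r, t <= r <= s -> f r = g r) -> RI t s f = RI t s g.
Proof. by move=> fg; apply: eq_Rintegral => x; rewrite inE/= in_itv/=; exact: fg. Qed.

Lemma RI_ecoef t s : -1 < t -> t <= s -> b * RI t s (ecoef b t) = ecoef b t s - 1.
Proof.
move=> t1 ts; have ce : continuous (ecoef b t).
  by apply: (ecoef_cont (f := fun=> t)); [exact: cont_cst|move=> z; exact: cvg_id].
have dG (x : R) : t <= x <= s -> is_derive x 1 (ecoef b t) (b * ecoef b t x).
  move=> _; have E (y : R) : ecoef b t y = expR (- (b * t)) * expR (b * y).
    by rewrite -expRD /ecoef; congr expR; ring.
  rewrite (funext E); apply: is_derive_eq (is_deriveZl _ (is_derive_expRl b x)) _.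
  by ring.
have cb : continuous (fun r => b * ecoef b t r) by apply: contM => //; exact: cont_cst.
by rewrite -RI_Z// (RI_FTC cb t1 ts dG) {2}/ecoef subrr mulr0 expR0.
Qed.

End linear_ode.

Section ou_path.
Context {R : realType}.
Variables (a b c T : R).
Hypothesis T0 : 0 < T.
Variables (W : R -> R) (Y : R -> R -> R -> R).
Hypothesis cW : {within `[0, T], continuous W}.
Hypothesis YP : forall t x : R, 0 <= t <= T ->
  {within `[t, T], continuous (Y t x)} /\
  (forall s : R, t <= s <= T ->
     Y t x s = x + RI t s (fun r => a + b * Y t x r) + c * (W s - W t)).

Implicit Types (t s x r q : R).

Let X (s : R) : R := Y 0 0 (clamp T s).
Let ou_noise t x s : R := x + a * (s - t) + c * (W (clamp T s) - W (clamp T t)).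

Lemma ou_path_continuous : continuous X.
Proof.
have T00 : 0 <= (0 : R) <= T by rewrite lexx ltW.
by have [cY _] := YP 0 T00; exact: (within_clip (ltW T0) cY).
Qed.

Lemma clamp_within_continuous (f : R -> R) : {within `[0, T], continuous f} ->
  continuous (fun s => f (clamp T s)).
Proof. exact: (within_clip (ltW T0)). Qed.

Lemma ou_noise_continuous t x : continuous (ou_noise t x).
Proof.
have cWc := clamp_within_continuous cW.
apply: contD.
  apply: contD; first exact: cont_cst.
  apply: contM; first exact: cont_cst.
  by apply: contB; [move=> z; exact: cvg_id|exact: cont_cst].
apply: contM; first exact: cont_cst.
by apply: contB => //; exact: cont_cst.
Qed.

Lemma ou_integral_eq t x (y : R -> R) : 0 <= t <= T -> continuous y ->
  (forall s, t <= s <= T -> y s = Y t x s) ->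
  forall s, t <= s <= T -> y s = ou_noise t x s + b * RI t s y.
Proof.
move=> tT cy yE s /andP[ts sT]; have [_ YE] := YP x tT.
have /andP[t0 _] := tT; have t1 : -1 < t by rewrite (lt_le_trans _ t0)// ltrN10.
rewrite yE ?ts// YE ?ts// /ou_noise !clamp_id ?tT//; last by rewrite sT (le_trans t0).
rewrite (@eq_RI _ _ (fun r => a + b * y r)); last first.
  by move=> r /andP[tr rs]; rewrite yE// tr (le_trans rs).
rewrite RI_D; [|exact: cont_cst|by apply: contM => //; exact: cont_cst].
by rewrite RI_cst// RI_Z//; ring.
Qed.

Lemma ou_path_eq s : 0 <= s <= T -> X s = ou_noise 0 0 s + b * RI 0 s X.
Proof.
apply: ou_integral_eq; first by rewrite lexx ltW.
  exact: ou_path_continuous.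
by move=> r rT; rewrite /X clamp_id.
Qed.

(** Both sides satisfy [y = ou_noise + b * int y] with the same noise; [linear_ode_integral]
    determines [int y] from the noise, hence [y] itself. *)
Lemma ou_flow_eq t x s : 0 <= t <= T -> t <= s <= T -> Y t x s = flow b T X t x s.
Proof.
move=> tT tsT; have /andP[t0 tT'] := tT.
have t1 : -1 < t by rewrite (lt_le_trans _ t0)// ltrN10.
have [cY _] := YP x tT.
pose y r := Y t x (clip t T r).
have cy : continuous y by exact: within_clip.
have yE r : t <= r <= T -> y r = Y t x r by move=> tr; rewrite /y clip_id.
have Ey := ou_integral_eq tT cy yE.
have cX := ou_path_continuous.
pose z := flow b T X t x.
have ce : continuous (ecoef b t).
  by apply: (ecoef_cont (f := fun=> t)); [exact: cont_cst|move=> r; exact: cvg_id].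
have cz : continuous z.
  by apply: (flow_cont (f := fun=> t) (g := fun=> x)) => //; try exact: cont_cst; move=> r; exact: cvg_id.
have Ez r : t <= r <= T -> z r = ou_noise t x r + b * RI t r z.
  move=> /andP[tr rT]; have r0 := le_trans t0 tr.
  have zE q : z q = X q + (x - X t) * ecoef b t q.
    by rewrite /z /flow clamp_id// [_ * (x - _)]mulrC.
  rewrite (funext zE) RI_D//; last by apply: contM => //; exact: cont_cst.
  rewrite RI_Z// mulrDr [b * ((x - X t) * _)]mulrCA RI_ecoef//.
  have E1 := @ou_path_eq r; rewrite r0 rT in E1; rewrite {1}E1//.
  have E2 := ou_path_eq tT; rewrite E2.
  rewrite !RI_Ant ?lerN10 ?(ltW t1)// /ou_noise.
  by ring.
rewrite -yE// Ey// -/z Ez//; congr (_ + b * _).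
rewrite (linear_ode_integral cy (@ou_noise_continuous t x) t1 Ey)//.
by rewrite (linear_ode_integral cz (@ou_noise_continuous t x) t1 Ez).
Qed.

(** [flow] is defined through a solution started at time 0; this form shows that from [t] on it
    depends only on increments of the noise after [t]. *)
Lemma ou_flow_explicit t x s : 0 <= t <= T -> t <= s <= T ->
  flow b T X t x s = ou_noise t x s + b * expR (b * s) *
   ((s - t) * avg (fun r => expR (- b * (t + (s - t) * r)) * ou_noise t x (t + (s - t) * r))).
Proof.
move=> tT /andP[ts sT]; have /andP[t0 tT'] := tT.
have t1 : -1 < t by rewrite (lt_le_trans _ t0)// ltrN10.
have cz : continuous (flow b T X t x).
  apply: (flow_cont (f := fun=> t) (g := fun=> x)); try exact: cont_cst.
    exact: ou_path_continuous.
  by move=> r; exact: cvg_id.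
have zE r : t <= r <= T -> flow b T X t x r = Y t x r by move=> tr; rewrite ou_flow_eq.
have Ez := ou_integral_eq tT cz zE.
have cn : continuous (fun r => expR (- b * r) * ou_noise t x r).
  by apply: contM; [exact: expRl_cont|exact: ou_noise_continuous].
rewrite Ez ?ts// (linear_ode_integral cz (@ou_noise_continuous t x) t1 Ez) ?ts// mulrA.
by rewrite (RI_avg cn).
Qed.

End ou_path.

(** * Independence of the Brownian future *)

Section independence.
Context {R : realType} {d : measure_display} {Omega : measurableType d}.
Variable P : probability Omega R.

Definition indep_of (A : set Omega) (G : set (set Omega)) :=
  forall E, G E -> P (A `&` E) = (P A * P E)%E.

(** The finite measures [P (A & E)] and [P A * P E] agree on a class closed under intersection that
    contains the whole space, hence on what it generates. *)
Lemma indep_of_gen A (Pi : set (set Omega)) : measurable A -> Pi `<=` measurable ->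
  Pi setT -> setI_closed Pi -> indep_of A Pi -> indep_of A <<s Pi>>.
Proof.
move=> mA mPi PiT PiI iA E sE.
have fA : P A \is a fin_num by exact: fin_num_measure.
pose r : {nonneg R} := NngNum (fine_ge0 (measure_ge0 P A)).
have rE : (r%:num)%:E = P A by rewrite /r /= fineK.
have m1E B : mrestr P mA B = P (A `&` B) by rewrite /mrestr setIC.
have m2E B : mscale r P B = (P A * P B)%E by rewrite -rE.
have : mrestr P mA E = mscale r P E.
  apply: (@g_sigma_algebra_measure_unique d R Omega Pi _ (fun=> setT)) => //.
  - by rewrite bigcup_const//; exists 0%N.
  - by move=> B PiB; exact: (etrans (m1E B) (etrans (iA _ PiB) (esym (m2E B)))).
  - move=> k; have : (mrestr P mA setT < +oo)%E; last by [].
    by rewrite m1E setIT; exact: le_lt_trans (probability_le1 P mA) (ltry _).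
by rewrite /mrestr /mscale rE setIC.
Qed.

(** Independence says that the joint law is the product of the marginal laws, since they agree on
    rectangles; Fubini's theorem then factors the mean. *)
Lemma mE_indep (y z : Omega -> R) :
  measurable_fun setT y -> measurable_fun setT z ->
  (forall B C : set R, measurable B -> measurable C ->
     P (y @^-1` B `&` z @^-1` C) = (P (y @^-1` B) * P (z @^-1` C))%E) ->
  P.-integrable setT (EFin \o y) -> P.-integrable setT (EFin \o z) ->
  P.-integrable setT (EFin \o (fun w => y w * z w)) ->
  mE P (fun w => y w * z w) = mE P y * mE P z.
Proof.
move=> my mz ind iy iz iyz.
pose Y : {mfun Omega >-> R} := HB.pack y (isMeasurableFun.Build _ _ _ _ _ my).
pose Z : {mfun Omega >-> R} := HB.pack z (isMeasurableFun.Build _ _ _ _ _ mz).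
have myz : measurable_fun setT (fun w => (y w, z w)) by exact: measurable_fun_pair.
pose YZ : {mfun Omega >-> (R * R)%type} :=
  HB.pack (fun w => (y w, z w)) (isMeasurableFun.Build _ _ _ _ _ myz).
pose m1 := distribution P Y; pose m2 := distribution P Z.
pose f := fun p : R * R => (p.1 * p.2)%:E.
have mf : measurable_fun setT f.
  by apply/measurable_EFinP; apply: measurable_funM; [exact: measurable_fst|exact: measurable_snd].
have E1 : (\int[distribution P YZ]_p f p = \int[P]_w (y w * z w)%:E)%E.
  by rewrite integral_distribution.
have prodE (X : set (R * R)) : measurable X -> (m1 \x m2)%E X = distribution P YZ X.
  apply: product_measure_unique => A B mA mB.
  rewrite /m1 /m2 /distribution /pushforward /= -ind//.
have intf : (m1 \x m2)%E.-integrable setT f.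
  apply/integrableP; split => //.
  rewrite (eq_measure_integral (distribution P YZ)); last by move=> A mA _; exact: prodE.
  rewrite ge0_integral_distribution//; last exact: measurableT_comp.
  by have /integrableP[] := iyz.
have E2 : (\int[m1 \x m2]_p f p = \int[P]_w (y w * z w)%:E)%E.
  by rewrite -E1; apply: eq_measure_integral => A mA _; exact: prodE.
have i2 : m2.-integrable setT (EFin \o id).
  apply/integrableP; split; first exact/measurable_EFinP.
  rewrite ge0_integral_distribution//; last first.
    by apply: measurableT_comp => //; exact/measurable_EFinP.
  by have /integrableP[] := iz.
have i1 : m1.-integrable setT (EFin \o id).
  apply/integrableP; split; first exact/measurable_EFinP.
  rewrite ge0_integral_distribution//; last first.
    by apply: measurableT_comp => //; exact/measurable_EFinP.
  by have /integrableP[] := iy.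
have e2 : (\int[m2]_y y%:E = (mE P z)%:E)%E.
  rewrite /mE /Rintegral fineK; last exact: integrable_fin_num.
  by rewrite integral_distribution//; exact/measurable_EFinP.
have e1 : (\int[m1]_y y%:E = (mE P y)%:E)%E.
  rewrite /mE /Rintegral fineK; last exact: integrable_fin_num.
  by rewrite integral_distribution//; exact/measurable_EFinP.
have := integral12_prod_meas1 intf; rewrite E2.
have inner x : (\int[m2]_y f (x, y) = x%:E * (mE P z)%:E)%E.
  by rewrite -e2 -(integralZl measurableT i2 x); apply: eq_integral => y' _; rewrite /f EFinM.
rewrite (eq_integral _ _ (fun x _ => inner x)).
rewrite (integralZr measurableT i1 (mE P z)) e1.
move=> h; apply: EFin_inj; rewrite EFinM h.
by rewrite {1}/mE /Rintegral fineK//; exact: integrable_fin_num iyz.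
Qed.

End independence.

Section brownian_future.
Context {R : realType} {d : measure_display} {Omega : measurableType d}.
Variables (P : probability Omega R) (F : R -> set (set Omega)) (W : R -> Omega -> R).
Hypotheses (FP : usual_filtration P F) (WP : brownian_motion P F W).
Implicit Types (t r q lo hi : R) (s : seq R).

Let F_sigma t : 0 <= t -> sigma_algebra setT (F t).
Proof. by have [h _ _ _ _] := FP; exact: h. Qed.

Let F_meas t : 0 <= t -> F t `<=` measurable.
Proof. by have [_ h _ _ _] := FP; exact: h. Qed.

Let F_mono r t : 0 <= r -> r <= t -> F r `<=` F t.
Proof. by have [_ _ h _ _] := FP; exact: h. Qed.

Lemma F_setI t A B : 0 <= t -> F t A -> F t B -> F t (A `&` B).
Proof.
move=> t0 FA FB; have sF := F_sigma t0.
have E := measurable_g_measurableTypeE sF.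
by rewrite -E; apply: measurableI; rewrite E.
Qed.

Lemma F_increment r t B : 0 <= r -> r <= t -> measurable B ->
  F t ((fun w => W t w - W r w) @^-1` B).
Proof.
move=> s0 st mB; have t0 := le_trans s0 st; have sF := F_sigma t0.
have E := measurable_g_measurableTypeE sF.
have [_ _ ad _ _] := WP.
have mW q : 0 <= q -> q <= t ->
    measurable_fun setT (W q : g_sigma_algebraType (F t) -> R).
  move=> r0 rt _ C mC; rewrite setTI E; apply: (F_mono r0 rt); exact: ad.
have := measurable_funB (mW t t0 (lexx _)) (mW r s0 st).
by move=> /(_ measurableT B mB); rewrite setTI E.
Qed.

Lemma mfun_increment r t : 0 <= r -> r <= t ->
  measurable_fun setT (fun w => W t w - W r w).
Proof.
move=> s0 st _ B mB; rewrite setTI; apply: (F_meas (le_trans s0 st)).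
exact: F_increment.
Qed.

Definition grid_future t (s : seq R) : set (set Omega) :=
  <<s [set E | exists2 r, r \in s & exists2 B : set R, measurable B &
        E = (fun w => W r w - W t w) @^-1` B] >>.

Lemma grid_future_meas t s : 0 <= t -> (forall r, r \in s -> t <= r) ->
  grid_future t s `<=` measurable.
Proof.
move=> t0 ts; apply: smallest_sub; first exact: sigma_algebra_measurable.
move=> _ [r rs [B mB ->]].
by have := mfun_increment t0 (ts r rs) measurableT mB; rewrite setTI.
Qed.

Lemma grid_future_mono t s s' : {subset s <= s'} ->
  grid_future t s `<=` grid_future t s'.
Proof.
move=> ss'; apply: smallest_sub; first exact: smallest_sigma_algebra.
move=> _ [r rs [B mB ->]]; apply: sub_gen_smallest.
by exists r; [exact: ss'|exists B].
Qed.

(** Induction on the times. With [D] the increment up to the first time [r], any later increment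
    from [t] is [D] plus an increment from [r]. So the sets combining an event of [D] with one of
    the future of [r] generate everything and are closed under intersection. *)
Lemma grid_future_indep_sorted s t A : 0 <= t -> sorted <=%R s ->
  (forall r, r \in s -> t <= r) -> F t A -> indep_of P A (grid_future t s).
Proof.
elim: s t A => [|r s IH] t A t0 ss ts FA.
  have mA := F_meas t0 FA.
  have iT : indep_of P A <<s [set setT]>>.
    apply: indep_of_gen => //.
    - by move=> _ ->; exact: measurableT.
    - by move=> _ _ -> ->; rewrite /= setIT.
    - by move=> _ ->; rewrite setIT probability_setT mule1.
  move=> E sE; apply: iT; move: E sE; apply: smallest_sub.
    exact: smallest_sigma_algebra.
  by move=> E [].
have tr : t <= r by apply: ts; rewrite mem_head.
have r0 := le_trans t0 tr.
have rs q : q \in s -> r <= q.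
  move=> qs; have := ss; rewrite /= (path_sortedE le_trans) => /andP[/allP + _].
  exact.
have ss' : sorted <=%R s by exact: path_sorted ss.
have IHr := IH r _ r0 ss' rs.
pose D := fun w => W r w - W t w.
pose Pi := [set E | exists2 B : set R, measurable B & exists2 C, grid_future r s C &
   E = D @^-1` B `&` C].
have gT q u : grid_future q u setT.
  by rewrite -setC0; apply: sigma_algebraC; exact: sigma_algebra0.
have mG := grid_future_meas r0 rs.
have mD : measurable_fun setT D by exact: mfun_increment.
have mDB B : measurable B -> measurable (D @^-1` B).
  by move=> mB; rewrite -[X in measurable X]setTI; exact: mD.
have FDB B : measurable B -> F r (D @^-1` B) by move=> mB; exact: F_increment.
have FrA : F r A by exact: F_mono FA.
have iD B : measurable B -> P (A `&` D @^-1` B) = (P A * P (D @^-1` B))%E.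
  (* Independent increments are given for strictly ordered times; if [r = t] the increment is the
     constant 0. *)
  move=> mB; move: tr; rewrite le_eqVlt => /predU1P[rt|tr].
    have -> : D = fun=> 0 by apply/funext => w; rewrite /D -rt subrr.
    rewrite preimage_cst; case: ifPn => _; first by rewrite setIT probability_setT mule1.
    by rewrite setI0 measure0 mule0.
  by have [_ _ _ h _] := WP; exact: h.
have iPi : indep_of P A <<s Pi>>.
  apply: indep_of_gen.
  - exact: F_meas FA.
  - by move=> _ [B mB [C gC ->]]; apply: measurableI; [exact: mDB|exact: mG].
  - by exists setT => //; exists setT => //; rewrite preimage_setT setIT.
  - move=> _ _ [B mB [C gC ->]] [B' mB' [C' gC' ->]].
    exists (B `&` B'); first exact: measurableI.
    exists (C `&` C'); last by rewrite preimage_setI setIACA.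
    exact: (@measurableI _ (g_sigma_algebraType _)).
  - move=> _ [B mB [C gC ->]]; rewrite setIA.
    (* The induction hypothesis at [r] detaches [C] twice: here from [A] together with the event of
       [D], then from the event of [D] alone. *)
    rewrite (IHr _ (F_setI r0 FrA (FDB B mB)) _ gC) iD// -muleA; congr (_ * _)%E.
    by rewrite (IHr _ (FDB B mB) _ gC).
move=> E sE; apply: iPi; move: E sE; apply: smallest_sub.
  exact: smallest_sigma_algebra.
move=> _ [q qrs [B mB ->]].
have mDPi : measurable_fun setT (D : g_sigma_algebraType Pi -> R).
  move=> _ C mC; rewrite setTI; apply: sub_gen_smallest.
  by exists C => //; exists setT => //; rewrite setIT.
move: qrs; rewrite inE => /predU1P[->|qs].
  by have := mDPi measurableT B mB; rewrite setTI.
have mq : measurable_fun setT ((fun w => W q w - W r w) : g_sigma_algebraType Pi -> R).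
  move=> _ C mC; rewrite setTI; apply: sub_gen_smallest.
  exists setT => //; exists ((fun w => W q w - W r w) @^-1` C); last by rewrite preimage_setT setTI.
  by apply: sub_gen_smallest; exists q => //; exists C.
have -> : (fun w => W q w - W t w) = (fun w => W q w - W r w) \+ D.
  by apply/funext => w /=; rewrite /D addrA subrK.
by have := measurable_funD mq mDPi measurableT mB; rewrite setTI.
Qed.

Lemma grid_future_indep t s A : 0 <= t -> (forall r, r \in s -> t <= r) -> F t A ->
  indep_of P A (grid_future t s).
Proof.
move=> t0 ts FA E gE.
have ss : sorted <=%R (sort <=%R s) by exact: (sort_sorted (@le_total _ _)).
have ts' r : r \in sort <=%R s -> t <= r by rewrite mem_sort; exact: ts.
apply: (grid_future_indep_sorted t0 ss ts' FA).
by apply: (grid_future_mono _ gE) => r; rewrite mem_sort.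
Qed.

(** A union over finite grids: concatenating lists shows that it is closed under intersection, which
    is what [indep_of_gen] asks for. *)
Definition future t : set (set Omega) :=
  [set E | exists2 s : seq R, (forall r, r \in s -> t <= r) & grid_future t s E].

Lemma future_increment_mfun t r : t <= r ->
  measurable_fun setT ((fun w => W r w - W t w) : g_sigma_algebraType (future t) -> R).
Proof.
move=> tr _ B mB; rewrite setTI; apply: sub_gen_smallest.
exists [:: r]; first by move=> q; rewrite inE => /eqP ->.
by apply: sub_gen_smallest; exists r; [rewrite inE|exists B].
Qed.

Lemma future_meas t : 0 <= t -> future t `<=` measurable.
Proof. by move=> t0 E [s st]; exact: grid_future_meas. Qed.

Lemma future_indep t A : 0 <= t -> F t A -> indep_of P A <<s future t>>.
Proof.
move=> t0 FA; apply: indep_of_gen.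
- exact: F_meas FA.
- exact: future_meas.
- exists [::] => //.
  by rewrite -setC0; apply: sigma_algebraC; exact: sigma_algebra0.
- move=> E E' [s st gE] [s' st' gE']; exists (s ++ s').
    by move=> r; rewrite mem_cat => /orP[]; [exact: st|exact: st'].
  apply: (@measurableI _ (g_sigma_algebraType _)).
    by apply: (grid_future_mono _ gE) => r rs; rewrite mem_cat rs.
  by apply: (grid_future_mono _ gE') => r rs; rewrite mem_cat rs orbT.
- by move=> E [s st]; exact: grid_future_indep.
Qed.

Lemma mE_future_prod lo hi (phi : R -> R) (z : Omega -> R) :
  0 <= lo -> lo <= hi -> continuous phi ->
  measurable_fun setT (z : g_sigma_algebraType (future hi) -> R) ->
  BddF P (fun (_ : unit) w => phi (W hi w - W lo w)) -> BddF P (fun _ : unit => z) ->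
  mE P (fun w => phi (W hi w - W lo w) * z w) =
  mE P (fun w => phi (W hi w - W lo w)) * mE P z.
Proof.
move=> lo0 lohi cphi mz By Bz; have hi0 := le_trans lo0 lohi.
apply: mE_indep.
- exact: (By.1 tt).
- exact: (Bz.1 tt).
- move=> B C mB mC.
  apply: (@future_indep hi ((fun w => W hi w - W lo w) @^-1` (phi @^-1` B)) hi0).
    apply: F_increment => //; rewrite -[X in measurable X]setTI.
    exact: (continuous_measurable_fun cphi).
  by have := mz measurableT C mC; rewrite setTI.
- exact: (BddF_integrable tt By).
- exact: (BddF_integrable tt Bz).
- exact: (BddF_integrable tt (BddF_M By Bz)).
Qed.

End brownian_future.

(** * Moments and measurability of the flow *)

Section ou_moments.
Context {R : realType} {d : measure_display} {Omega : measurableType d}.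
Variables (P : probability Omega R) (F : R -> set (set Omega)) (W : R -> Omega -> R).
Hypotheses (FP : usual_filtration P F) (WP : brownian_motion P F W).

(** Normalized increments are all standard Gaussian, so exponent [1 / 4] and bound 2 serve for every
    pair of times at once, however close. *)
Lemma SubG_increment I (lo hi : I -> R) : (forall i, 0 <= lo i < hi i) ->
  SubG P (fun i w => (Num.sqrt (hi i - lo i))^-1 * (W (hi i) w - W (lo i) w)).
Proof.
move=> lh; split=> [i|].
  have /andP[l0 lhi] := lh i.
  by apply: measurable_funM => //; exact: (mfun_increment FP WP l0 (ltW lhi)).
exists (4^-1); first by rewrite invr_gt0.
exists 2 => i; have /andP[l0 lhi] := lh i.
have s0 : 0 < Num.sqrt (hi i - lo i) by rewrite sqrtr_gt0 subr_gt0.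
have [_ _ _ _ law] := WP.
rewrite [X in eE P X](_ : _ = fun w => expR ((4 * Num.sqrt (hi i - lo i) ^+ 2)^-1 *
    (W (hi i) w - W (lo i) w) ^+ 2)).
  have := gauss_law_exp_moment s0 (mfun_increment FP WP l0 (ltW lhi)) (law _ _ l0 lhi).
  exact: id.
apply/funext => w; congr expR; rewrite exprMn exprVn mulrA.
by rewrite -(invfM 4).
Qed.

Lemma BddF_increment (lo hi : R) : 0 <= lo < hi ->
  BddF P (fun (_ : unit) w => W hi w - W lo w).
Proof.
move=> lh; have /andP[l0 lhi] := lh; apply: SubG_BddF.
have s0 : 0 < Num.sqrt (hi - lo) by rewrite sqrtr_gt0 subr_gt0.
have [_ _ _ _ law] := WP.
exact: (gauss_law_SubG s0 (mfun_increment FP WP l0 (ltW lhi)) (law _ _ l0 lhi)).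
Qed.

Lemma mE_increment (lo hi : R) : 0 <= lo < hi -> mE P (fun w => W hi w - W lo w) = 0.
Proof.
move=> /andP[l0 lhi].
have s0 : 0 < Num.sqrt (hi - lo) by rewrite sqrtr_gt0 subr_gt0.
have [_ _ _ _ law] := WP.
exact: (gauss_law_mean0 s0 (mfun_increment FP WP l0 (ltW lhi)) (law _ _ l0 lhi)).
Qed.

Lemma mE_increment_sq (lo hi : R) : 0 <= lo < hi ->
  mE P (fun w => (W hi w - W lo w) ^+ 2 - (hi - lo)) = 0.
Proof.
move=> /andP[l0 lhi].
have s0 : 0 < Num.sqrt (hi - lo) by rewrite sqrtr_gt0 subr_gt0.
have [_ _ _ _ law] := WP.
have := gauss_law_variance s0 (mfun_increment FP WP l0 (ltW lhi)) (law _ _ l0 lhi).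
by rewrite sqr_sqrtr// subr_ge0 ltW.
Qed.

Variables (a b c T : R) (Y : R -> R -> R -> Omega -> R).
Hypotheses (T0 : 0 < T) (YP : ou_flow W a b c T Y).
Local Notation cl := (clamp T).

Let T0' : 0 <= T. Proof. exact: ltW. Qed.

Lemma brownian_SubG : SubG P (fun s w => W (cl s) w).
Proof.
have [W0 _ _ _ _] := WP.
(* Time 0 would give an empty increment, which cannot be normalized; 1 is a dummy value, used where
   [W] vanishes. *)
pose hi (s : R) := if 0 < cl s then cl s else 1.
have hi0 s : 0 <= (0 : R) < hi s by rewrite lexx/= /hi; case: ifPn.
have mW s : measurable_fun setT (fun w => W (cl s) w).
  have /andP[s0 _] := clamp_itv T0' s.
  have := mfun_increment FP WP (lexx 0) s0; congr measurable_fun.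
  by apply/funext => w; rewrite W0 subr0.
apply: (SubG_le (r := id) (M := Num.sqrt T) mW _ (SubG_increment hi0)) => s w.
rewrite W0 !subr0 /hi; have /andP[s0 sT] := clamp_itv T0' s.
case: ifPn => [sp|]; last first.
  rewrite -leNgt => sn; have -> : cl s = 0 by apply/le_anti; rewrite sn.
  by rewrite W0 normr0 mulr_ge0// sqrtr_ge0.
rewrite normrM normfV mulrA (ger0_norm (sqrtr_ge0 _)) ler_peMl//.
by rewrite ler_pdivlMr ?sqrtr_gt0// mul1r ler_wsqrtr.
Qed.

Local Notation X := (fun w s => Y 0 0 (cl s) w).

Let cW w : {within `[0, T], continuous (fun s => W s w)}.
Proof.
have [_ h _ _ _] := WP; apply: continuous_subspaceW (h w) => s /=.
by rewrite !in_itv/= andbT => /andP[].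
Qed.

Let YPw w t x : 0 <= t <= T ->
  {within `[t, T], continuous (fun s => Y t x s w)} /\
  (forall s : R, t <= s <= T ->
     Y t x s w = x + RI t s (fun r => a + b * Y t x r w) + c * (W s w - W t w)).
Proof. exact: YP. Qed.

Lemma ou_continuous w : continuous (X w).
Proof. exact: (ou_path_continuous T0 (@YPw w)). Qed.

Lemma ou_flowE t x s w : 0 <= t <= T -> t <= s <= T -> Y t x s w = flow b T (X w) t x s.
Proof. exact: (ou_flow_eq T0 (@cW w) (@YPw w)). Qed.

Lemma brownian_noise_continuous w : continuous (fun s => W (cl s) w).
Proof. exact: (clamp_within_continuous T0 (@cW w)). Qed.

(** By the explicit formula from time 0, [X] is built from [W] by bounded factors, sums and an
    average, all of which preserve [SubG] uniformly in time. *)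
Lemma ou_SubG : SubG P (fun s w => X w s).
Proof.
have sW := brownian_SubG.
have sN J (q : J -> R) : (forall j, 0 <= q j <= T) ->
    SubG P (fun j w => 0 + a * (q j - 0) + c * (W (cl (q j)) w - W (cl 0) w)).
  move=> qT; apply: SubG_D.
    apply: (SubG_cst _ (c := fun j => 0 + a * (q j - 0)) (M := `|a| * T)) => j.
    have /andP[q0 qT'] := qT j.
    by rewrite add0r subr0 normrM ler_wpM2l// ger0_norm.
  have s1 : SubG P (fun j w => W (cl (q j)) w + - W (cl 0) w).
    apply: SubG_D; first exact: (SubG_reindex q sW).
    apply: (SubG_le (r := fun=> 0) (M := 1) _ _ sW) => [j|j w].
      by apply: measurable_funN; exact: (sW.1 0).
    by rewrite mul1r normrN.
  apply: (SubG_le (r := id) (M := `|c|) _ _ s1) => [j|j w].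
    by apply: measurable_funM => //; exact: (s1.1 j).
  by rewrite normrM.
have XE s w : X w s = (0 + a * (cl s - 0) + c * (W (cl (cl s)) w - W (cl 0) w)) +
   b * expR (b * cl s) * ((cl s - 0) * avg (fun r => expR (- b * (0 + (cl s - 0) * r)) *
   (0 + a * ((0 + (cl s - 0) * r) - 0) + c * (W (cl (0 + (cl s - 0) * r)) w - W (cl 0) w)))).
  have t00 : 0 <= (0 : R) <= T by rewrite lexx.
  rewrite -(ou_flow_explicit T0 (@cW w) (@YPw w) 0 t00 (clamp_itv T0' s)) -ou_flowE//.
  exact: clamp_itv.
have -> : (fun s w => X w s) = (fun s w => (0 + a * (cl s - 0) + c * (W (cl (cl s)) w - W (cl 0) w)) +
   b * expR (b * cl s) * ((cl s - 0) * avg (fun r => expR (- b * (0 + (cl s - 0) * r)) *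
   (0 + a * ((0 + (cl s - 0) * r) - 0) + c * (W (cl (0 + (cl s - 0) * r)) w - W (cl 0) w))))).
  by apply/funext => s; apply/funext => w; exact: XE.
apply: SubG_D; first by apply: sN => s; exact: clamp_itv.
pose g s (r : R) w := expR (- b * (0 + (cl s - 0) * r)) *
   (0 + a * ((0 + (cl s - 0) * r) - 0) + c * (W (cl (0 + (cl s - 0) * r)) w - W (cl 0) w)).
have qT (p : R * @unit_itv R) : 0 <= 0 + (cl p.1 - 0) * sval p.2 <= T.
  have /andP[r0 r1] := svalP p.2; have /andP[s0 sT] := clamp_itv T0' p.1.
  by rewrite add0r subr0 mulr_ge0//= (le_trans _ sT)// ler_piMr.
have eb (q : R) : 0 <= q <= T -> `|b * q| <= `|b| * T.
  by move=> /andP[q0 qT']; rewrite normrM ler_wpM2l// ger0_norm.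
have sg : SubG P (fun s w => avg (fun r => g s r w)).
  apply: (@SubG_avg _ _ _ _ _ (fun s r w => g s r w)).
    move=> s w; have cq : continuous (fun r : R => 0 + (cl s - 0) * r).
      by apply: contD; [exact: cont_cst|apply: contM; [exact: cont_cst|move=> z; exact: cvg_id]].
    apply: contM; first by apply: (cont_comp (h := fun r => expR (- b * r))) => //; exact: expRl_cont.
    apply: (cont_comp (h := fun q => 0 + a * (q - 0) + c * (W (cl q) w - W (cl 0) w))) => //.
    exact: (ou_noise_continuous T0 (@cW w)).
  apply: (SubG_le (r := id) (M := expR (`|b| * T)) _ _ (sN _ _ qT)) => [p|p w].
    by apply: measurable_funM => //; exact: ((sN _ _ qT).1 p).
  rewrite normrM ler_wpM2r// ger0_norm ?expR_ge0// ler_expR mulNr.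
  by apply: le_trans (ler_norm _) _; rewrite normrN; exact: eb.
apply: (SubG_le (r := id) (M := `|b| * expR (`|b| * T) * T) _ _ sg) => [s|s w].
  by apply: measurable_funM => //; apply: measurable_funM => //; exact: (sg.1 s).
rewrite !normrM mulrA ler_wpM2r//; have sT := clamp_itv T0' s.
rewrite ler_pM ?mulr_ge0//.
  rewrite ler_wpM2l// ger0_norm ?expR_ge0// ler_expR.
  by apply: le_trans (ler_norm _) _; exact: eb.
by have /andP[s0 sT'] := sT; rewrite subr0 ger0_norm.
Qed.

Lemma ou_flow_future t x s : 0 <= t <= T -> t <= s <= T ->
  measurable_fun setT
    ((fun w => flow b T (X w) t x s) : g_sigma_algebraType (future W t) -> R).
Proof.
move=> tT tsT; have /andP[ts sT] := tsT; have /andP[t0 tT'] := tT.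
have mN q : t <= q <= T -> measurable_fun setT
    ((fun w => x + a * (q - t) + c * (W (cl q) w - W (cl t) w)) :
      g_sigma_algebraType (future W t) -> R).
  move=> /andP[tq qT]; apply: measurable_funD => //; apply: measurable_funM => //.
  rewrite (clamp_id tT) (@clamp_id _ T q) ?qT ?(le_trans t0)//.
  exact: future_increment_mfun.
rewrite (_ : (fun w => _) = (fun w => (x + a * (s - t) + c * (W (cl s) w - W (cl t) w)) +
   b * expR (b * s) * ((s - t) * avg (fun r => expR (- b * (t + (s - t) * r)) *
   (x + a * ((t + (s - t) * r) - t) + c * (W (cl (t + (s - t) * r)) w - W (cl t) w)))))).
  apply: measurable_funD; first exact: mN.
  apply: measurable_funM => //; apply: measurable_funM => //.
  apply: (@mfun_avg _ _ (g_sigma_algebraType (future W t)) (fun r w =>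
    expR (- b * (t + (s - t) * r)) *
    (x + a * ((t + (s - t) * r) - t) + c * (W (cl (t + (s - t) * r)) w - W (cl t) w)))).
    move=> w; have cq : continuous (fun r : R => t + (s - t) * r).
      by apply: contD; [exact: cont_cst|apply: contM; [exact: cont_cst|move=> z; exact: cvg_id]].
    apply: contM; first by apply: (cont_comp (h := fun r => expR (- b * r))) => //; exact: expRl_cont.
    apply: (cont_comp (h := fun q => x + a * (q - t) + c * (W (cl q) w - W (cl t) w))) => //.
    exact: (ou_noise_continuous T0 (@cW w)).
  move=> r /andP[r0 r1]; apply: measurable_funM => //; apply: mN.
  rewrite lerDl mulr_ge0 ?subr_ge0//= (le_trans _ sT)// -lerBrDl ler_piMr// subr_ge0//.
by apply/funext => w; exact: (ou_flow_explicit T0 (@cW w) (@YPw w) x tT tsT).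
Qed.

End ou_moments.

(** * Time increments *)

Section time_increment.
Context {R : realType}.
Variables (b T : R).
Hypothesis T0 : 0 <= T.
Local Notation cl := (clamp T).
Implicit Types (lo hi t x y r s : R).
Variable X : R -> R.
Hypothesis cX : continuous X.
Local Notation flowX := (flow b T X).

Lemma flow_flow (t x r s : R) : flowX r (flowX t x (cl r)) s = flowX t x s.
Proof.
have E : ecoef b (cl r) s * ecoef b (cl t) (cl r) = ecoef b (cl t) s.
  by rewrite /ecoef -expRD; congr expR; ring.
by rewrite /flow -E; ring.
Qed.

Lemma flow_diag (t x : R) : 0 <= t <= T -> flowX t x t = x.
Proof. by move=> tT; rewrite /flow (clamp_id tT) /ecoef subrr mulr0 expR0; ring. Qed.

Lemma flow_slice_cont (t x : R) : continuous (flowX t x).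
Proof.
apply: (flow_cont (f := fun=> t) (g := fun=> x)) => //; try exact: cont_cst.
by move=> r; exact: cvg_id.
Qed.

Lemma functional_RI V Q t (xi : R -> R) : jet V -> continuous xi -> 0 <= t <= T ->
  functional b T V Q 0 t xi = RI t T (fun s => V 0 s (xi s)) + Q 0 T (xi T).
Proof.
move=> [cV _ _] cxi /andP[t0 tT].
have cg : continuous (fun s : R => V 0 s (xi s)).
  by apply: (cont_comp2 (h := V 0)) => // s; exact: cvg_id.
have t1 : -1 < t by rewrite (lt_le_trans _ t0)// ltrN10.
rewrite (RI_avg cg t1 tT) /functional clamp_id ?t0// expr0 mul1r; congr (_ * avg _ + _).
by apply/funext => x; rewrite expr0 mul1r /tgrid clamp_id ?t0.
Qed.

Lemma functional_split V Q lo hi (xi : R -> R) : jet V -> continuous xi ->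
  0 <= lo -> lo <= hi -> hi <= T ->
  functional b T V Q 0 lo xi = functional b T V Q 0 hi xi +
    (hi - lo) * avg (fun r => V 0 (lo + (hi - lo) * r) (xi (lo + (hi - lo) * r))).
Proof.
move=> jV cxi lo0 lohi hiT; have [cV _ _] := jV.
have hi0 := le_trans lo0 lohi; have loT := le_trans lohi hiT.
have cg : continuous (fun s : R => V 0 s (xi s)).
  by apply: (cont_comp2 (h := V 0)) => // s; exact: cvg_id.
have lo1 : -1 < lo by rewrite (lt_le_trans _ lo0)// ltrN10.
rewrite -(RI_avg cg lo1 lohi) !functional_RI ?lo0 ?hi0//.
have hi1 : -1 < hi by exact: lt_le_trans lohi.
rewrite !(RI_Ant cg (ltW lo1))// (RI_Ant cg (ltW hi1))//.
set u := Ant _ _; set u1 := Ant _ _; set u2 := Ant _ _; ring.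
Qed.

(* Averaging over the unit interval, rather than over [[lo, hi]], makes this
   jointly continuous in [lo] and [hi], including at [lo = hi]. *)
Definition slope (v : R -> R -> R) (x lo hi : R) : R :=
  avg (fun r : R => v (lo + (hi - lo) * r) (flowX lo x (lo + (hi - lo) * r))).

Lemma slope_continuous v x : continuous (fun p : R * R => v p.1 p.2) ->
  continuous (fun p : R * R => slope v x p.1 p.2).
Proof.
move=> cv; apply: (@avg_continuous R (R * R)%type (fun p r =>
  v (p.1 + (p.2 - p.1) * r) (flowX p.1 x (p.1 + (p.2 - p.1) * r)))).
have c11 : continuous (fun q : R * R * R => q.1.1).
  by move=> q A nA; exact: (@cont_fst _ _ q _ (@cont_fst _ _ q.1 A nA)).
have c12 : continuous (fun q : R * R * R => q.1.2).
  by move=> q A nA; exact: (@cont_fst _ _ q _ (@cont_snd _ _ q.1 A nA)).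
have c2 : continuous (fun q : R * R * R => q.2) by exact: cont_snd.
have cs : continuous (fun q : R * R * R => q.1.1 + (q.1.2 - q.1.1) * q.2).
  by apply: contD => //; apply: contM => //; exact: contB.
apply: (cont_comp2 (h := v)) => //; apply: flow_cont => //; exact: cont_cst.
Qed.

Lemma avg_cst (k : R) : avg (fun=> k) = k.
Proof. by have [c _ ->] := avg_mean (@cont_cst _ _ k). Qed.

Lemma slope_integrand_continuous (v : R -> R -> R) x lo hi : continuous (fun p : R * R => v p.1 p.2) ->
  continuous (fun r : R => v (lo + (hi - lo) * r) (flowX lo x (lo + (hi - lo) * r))).
Proof.
move=> cv; have cs : continuous (fun r : R => lo + (hi - lo) * r).
  by apply: contD; [exact: cont_cst|apply: contM; [exact: cont_cst|move=> r; exact: cvg_id]].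
apply: (cont_comp2 (h := v)) => //.
by apply: (cont_comp (h := flowX lo x)) => //; exact: flow_slice_cont.
Qed.

Lemma slope_diag v x t : 0 <= t <= T -> slope v x t t = v t x.
Proof.
move=> tT; rewrite /slope -[RHS]avg_cst; congr avg; apply/funext => r.
by rewrite subrr mul0r addr0 flow_diag.
Qed.

Variables VA QA VB QB : nat -> R -> R -> R.
Hypotheses (jVA : jet VA) (jQA : jet QA) (jVB : jet VB) (jQB : jet QB).
Hypothesis VA_le0 : forall s y, VA 0 s y <= 0.
Hypothesis QA_le0 : forall s y, QA 0 s y <= 0.
Local Notation evalX := (eval b T VA QA VB QB).
Variable x : R.

Let al lo hi := slope (VA 0) x lo hi.
Let be lo hi := slope (VB 0) x lo hi.
Let fA lo hi := functional b T VA QA 0 hi (flowX hi (flowX lo x (cl hi))).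
Let fB lo hi := functional b T VB QB 0 hi (flowX hi (flowX lo x (cl hi))).

(** Derivative of [e^A cos B] averaged along the segment from the exponent at [hi] to that at [lo].
    Since the exponents differ by [hi - lo] times the slopes, no division by [hi - lo] occurs. *)
Definition exp_slope (lo hi : R) : R :=
  avg (fun r => expR (fA lo hi + al lo hi * ((hi - lo) * r)) *
    (al lo hi * cos (fB lo hi + be lo hi * ((hi - lo) * r)) -
     be lo hi * sin (fB lo hi + be lo hi * ((hi - lo) * r)))).

Let fcont V Q : jet V -> jet Q ->
  continuous (fun p : R * R => functional b T V Q 0 p.2 (flowX p.2 (flowX p.1 x (cl p.2)))).
Proof.
move=> jV jQ.
apply: (cont_comp2 (h := fun t y => functional b T V Q 0 t (flowX t y))).
- exact: functional_cont.
- exact: cont_snd.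
- apply: flow_cont => //; [exact: cont_fst|exact: cont_cst|].
  by apply: clamp_cont; exact: cont_snd.
Qed.

Lemma exp_slope_continuous : continuous (fun p : R * R => exp_slope p.1 p.2).
Proof.
have [cVA _ _] := jVA; have [cVB _ _] := jVB.
have lift1 (g : R * R -> R) : continuous g -> continuous (fun q : R * R * R => g q.1).
  by move=> cg q A nA; exact: (@cont_fst _ _ q _ (cg q.1 A nA)).
have cal := lift1 _ (slope_continuous (x := x) (cVA 0%N)).
have cbe := lift1 _ (slope_continuous (x := x) (cVB 0%N)).
have cfA := lift1 _ (fcont jVA jQA); have cfB := lift1 _ (fcont jVB jQB).
have ch : continuous (fun q : R * R * R => (q.1.2 - q.1.1) * q.2).
  apply: contM; last exact: cont_snd.
  apply: (lift1 (fun p => p.2 - p.1)); apply: contB; [exact: cont_snd|exact: cont_fst].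
apply: (@avg_continuous R (R * R)%type (fun p r =>
  expR (fA p.1 p.2 + al p.1 p.2 * ((p.2 - p.1) * r)) *
    (al p.1 p.2 * cos (fB p.1 p.2 + be p.1 p.2 * ((p.2 - p.1) * r)) -
     be p.1 p.2 * sin (fB p.1 p.2 + be p.1 p.2 * ((p.2 - p.1) * r))))).
apply: contM.
  apply: (cont_comp (h := expR)); first exact: continuous_expR.
  by apply: contD => //; exact: contM.
have cB : continuous (fun q : R * R * R => fB q.1.1 q.1.2 + be q.1.1 q.1.2 * ((q.1.2 - q.1.1) * q.2)).
  by apply: contD => //; exact: contM.
apply: contB; apply: contM => //.
  by apply: (cont_comp (h := cos)) => //; exact: continuous_cos.
by apply: (cont_comp (h := sin)) => //; exact: continuous_sin.
Qed.

Lemma exp_slope_diag t : 0 <= t <= T ->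
  exp_slope t t = VA 0 t x * evalX XC t (flowX t x) - VB 0 t x * evalX XS t (flowX t x).
Proof.
move=> tT; rewrite -[RHS]avg_cst; congr avg; apply/funext => r.
rewrite /al /be /fA /fB !slope_diag// clamp_id// flow_diag// subrr mul0r !mulr0 !addr0 /=.
by ring.
Qed.

Lemma eval_XC_split lo hi : 0 <= lo -> lo < hi -> hi <= T ->
  evalX XC lo (flowX lo x) =
  evalX XC hi (flowX hi (flowX lo x (cl hi))) + (hi - lo) * exp_slope lo hi.
Proof.
move=> lo0 lohi hiT; have cxi := @flow_slice_cont lo x.
have EA : functional b T VA QA 0 lo (flowX lo x) = fA lo hi + al lo hi * (hi - lo).
  rewrite (functional_split QA jVA cxi lo0 (ltW lohi) hiT) mulrC /fA.
  by rewrite (funext (flow_flow lo x hi)).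
have EB : functional b T VB QB 0 lo (flowX lo x) = fB lo hi + be lo hi * (hi - lo).
  rewrite (functional_split QB jVB cxi lo0 (ltW lohi) hiT) mulrC /fB.
  by rewrite (funext (flow_flow lo x hi)).
pose phi r := expR (fA lo hi + al lo hi * r) * cos (fB lo hi + be lo hi * r).
pose dphi r := expR (fA lo hi + al lo hi * r) *
    (al lo hi * cos (fB lo hi + be lo hi * r) - be lo hi * sin (fB lo hi + be lo hi * r)).
have ca (m k : R) : continuous (fun r : R => m + k * r).
  by apply: contD; [exact: cont_cst|apply: contM; [exact: cont_cst|move=> r; exact: cvg_id]].
have cdphi : continuous dphi.
  apply: contM; first by apply: (cont_comp (h := expR)) => //; exact: continuous_expR.
  by apply: contB; apply: contM; try exact: cont_cst;
    [apply: (cont_comp (h := cos)) => //; exact: continuous_cos|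
     apply: (cont_comp (h := sin)) => //; exact: continuous_sin].
have dd (r : R) : is_derive r 1 phi (dphi r).
  apply: is_derive_eq (is_deriveMr (is_derive_comp_aff (is_derive_expR _))
    (is_derive_comp_aff (is_derive_cos _))) _.
  by rewrite /dphi; ring.
have := increment_avg 0 (hi - lo) cdphi dd.
rewrite add0r {1 2}/phi mulr0 !addr0 mulr0 addr0 => E.
rewrite /= EA EB -/(fA lo hi) -/(fB lo hi) -[LHS](subrK (expR (fA lo hi) * cos (fB lo hi))) E addrC.
congr (_ + _ * _); congr avg; apply/funext => r; by rewrite add0r.
Qed.

(** Both [fA] and [al] are nonpositive, so the exponential stays below 1 along the whole segment. *)
Lemma exp_slope_le lo hi : lo <= hi -> 
  `|exp_slope lo hi| <= `|slope (VA 0) x lo hi| + `|slope (VB 0) x lo hi|.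
Proof.
move=> lohi; have [cVA _ _] := jVA.
have al0 : al lo hi <= 0.
  by have [r _] := avg_mean (@slope_integrand_continuous (VA 0%N) x lo hi (cVA 0%N)); rewrite /al /slope => ->.
have fA0 : fA lo hi <= 0.
  by apply: functional_le0 => //; exact: flow_slice_cont.
have ca (m k : R) : continuous (fun r : R => m + k * ((hi - lo) * r)).
  apply: contD; first exact: cont_cst; apply: contM; first exact: cont_cst.
  by apply: contM; [exact: cont_cst|move=> r; exact: cvg_id].
have cphi : continuous (fun r => expR (fA lo hi + al lo hi * ((hi - lo) * r)) *
    (al lo hi * cos (fB lo hi + be lo hi * ((hi - lo) * r)) -
     be lo hi * sin (fB lo hi + be lo hi * ((hi - lo) * r)))).
  apply: contM; first by apply: (cont_comp (h := expR)) => //; exact: continuous_expR.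
  by apply: contB; apply: contM; try exact: cont_cst;
    [apply: (cont_comp (h := cos)) => //; exact: continuous_cos|
     apply: (cont_comp (h := sin)) => //; exact: continuous_sin].
rewrite -/(al lo hi) -/(be lo hi).
have [r /andP[r0 _]] := avg_mean cphi; rewrite /exp_slope => ->.
have h0 : 0 <= (hi - lo) * r by rewrite mulr_ge0// subr_ge0.
rewrite normrM -[leRHS]mul1r ler_pM//.
  rewrite ger0_norm ?expR_ge0// -expR0 ler_expR -[leRHS]addr0 lerD//.
  by rewrite mulr_le0_ge0.
apply: le_trans (ler_normB _ _) _; rewrite !normrM lerD// ler_piMr//.
  by rewrite ler_norml cos_geN1 cos_le1.
by rewrite ler_norml sin_geN1 sin_le1.
Qed.

End time_increment.

(** * Second-order Taylor expansion with averaged remainder *)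

Section taylor.
Context {R : realType}.
Implicit Types (x k r q : R).

Lemma avg_linear k : avg (fun r => r * k) = 2^-1 * k.
Proof.
have cl : continuous (fun r : R => r * k).
  by apply: contM; [move=> r; exact: cvg_id|exact: cont_cst].
have dl r : is_derive r 1 (fun r : R => 2^-1 * k * (r * r)) (r * k).
  apply: is_derive_eq (is_deriveZl _ (is_deriveMr (is_derive_id r 1) (is_derive_id r 1))) _.
  by field.
by rewrite (avgE cl dl) !mulr1 !mulr0 subr0.
Qed.

(** Integral remainder with [dx ^+ 2] already divided out, so that it is defined and continuous at
    [dx = 0]. *)
Definition taylor_rem (g2 : R -> R) x (dx : R) : R :=
  avg (fun r => r * avg (fun q => g2 (x + dx * r * q))).

Lemma taylor_rem0 g2 x : taylor_rem g2 x 0 = 2^-1 * g2 x.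
Proof.
rewrite -avg_linear; congr avg; apply/funext => r; congr (_ * _).
by rewrite -[RHS]avg_cst; congr avg; apply/funext => q; rewrite !mul0r addr0.
Qed.

Lemma taylor_integrand_continuous (Z : topologicalType) (g2 : Z -> R -> R) x (dx : Z -> R) :
  continuous (fun p : Z * R => g2 p.1 p.2) -> continuous dx ->
  continuous (fun p : Z * R => p.2 * avg (fun q => g2 p.1 (x + dx p.1 * p.2 * q))).
Proof.
move=> cg2 cdx; apply: contM; first exact: cont_snd.
apply: (@avg_continuous R (Z * R)%type (fun p q => g2 p.1 (x + dx p.1 * p.2 * q))).
have c11 : continuous (fun q : Z * R * R => q.1.1).
  by move=> q A nA; exact: (@cont_fst _ _ q _ (@cont_fst _ _ q.1 A nA)).
have c12 : continuous (fun q : Z * R * R => q.1.2).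
  by move=> q A nA; exact: (@cont_fst _ _ q _ (@cont_snd _ _ q.1 A nA)).
have cy : continuous (fun q : Z * R * R => x + dx q.1.1 * q.1.2 * q.2).
  apply: contD; first exact: cont_cst.
  apply: contM; last exact: cont_snd.
  apply: contM => // q A nA; exact: (c11 q _ (cdx q.1.1 A nA)).
move=> q A nA; exact: (cont_pair c11 cy (cg2 (q.1.1, _) A nA)).
Qed.

Lemma taylor_rem_continuous (Z : topologicalType) (g2 : Z -> R -> R) x (dx : Z -> R) :
  continuous (fun p : Z * R => g2 p.1 p.2) -> continuous dx ->
  continuous (fun z => taylor_rem (g2 z) x (dx z)).
Proof.
move=> cg2 cdx; apply: (@avg_continuous R Z (fun z r => r * avg (fun q => g2 z (x + dx z * r * q)))).
exact: (@taylor_integrand_continuous Z g2 x dx cg2 cdx).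
Qed.

Lemma taylor_slice_continuous (g2 : R -> R) x (dx : R) : continuous g2 ->
  continuous (fun r : R => r * avg (fun q => g2 (x + dx * r * q))).
Proof.
move=> cg2; apply: (cont_comp2 (f := fun=> 0)
  (h := fun (z r : R) => r * avg (fun q => g2 (x + dx * r * q)))).
- apply: (@taylor_integrand_continuous R (fun=> g2) x (fun=> dx)).
    by apply: (cont_comp (h := g2)) => //; exact: cont_snd.
  exact: cont_cst.
- exact: cont_cst.
- by move=> r; exact: cvg_id.
Qed.

Lemma taylor2 (g g1 g2 : R -> R) x (dx : R) : continuous g2 ->
  (forall y : R, is_derive y 1 g (g1 y)) -> (forall y : R, is_derive y 1 g1 (g2 y)) ->
  g (x + dx) - g x = dx * g1 x + dx ^+ 2 * taylor_rem g2 x dx.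
Proof.
move=> cg2 dg dg1.
have cg1 : continuous g1 by move=> y; exact: is_derive_continuous (dg1 y).
rewrite (increment_avg x dx cg1 dg) expr2 -mulrA -mulrDr; congr (_ * _).
have E r : g1 (x + dx * r) = g1 x + dx * (r * avg (fun q => g2 (x + dx * r * q))).
  by rewrite mulrA -(increment_avg x (dx * r) cg2 dg1); ring.
have ct := @taylor_slice_continuous g2 x dx cg2.
rewrite (funext E) avgD; [|exact: cont_cst|by apply: contM => //; exact: cont_cst].
by rewrite avg_cst avgZ.
Qed.

End taylor.

Section mean_linearity.
Context {R : realType} {d : measure_display} {Omega : measurableType d}.
Variable P : probability Omega R.

Lemma mE_D (f g : Omega -> R) : BddF P (fun _ : unit => f) -> BddF P (fun _ : unit => g) ->
  mE P (fun w => f w + g w) = mE P f + mE P g.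
Proof. by move=> Bf Bg; apply: RintegralD => //; exact: (BddF_integrable tt). Qed.

Lemma mE_Z (k : R) (f : Omega -> R) : BddF P (fun _ : unit => f) ->
  mE P (fun w => k * f w) = k * mE P f.
Proof. by move=> Bf; apply: RintegralZl => //; exact: (BddF_integrable tt). Qed.

End mean_linearity.

Lemma cvg_continuous2 {R : realType} (f : R -> R -> R) (u v : nat -> R) (l m : R) :
  continuous (fun p : R * R => f p.1 p.2) -> u n @[n --> \oo] --> l ->
  v n @[n --> \oo] --> m -> f (u n) (v n) @[n --> \oo] --> f l m.
Proof.
move=> cf cu cv.
exact: (cvg_comp (fun n => (u n, v n)) _ (cvg_pair cu cv) (cf (l, m))).
Qed.

Section sequence_limits.
Context {R : realType}.
Implicit Types (u v : nat -> R) (k l m : R).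

Lemma seq_cvgD u v l m : u n @[n --> \oo] --> l -> v n @[n --> \oo] --> m ->
  u n + v n @[n --> \oo] --> l + m.
Proof. by move=> cu cv; apply: cvgD. Qed.

Lemma seq_cvgM u v l m : u n @[n --> \oo] --> l -> v n @[n --> \oo] --> m ->
  u n * v n @[n --> \oo] --> l * m.
Proof. by move=> cu cv; apply: cvgM. Qed.

Lemma seq_cvgZ k u l : u n @[n --> \oo] --> l -> k * u n @[n --> \oo] --> k * l.
Proof. by move=> cu; apply: seq_cvgM => //; exact: cvg_cst. Qed.

End sequence_limits.

(** * Limit of the time difference quotients *)

Section time_derivative.
Context {R : realType} {d : measure_display} {Omega : measurableType d}.
Variables (P : probability Omega R) (F : R -> set (set Omega)) (W : R -> Omega -> R).
Hypotheses (FP : usual_filtration P F) (WP : brownian_motion P F W).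
Variables (a b c T : R) (Y : R -> R -> R -> Omega -> R).
Hypotheses (T0 : 0 < T) (YP : ou_flow W a b c T Y).
Local Notation cl := (clamp T).
Local Notation X := (fun w s => Y 0 0 (cl s) w).
Variables VA QA VB QB : nat -> R -> R -> R.
Hypotheses (jVA : jet VA) (jQA : jet QA) (jVB : jet VB) (jQB : jet QB).
Hypothesis VA_le0 : forall s y, VA 0 s y <= 0.
Hypothesis QA_le0 : forall s y, QA 0 s y <= 0.
Local Notation evalX := (eval b T VA QA VB QB).
Local Notation meanX := (mean_eval b T P X VA QA VB QB).

Variable x : R.
Variables (lo hi : nat -> R) (t0 : R).
Hypotheses (lo0 : forall n, 0 <= lo n) (lohi : forall n, lo n < hi n)
  (hiT : forall n, hi n <= T).
Hypotheses (t0T : 0 <= t0 <= T) (lo_cvg : lo n @[n --> \oo] --> t0) (hi_cvg : hi n @[n --> \oo] --> t0).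

Let T0' : 0 <= T. Proof. exact: ltW. Qed.
Let cX w : continuous (X w). Proof. exact: (ou_continuous T0 YP). Qed.
Let sX : SubG P (fun s w => X w s). Proof. exact: (ou_SubG FP WP T0 YP). Qed.

Let hi0 n : 0 <= hi n. Proof. exact: le_trans (lo0 n) (ltW (lohi n)). Qed.
Let loT n : lo n <= T. Proof. exact: le_trans (ltW (lohi n)) (hiT n). Qed.

Let h n : R := hi n - lo n.
Let sh n : R := Num.sqrt (h n).
Let D1 := deriv_expr XC.
Let D2 := deriv_expr D1.
Let G1 n w : R := evalX D1 (hi n) (flow b T (X w) (hi n) x).
Let G2 n w : R := evalX D2 (hi n) (flow b T (X w) (hi n) x).
Let dW n w : R := W (hi n) w - W (lo n) w.
Let N n w : R := (sh n)^-1 * dW n w.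
Let y n w : R := flow b T (X w) (lo n) x (cl (hi n)).
Let dx n w : R := y n w - x.
Let rho n w : R := slope b T (X w) (fun _ z => a + b * z) x (lo n) (hi n).
Let K n w : R := taylor_rem (fun z => evalX D2 (hi n) (flow b T (X w) (hi n) z)) x (dx n w).
Let Phi n w : R := exp_slope b T (X w) VA QA VB QB x (lo n) (hi n).
(** The terms of the difference quotient that converge on every path; the last two vanish in the
    limit. *)
Let Z n w : R := Phi n w + rho n w * G1 n w + (c ^+ 2 / 2) * G2 n w
  + c * (sh n * N n w) * rho n w * G2 n w + 2^-1 * h n * rho n w ^+ 2 * G2 n w.
(** This is [dx ^+ 2 / h]; through the normalized increment [N] its moments are visibly bounded
    uniformly in [n]. *)
Let Psi n w : R := (c * N n w + sh n * rho n w) ^+ 2.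

Let h_gt0 n : 0 < h n. Proof. by rewrite subr_gt0. Qed.
Let sh_gt0 n : 0 < sh n. Proof. by rewrite sqrtr_gt0. Qed.
Let shE n : sh n ^+ 2 = h n. Proof. by rewrite sqr_sqrtr// ltW. Qed.
Let dWE n w : dW n w = sh n * N n w. Proof. by rewrite /N mulVKf// gt_eqF. Qed.

Let dxE n w : dx n w = c * dW n w + h n * rho n w.
Proof.
have loTn : 0 <= lo n <= T by rewrite lo0 loT.
have hiTn : lo n <= hi n <= T by rewrite ltW// hiT.
have [_ YE] := YP x w loTn.
have cg : continuous (fun r => a + b * flow b T (X w) (lo n) x r).
  apply: contD; first exact: cont_cst; apply: contM; first exact: cont_cst.
  exact: flow_slice_cont.
have n1 : -1 < lo n by rewrite (lt_le_trans _ (lo0 n))// ltrN10.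
rewrite /dx /y clamp_id ?hi0 ?hiT// -(ou_flowE WP T0 YP)// YE//.
rewrite -/(RI (lo n) (hi n) _) (@eq_RI _ _ (fun r => a + b * flow b T (X w) (lo n) x r)).
  by rewrite (RI_avg cg n1 (ltW (lohi n))) -/(dW n w) /rho /slope -/(h n); ring.
move=> r /andP[lr rh]; rewrite (ou_flowE WP T0 YP)//.
by rewrite lr (le_trans rh).
Qed.

(** Taylor's formula with [dx = c dW + h rho]. The square [dW ^+ 2] is centred by [h], which moves
    [c^2 / 2 * G2] into [Z], and [K] is replaced by its limit [G2 / 2] plus an error. The two middle
    terms will have mean zero. *)
Let increment_split n w :
  (h n)^-1 * (evalX XC (lo n) (flow b T (X w) (lo n) x) -
              evalX XC (hi n) (flow b T (X w) (hi n) x)) =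
  Z n w + (c / h n) * (dW n w * G1 n w)
  + (c ^+ 2 / (2 * h n)) * ((dW n w ^+ 2 - h n) * G2 n w)
  + Psi n w * (K n w - 2^-1 * G2 n w).
Proof.
rewrite (eval_XC_split b (@cX w) QA QB jVA jVB x (lo0 n) (lohi n) (hiT n)).
rewrite -/(Phi n w) -/(y n w) -/(h n).
have E := taylor2 (g := fun z => evalX XC (hi n) (flow b T (X w) (hi n) z)) x (dx n w)
   (@eval_slice_cont _ b T _ _ _ cX _ _ _ _ jVA jQA jVB jQB D2 (hi n) w)
   (fun z => eval_derive b T jVA jQA jVB jQB XC (hi n) z (@cX w))
   (fun z => eval_derive b T jVA jQA jVB jQB D1 (hi n) z (@cX w)).
rewrite -/(K n w) {1}/dx [x + _]addrC subrK -/D1 -/(G1 n w) in E.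
rewrite addrAC E dxE /Z /Psi dWE -shE.
by field; rewrite gt_eqF.
Qed.


Let B1 : BddF P (fun (_ : nat) (_ : Omega) => (1 : R)).
Proof. by apply: (BddF_cst P (M := 1)) => i; rewrite normr1. Qed.

Let sx : SubG P (fun (_ : nat) (_ : Omega) => x).
Proof. by apply: (SubG_cst _ (c := fun=> x) (M := `|x|)). Qed.

Let BE e : BddF P (fun n w => evalX e (hi n) (flow b T (X w) (hi n) x)).
Proof. exact: (eval_BddF b T0' cX sX jVA jQA jVB jQB VA_le0 QA_le0 e hi sx). Qed.

Let sN : SubG P N.
Proof.
by apply: (SubG_increment FP WP (lo := lo) (hi := hi)) => n; rewrite lo0 lohi.
Qed.

Let h_le n : `|h n| <= T.
Proof. by rewrite (ger0_norm (ltW (h_gt0 n))) /h lerBlDr (le_trans (hiT n))// lerDl. Qed.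

Let sh_le n : `|sh n| <= Num.sqrt T.
Proof.
rewrite ger0_norm ?sqrtr_ge0// ler_wsqrtr//.
by apply: le_trans (h_le n); exact: ler_norm.
Qed.

Let grid_itv (p : nat * @unit_itv R) :
  0 <= lo p.1 + (hi p.1 - lo p.1) * sval p.2 <= T.
Proof.
have /andP[r0 r1] := svalP p.2; have := lo0 p.1; have := hiT p.1; have := h_gt0 p.1.
rewrite -/(h p.1) => h0 hT l0; rewrite addr_ge0 ?mulr_ge0 ?(ltW h0)//=.
apply: le_trans hT; rewrite -[leRHS](subrKC (lo p.1)) lerD2l -/(h p.1).
by rewrite ler_piMr// ltW.
Qed.

Let slope_BddF (v : R -> R -> R) : continuous (fun p : R * R => v p.1 p.2) ->
  (forall e : R, 0 < e -> exists M : R, forall s z, `|v s z| <= M * expR (e * z ^+ 2)) ->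
  BddF P (fun n w => slope b T (X w) v x (lo n) (hi n)).
Proof.
move=> cv gv.
apply: (@BddF_avg _ _ _ _ _ (fun n r w => v (lo n + (hi n - lo n) * r)
  (flow b T (X w) (lo n) x (lo n + (hi n - lo n) * r)))).
  by move=> n w; exact: (@slope_integrand_continuous R b T (X w) (@cX w) v x (lo n) (hi n) cv).
apply: (BddF_growth (f := fun p : nat * unit_itv => v (lo p.1 + (hi p.1 - lo p.1) * sval p.2))).
- by move=> e e0; have [M MP] := gv e e0; exists M => p z; exact: MP.
- move=> p; apply: (cont_comp2 (h := v)) => //; first exact: cont_cst.
  by move=> z; exact: cvg_id.
- exact: (SubG_flow b T0' sX (fun p => lo p.1) grid_itv (SubG_reindex fst sx)).
Qed.

Let drift_cont : continuous (fun p : R * R => a + b * p.2).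
Proof.
apply: contD; first exact: cont_cst; apply: contM; first exact: cont_cst.
exact: cont_snd.
Qed.

Let Brho : BddF P rho.
Proof.
apply: (@slope_BddF (fun _ z => a + b * z)); first exact: drift_cont.
move=> e e0; have [M MP] := growth_id e0.
exists (`|a| + `|b| * M) => _ z; apply: le_trans (ler_normD _ _) _.
rewrite mulrDl lerD//.
  by rewrite ler_peMr// -expR0 ler_expR mulr_ge0 ?sqr_ge0// ltW.
by rewrite normrM -mulrA ler_wpM2l.
Qed.

Let sy : SubG P y.
Proof.
apply: (SubG_flow b T0' sX lo (s := fun n => cl (hi n)) _ sx) => n.
exact: clamp_itv.
Qed.

Let sdx : SubG P dx.
Proof.
apply: SubG_D sy _.
by apply: (SubG_cst _ (c := fun=> - x) (M := `|x|)) => n; rewrite normrN.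
Qed.

(** Measurability is read off [eval_XC_split] solved for [Phi]; the moments follow from
    [exp_slope_le]. *)
Let BPhi : BddF P Phi.
Proof.
have [cVA _ gVA] := jVA; have [cVB _ gVB] := jVB.
have Bal := slope_BddF (cVA 0%N) (gVA 0%N).
have Bbe := slope_BddF (cVB 0%N) (gVB 0%N).
have Bab (z : nat -> Omega -> R) : BddF P z -> BddF P (fun n w => `|z n w|).
  move=> Bz; apply: (BddF_le (r := id) _ _ Bz) => [n|n w]; last by rewrite normr_id.
  by apply: (mfun_comp (phi := fun u : R => `|u|)); [exact: norm_continuous|exact: (Bz.1 n)].
apply: (BddF_le (r := id) _ _ (BddF_D (Bab _ Bal) (Bab _ Bbe))) => [n|n w].
  have -> : Phi n = fun w => (h n)^-1 * (evalX XC (lo n) (flow b T (X w) (lo n) x) -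
     evalX XC (hi n) (flow b T (X w) (hi n) (y n w))).
    apply/funext => w.
    rewrite (eval_XC_split b (@cX w) QA QB jVA jVB x (lo0 n) (lohi n) (hiT n)).
    rewrite -/(Phi n w) -/(y n w) -/(h n) [X in X - _]addrC addrK mulKf//.
    by rewrite gt_eqF.
  apply: measurable_funM => //; apply: measurable_funB.
    exact: ((eval_BddF b T0' cX sX jVA jQA jVB jQB VA_le0 QA_le0 XC lo sx).1 n).
  exact: ((eval_BddF b T0' cX sX jVA jQA jVB jQB VA_le0 QA_le0 XC hi sy).1 n).
rewrite [leRHS]ger0_norm ?addr_ge0//.
exact: (exp_slope_le b T0' (@cX w) VB QB jVA VA_le0 QA_le0 x (ltW (lohi n))).
Qed.

Let BN : BddF P N := SubG_BddF sN.

Let BZ : BddF P Z.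
Proof.
apply: BddF_D; first apply: BddF_D; first apply: BddF_D; first apply: BddF_D.
- exact: BPhi.
- exact: (BddF_M Brho (BE D1)).
- by apply: (BddF_Z (c := fun=> c ^+ 2 / 2) (M := `|c ^+ 2 / 2|)) => //; exact: BE.
- apply: BddF_M (BE D2); apply: BddF_M Brho.
  apply: (BddF_Z (c := fun=> c) (M := `|c|)) => //.
  exact: (BddF_Z sh_le BN).
- apply: BddF_M (BE D2); apply: BddF_M; last exact: (BddF_M Brho Brho).
  apply: (BddF_cst _ (c := fun n => 2^-1 * h n) (M := 2^-1 * T)) => n.
  by rewrite normrM ger0_norm// ler_wpM2l.
Qed.

Let BPsi : BddF P Psi.
Proof.
have Bb : BddF P (fun n w => c * N n w + sh n * rho n w).
  apply: BddF_D; first by apply: (BddF_Z (c := fun=> c) (M := `|c|)).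
  exact: (BddF_Z sh_le Brho).
exact: (BddF_M Bb Bb).
Qed.

Let unit_norm (r : @unit_itv R) : `|sval r| <= 1.
Proof. by have /andP[r0 r1] := svalP r; rewrite ger0_norm. Qed.

Let BK : BddF P K.
Proof.
have cs n w : continuous (fun z => evalX D2 (hi n) (flow b T (X w) (hi n) z)).
  exact: (@eval_slice_cont _ b T _ _ _ cX _ _ _ _ jVA jQA jVB jQB D2 (hi n) w).
apply: (@BddF_avg _ _ _ _ _ (fun n r w => r * avg (fun q =>
   evalX D2 (hi n) (flow b T (X w) (hi n) (x + dx n w * r * q))))).
  by move=> n w; exact: (@taylor_slice_continuous _ _ x (dx n w) (cs n w)).
apply: (BddF_Z (c := fun p : nat * unit_itv => sval p.2) (M := 1)) => [p|].
  exact: unit_norm.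
apply: (@BddF_avg _ _ _ _ _ (fun (p : nat * unit_itv) q w =>
   evalX D2 (hi p.1) (flow b T (X w) (hi p.1) (x + dx p.1 w * sval p.2 * q)))).
  move=> p w; apply: (cont_comp (cs p.1 w)).
  apply: contD; first exact: cont_cst; apply: contM; first exact: cont_cst.
  by move=> q; exact: cvg_id.
apply: (eval_BddF b T0' cX sX jVA jQA jVB jQB VA_le0 QA_le0 D2
  (fun p : nat * unit_itv * unit_itv => hi p.1.1)
  (chi := fun p w => x + dx p.1.1 w * sval p.1.2 * sval p.2)).
apply: SubG_D; first exact: (SubG_reindex (fun=> 0%N) sx).
apply: (SubG_le (r := fun p : nat * unit_itv * unit_itv => p.1.1) (M := 1) _ _ sdx) => [p|p w].
  by apply: measurable_funM => //; apply: measurable_funM => //; exact: (sdx.1 p.1.1).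
rewrite mul1r 2!normrM -mulrA ler_piMr// mulr_ile1//; exact: unit_norm.
Qed.


Let cdx w : dx n w @[n --> \oo] --> (0 : R).
Proof.
have cf : continuous (fun p : R * R => flow b T (X w) p.1 x (cl p.2)).
  apply: flow_cont; [exact: cX|exact: cont_fst|exact: cont_cst|].
  by apply: clamp_cont; exact: cont_snd.
have := cvg_continuous2 (f := fun l u => flow b T (X w) l x (cl u)) cf lo_cvg hi_cvg.
rewrite /= clamp_id// flow_diag// => yx.
by rewrite -(subrr x); apply: cvgB; [exact: yx|exact: cvg_cst].
Qed.

Let cdW w : dW n w @[n --> \oo] --> (0 : R).
Proof.
have cf : continuous (fun p : R * R => W (cl p.2) w - W (cl p.1) w).
  apply: contB; apply: (cont_comp (h := fun s => W (cl s) w)).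
  - exact: (brownian_noise_continuous WP T0).
  - exact: cont_snd.
  - exact: (brownian_noise_continuous WP T0).
  - exact: cont_fst.
have := cvg_continuous2 (f := fun l u => W (cl u) w - W (cl l) w) cf lo_cvg hi_cvg.
rewrite /= subrr; apply: cvg_trans.
apply: near_eq_cvg; near=> n.
by rewrite /dW !clamp_id ?lo0 ?loT ?hi0 ?hiT.
Unshelve. all: by end_near. Qed.

Let ch : h n @[n --> \oo] --> (0 : R).
Proof. by rewrite -(subrr t0); apply: cvgB. Qed.

Let cE e w : evalX e (hi n) (flow b T (X w) (hi n) x) @[n --> \oo] -->
  evalX e t0 (flow b T (X w) t0 x).
Proof.
apply: (cvg_continuous2 (f := fun t z => evalX e t (flow b T (X w) t z))
  _ hi_cvg (cvg_cst (x : R))).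
exact: (@eval_cont R b T VA QA VB QB jVA jQA jVB jQB e (X w) (@cX w)).
Qed.

Let crho w : rho n w @[n --> \oo] --> a + b * x.
Proof.
have := cvg_continuous2 (f := slope b T (X w) (fun _ z => a + b * z) x)
  (@slope_continuous R b T (X w) (@cX w) (fun _ z => a + b * z) x
  drift_cont) lo_cvg hi_cvg.
by rewrite slope_diag.
Qed.

Let cPhi w : Phi n w @[n --> \oo] -->
  VA 0 t0 x * evalX XC t0 (flow b T (X w) t0 x) - VB 0 t0 x * evalX XS t0 (flow b T (X w) t0 x).
Proof.
have := cvg_continuous2 (f := exp_slope b T (X w) VA QA VB QB x)
  (@exp_slope_continuous R b T (X w) (@cX w) _ _ _ _
  jVA jQA jVB jQB x) lo_cvg hi_cvg.
by rewrite exp_slope_diag.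
Qed.

Let cK w : K n w - 2^-1 * G2 n w @[n --> \oo] --> (0 : R).
Proof.
have cf : continuous (fun p : R * R =>
    taylor_rem (fun z => evalX D2 p.1 (flow b T (X w) p.1 z)) x p.2).
  apply: (@taylor_rem_continuous R (R * R)%type
    (fun p z => evalX D2 p.1 (flow b T (X w) p.1 z)) x snd); last exact: cont_snd.
  apply: (cont_comp2 (h := fun t z => evalX D2 t (flow b T (X w) t z))).
  - exact: (@eval_cont R b T VA QA VB QB jVA jQA jVB jQB D2 (X w) (@cX w)).
  - by move=> q A nA; exact: (@cont_fst _ _ q _ (@cont_fst _ _ q.1 A nA)).
  - exact: cont_snd.
have := cvg_continuous2 (f := fun t z =>
  taylor_rem (fun z' => evalX D2 t (flow b T (X w) t z')) x z) cf hi_cvg (cdx w).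
rewrite taylor_rem0 => cKw.
rewrite -(subrr (2^-1 * evalX D2 t0 (flow b T (X w) t0 x))).
by apply: cvgB; [exact: cKw|apply: seq_cvgZ; exact: (@cE D2 w)].
Qed.

Let Zlim w : R :=
  VA 0 t0 x * evalX XC t0 (flow b T (X w) t0 x) - VB 0 t0 x * evalX XS t0 (flow b T (X w) t0 x)
  + (a + b * x) * evalX D1 t0 (flow b T (X w) t0 x)
  + c ^+ 2 / 2 * evalX D2 t0 (flow b T (X w) t0 x).

Let cZ w : Z n w @[n --> \oo] --> Zlim w.
Proof.
have c4 : c * (sh n * N n w) * rho n w * G2 n w @[n --> \oo] --> (0 : R).
  under eq_fun do rewrite -dWE.
  have := seq_cvgM (seq_cvgM (seq_cvgZ (k := c) (cdW w)) (crho w)) (@cE D2 w).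
  by rewrite mulr0 !mul0r.
have c5 : 2^-1 * h n * rho n w ^+ 2 * G2 n w @[n --> \oo] --> (0 : R).
  have := seq_cvgM (seq_cvgM (seq_cvgZ (k := 2^-1) ch) (seq_cvgM (crho w) (crho w))) (@cE D2 w).
  by rewrite mulr0 !mul0r.
have := seq_cvgD (seq_cvgD (seq_cvgD (seq_cvgD (@cPhi w) (seq_cvgM (crho w) (@cE D1 w)))
  (seq_cvgZ (k := c ^+ 2 / 2) (@cE D2 w))) c4) c5.
by rewrite !addr0.
Qed.

Let single (z : nat -> Omega -> R) n : BddF P z -> BddF P (fun _ : unit => z n).
Proof. exact: (BddF_reindex (fun=> n)). Qed.

Let BdW n : BddF P (fun _ : unit => dW n).
Proof. by apply: (BddF_increment FP WP); rewrite lo0 lohi. Qed.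

Let BdW2 n : BddF P (fun (_ : unit) w => dW n w ^+ 2 - h n).
Proof.
apply: BddF_D; first exact: (BddF_M (BdW n) (BdW n)).
by apply: (BddF_cst _ (c := fun=> - h n) (M := `|h n|)) => _; rewrite normrN.
Qed.

(** Expanding at the deterministic point [x], rather than at the random position reached at [hi], is
    what makes these coefficients depend on the future only. *)
Let eval_future n e : measurable_fun setT
  ((fun w => evalX e (hi n) (flow b T (X w) (hi n) x)) : g_sigma_algebraType (future W (hi n)) -> R).
Proof.
apply: (@eval_mfun R b T T0' _ (g_sigma_algebraType (future W (hi n)))
  (fun w => flow b T (X w) (hi n) x) _ VA QA VB QB e (hi n) jVA jQA jVB jQB).
  by move=> w; exact: flow_slice_cont.
rewrite clamp_id ?hi0 ?hiT// => s sT.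
by apply: (ou_flow_future WP T0 YP x) => //; rewrite hi0 hiT.
Qed.

Let mE_dW n : mE P (fun w => dW n w * G1 n w) = 0.
Proof.
rewrite (@mE_future_prod _ _ _ P F W FP WP (lo n) (hi n) (fun u => u) (G1 n) (lo0 n) (ltW (lohi n))).
- by rewrite (mE_increment FP WP) ?mul0r// lo0 lohi.
- by move=> u; exact: cvg_id.
- exact: eval_future.
- exact: BdW.
- exact: (single n (BE D1)).
Qed.

Let mE_dW2 n : mE P (fun w => (dW n w ^+ 2 - h n) * G2 n w) = 0.
Proof.
rewrite (@mE_future_prod _ _ _ P F W FP WP (lo n) (hi n) (fun u => u ^+ 2 - h n) (G2 n)
  (lo0 n) (ltW (lohi n))).
- by rewrite (mE_increment_sq FP WP) ?mul0r// lo0 lohi.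
- by apply: contB; [exact: exprn_continuous|exact: cont_cst].
- exact: eval_future.
- exact: BdW2.
- exact: (single n (BE D2)).
Qed.

Let BKG : BddF P (fun n w => K n w - 2^-1 * G2 n w).
Proof.
apply: BddF_D BK _; apply: BddF_N.
by apply: (BddF_Z (c := fun=> 2^-1) (M := `|2^-1|)) => //; exact: BE.
Qed.

(** The earlier value comes first, so the limit is minus the time derivative. [Z] supplies the limit
    and the term with [Psi] tends to 0. Letting both ends vary covers left and right derivatives at
    once. *)
Lemma mean_eval_increment :
  (hi n - lo n)^-1 * (meanX XC (lo n) x - meanX XC (hi n) x) @[n --> \oo] -->
  VA 0 t0 x * meanX XC t0 x - VB 0 t0 x * meanX XS t0 x
  + (a + b * x) * meanX (deriv_expr XC) t0 x
  + c ^+ 2 / 2 * meanX (deriv_expr (deriv_expr XC)) t0 x.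
Proof.
have quotE n : (hi n - lo n)^-1 * (meanX XC (lo n) x - meanX XC (hi n) x) =
    mE P (Z n) + mE P (fun w => Psi n w * (K n w - 2^-1 * G2 n w)).
  have Bl : BddF P (fun _ : unit => fun w => evalX XC (lo n) (flow b T (X w) (lo n) x)).
    exact: (single n (eval_BddF b T0' cX sX jVA jQA jVB jQB VA_le0 QA_le0 XC lo sx)).
  have Bh : BddF P (fun _ : unit => fun w => - evalX XC (hi n) (flow b T (X w) (hi n) x)).
    exact: (BddF_N (single n (BE XC))).
  have BdWG := BddF_M (BdW n) (single n (BE D1)).
  have BdWG2 := BddF_M (BdW2 n) (single n (BE D2)).
  have BP := BddF_M (single n BPsi) (single n BKG).
  have Bc1 : BddF P (fun (_ : unit) w => c / h n * (dW n w * G1 n w)).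
    by apply: (BddF_Z (c := fun=> c / h n) (M := `|c / h n|)).
  have Bc2 : BddF P (fun (_ : unit) w => c ^+ 2 / (2 * h n) * ((dW n w ^+ 2 - h n) * G2 n w)).
    by apply: (BddF_Z (c := fun=> c ^+ 2 / (2 * h n)) (M := `|c ^+ 2 / (2 * h n)|)).
  have E : mE P (fun w => Z n w + (c / h n * (dW n w * G1 n w) +
      (c ^+ 2 / (2 * h n) * ((dW n w ^+ 2 - h n) * G2 n w) +
       Psi n w * (K n w - 2^-1 * G2 n w)))) =
      mE P (Z n) + mE P (fun w => Psi n w * (K n w - 2^-1 * G2 n w)).
    rewrite (mE_D (single n BZ) (BddF_D Bc1 (BddF_D Bc2 BP))).
    rewrite (mE_D Bc1 (BddF_D Bc2 BP)) (mE_D Bc2 BP) (mE_Z _ BdWG) (mE_Z _ BdWG2).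
    by rewrite mE_dW mE_dW2 !mulr0 !add0r.
  rewrite -E.
  have -> : meanX XC (lo n) x - meanX XC (hi n) x =
      mE P (fun w => evalX XC (lo n) (flow b T (X w) (lo n) x) +
        - evalX XC (hi n) (flow b T (X w) (hi n) x)).
    rewrite (mE_D Bl Bh); congr (_ + _); rewrite -mulN1r -(mE_Z _ (single n (BE XC))).
    by congr (mE P _); apply/funext => w; rewrite mulN1r.
  rewrite -(mE_Z _ (BddF_D Bl Bh)); congr (mE P _); apply/funext => w.
  by rewrite increment_split !addrA.
have Bs e : BddF P (fun (_ : unit) w => evalX e t0 (flow b T (X w) t0 x)).
  exact: (eval_BddF b T0' cX sX jVA jQA jVB jQB VA_le0 QA_le0 e (fun=> t0)
    (SubG_reindex (fun=> 0%N) sx)).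
have Bk (k : R) e : BddF P (fun (_ : unit) w => k * evalX e t0 (flow b T (X w) t0 x)).
  by apply: (BddF_Z (c := fun=> k) (M := `|k|)).
have limE : VA 0 t0 x * meanX XC t0 x - VB 0 t0 x * meanX XS t0 x
    + (a + b * x) * meanX D1 t0 x + c ^+ 2 / 2 * meanX D2 t0 x = mE P Zlim.
  rewrite -mulNr -!(mE_Z _ (Bs _)) -(mE_D (Bk _ _) (Bk _ _)).
  rewrite -(mE_D (BddF_D (Bk _ _) (Bk _ _)) (Bk _ _)).
  rewrite -(mE_D (BddF_D (BddF_D (Bk _ _) (Bk _ _)) (Bk _ _)) (Bk _ _)).
  by congr (mE P _); apply/funext => w; rewrite /Zlim mulNr.
rewrite limE; under eq_fun do rewrite quotE.
rewrite -[mE P Zlim]addr0; apply: cvgD; first exact: mE_cvg BZ (@cZ).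
exact: mE_cvg_prod0 BPsi BKG cK.
Qed.

End time_derivative.

(** * The Feynman-Kac equation *)

Section potentials.
Context {R : realType}.
Variable T : R.
Hypothesis T0 : 0 < T.
Implicit Types (g : R -> R) (p : nat -> R) (k : nat).

Definition potential g p k (s y : R) : R :=
  g s * pser (iter k (@pseries_diffs R) p) y.

Lemma superexp_iter_diffs p k : superexp p -> superexp (iter k (@pseries_diffs R) p).
Proof. by move=> sp; elim: k => //= k; exact: superexp_diffs. Qed.

Lemma clamped_bounded g : {within `[0, T], continuous g} ->
  exists2 M : R, 0 <= M & forall s, `|g (clamp T s)| <= M.
Proof.
move=> cg; have cn : {within `[0, T], continuous (fun s => `|g s|)}.
  by move=> s; apply: continuous_comp (cg s) _; exact: norm_continuous.
have [s0 _ sP] := EVT_max (ltW T0) cn.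
exists `|g s0| => // s; apply: sP; rewrite in_itv/=.
exact: clamp_itv (ltW T0) s.
Qed.

Lemma jet_potential g p : {within `[0, T], continuous g} -> superexp p ->
  jet (potential (fun s => g (clamp T s)) p).
Proof.
move=> cg sp; split=> [k|k s y|k e e0].
- apply: contM.
    apply: (cont_comp (h := fun s => g (clamp T s))); first exact: (clamp_within_continuous T0 cg).
    exact: cont_fst.
  apply: (cont_comp (h := pser (iter k (@pseries_diffs R) p))); last exact: cont_snd.
  by move=> y; exact: is_derive_continuous (is_derive_pser y (superexp_iter_diffs k sp)).
- by apply: is_deriveZl; exact: is_derive_pser (superexp_iter_diffs k sp).
- have [M M0 MP] := clamped_bounded cg.
  have [K K0 KP] := pser_growth (superexp_iter_diffs k sp) e0.
  by exists (M * K) => s y; rewrite normrM -mulrA ler_pM.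
Qed.

Lemma jet_D (V V' : nat -> R -> R -> R) : jet V -> jet V' ->
  jet (fun k s y => V k s y + V' k s y).
Proof.
move=> [cV dV gV] [cV' dV' gV']; split=> [k|k s y|k e e0].
- exact: contD.
- exact: is_deriveD.
- have [K KP] := gV k e e0; have [K' KP'] := gV' k e e0.
  exists (K + K') => s y; apply: le_trans (ler_normD _ _) _.
  by rewrite mulrDl lerD.
Qed.

End potentials.

Section phase_shift.
Context {R : realType}.
Variables (b T : R) (VA QA VB QB : nat -> R -> R -> R).

(* Since [cos (B - pi/2) = sin B], shifting the phase turns [XC] into [XS], so
   that statements about real parts transfer to imaginary parts. *)
Definition shift_phase (Q : nat -> R -> R -> R) k s y : R :=
  if k is 0 then Q 0 s y - pi / 2 else Q k s y.

Lemma jet_shift_phase Q : jet Q -> jet (shift_phase Q).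
Proof.
move=> [cQ dQ gQ]; split=> [[|k]|[|k] s y|[|k] e e0]; try exact: cQ; try exact: dQ; try exact: gQ.
- by apply: contB; [exact: cQ|exact: cont_cst].
- apply: is_derive_eq (is_deriveB (dQ 0%N s y) (is_derive_cst (pi / 2 : R) y 1)) _.
  by rewrite subr0.
- have [K KP] := gQ 0%N e e0; exists (K + `|pi / 2|) => s y.
  rewrite /shift_phase; apply: (le_trans (ler_normB _ _)); rewrite [leRHS]mulrDl lerD//.
  by rewrite ler_peMr// -expR0 ler_expR mulr_ge0 ?sqr_ge0// ltW.
Qed.

Local Notation evalX := (eval b T VA QA VB QB).
Local Notation evalS := (eval b T VA QA VB (shift_phase QB)).

Lemma functional_shift_phase t xi :
  functional b T VB (shift_phase QB) 0 t xi = functional b T VB QB 0 t xi - pi / 2.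
Proof. by rewrite /functional /= !expr0 !mul1r addrA. Qed.

Lemma cosBpihalf (x : R) : cos (x - pi / 2) = sin x.
Proof. by rewrite cosB cos_pihalf sin_pihalf mulr0 add0r mulr1. Qed.

Lemma sinBpihalf (x : R) : sin (x - pi / 2) = - cos x.
Proof. by rewrite sinB cos_pihalf sin_pihalf mulr0 sub0r mulr1. Qed.

Lemma eval_shift_XC t xi : evalS XC t xi = evalX XS t xi.
Proof. by rewrite /= functional_shift_phase cosBpihalf. Qed.

Lemma eval_shift_XS t xi : evalS XS t xi = - evalX XC t xi.
Proof. by rewrite /= functional_shift_phase sinBpihalf mulrN. Qed.

Lemma eval_shift_D1 t xi : evalS (deriv_expr XC) t xi = evalX (deriv_expr XS) t xi.
Proof.
rewrite /= functional_shift_phase cosBpihalf sinBpihalf.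
rewrite /functional /=; ring.
Qed.

Lemma eval_shift_D2 t xi :
  evalS (deriv_expr (deriv_expr XC)) t xi = evalX (deriv_expr (deriv_expr XS)) t xi.
Proof.
rewrite /= functional_shift_phase cosBpihalf sinBpihalf.
rewrite /functional /=; ring.
Qed.

End phase_shift.

Section one_sided_derivative.
Context {R : realType}.
Implicit Types (g : R -> R) (t l T : R).

Lemma deriv_within_seq (D : set R) g t l :
  (forall u : nat -> R, (forall n, u n != 0 /\ D (u n + t)) -> u n @[n --> \oo] --> (0 : R) ->
    (u n)^-1 * (g (u n + t) - g t) @[n --> \oo] --> l) ->
  deriv_within D g t l.
Proof.
move=> H A nA.
have := @cvg_within_seq R R [set h | h != 0 /\ D (h + t)] 0
  (fun h => h^-1 * (g (h + t) - g t)) l H A nA.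
rewrite /dnbhs /within /=; apply: (@filterS _ (nbhs (0 : R))) => h hA h0 Dh.
exact: hA.
Qed.

(** The minimum and maximum of [t] and [u + t] serve as [lo] and [hi] for either sign of the step
    [u], also at the ends of the interval. *)
Lemma deriv_within_increments g t l T : 0 <= t <= T ->
  (forall lo hi : nat -> R, (forall n, 0 <= lo n) -> (forall n, lo n < hi n) ->
    (forall n, hi n <= T) -> lo n @[n --> \oo] --> t -> hi n @[n --> \oo] --> t ->
    (hi n - lo n)^-1 * (g (lo n) - g (hi n)) @[n --> \oo] --> - l) ->
  deriv_within `[0, T] g t l.
Proof.
move=> /andP[t0 tT] H; apply: deriv_within_seq => u uP u0.
pose lo n := Num.min t (u n + t); pose hi n := Num.max t (u n + t).
have ut n : 0 <= u n + t <= T by have [_] := uP n; rewrite /= in_itv/=.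
have un0 n : u n != 0 by have [] := uP n.
have cid : continuous (fun h : R => h + t).
  by apply: contD; [move=> z; exact: cvg_id|exact: cont_cst].
have clo : lo n @[n --> \oo] --> t.
  have cm : continuous (fun h : R => Num.min t (h + t)).
    by move=> h; apply: (@continuous_min R R (fun=> t) (fun h => h + t) h);
      [exact: cvg_cst|exact: (@cid h)].
  by have := cvg_comp _ _ u0 (cm 0); rewrite add0r minxx.
have chi : hi n @[n --> \oo] --> t.
  have cm : continuous (fun h : R => Num.max t (h + t)).
    by move=> h; apply: (@continuous_max R R (fun=> t) (fun h => h + t) h);
      [exact: cvg_cst|exact: (@cid h)].
  by have := cvg_comp _ _ u0 (cm 0); rewrite add0r maxxx.
have E n : (u n)^-1 * (g (u n + t) - g t) = - ((hi n - lo n)^-1 * (g (lo n) - g (hi n))).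
  rewrite /lo /hi; case: (ltgtP (u n) 0) => [un|un|un]; last by have := un0 n; rewrite un eqxx.
    have le : u n + t <= t by rewrite gerDr ltW.
    rewrite min_r// max_l// opprD addrCA subrr addr0 invrN; ring.
  have le : t <= u n + t by rewrite lerDr ltW.
  by rewrite min_l// max_r// addrK; ring.
under eq_fun do rewrite E.
rewrite -(opprK l); apply: cvgN; apply: H => // n.
- by rewrite le_min t0; have /andP[] := ut n.
- rewrite /lo /hi lt_max !gt_min !ltxx /=.
  by rewrite ltrDr gtrDr orbF; case: (ltgtP 0 (u n)) (un0 n) => // <-; rewrite eqxx.
- by rewrite ge_max tT; have /andP[] := ut n.
Qed.

End one_sided_derivative.

Section complex_parts.
Context {R : realType}.
Implicit Types (z u : Cx R) (r : R).

Lemma cReD z u : cRe (z + u) = cRe z + cRe u. Proof. by case: z; case: u. Qed.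
Lemma cImD z u : cIm (z + u) = cIm z + cIm u. Proof. by case: z; case: u. Qed.

Lemma cReMr z r : cRe (z * cR r) = cRe z * r.
Proof. by case: z => x y /=; rewrite mulr0 subr0. Qed.

Lemma cImMr z r : cIm (z * cR r) = cIm z * r.
Proof. by case: z => x y /=; rewrite mulr0 add0r. Qed.

Lemma cReM z u : cRe (z * u) = cRe z * cRe u - cIm z * cIm u.
Proof. by case: z; case: u. Qed.

Lemma cImM z u : cIm (z * u) = cRe z * cIm u + cIm z * cRe u.
Proof. by case: z; case: u. Qed.

Lemma mkC_eq0 z : cRe z = 0 -> cIm z = 0 -> z = 0.
Proof. by case: z => x y /= -> ->. Qed.

End complex_parts.

Lemma mE_cst {R : realType} {d : measure_display} {Omega : measurableType d}
  (P : probability Omega R) (k : R) : mE P (fun=> k) = k.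
Proof. by rewrite /mE /Rintegral -/(eE P (fun=> k)) eE_cst. Qed.

Lemma continuous_within {R : realType} (Z : topologicalType) (D : set Z) (f g : Z -> R) :
  (forall z, D z -> g z = f z) -> continuous g -> {within D, continuous f}.
Proof.
move=> fg cg; apply: (@subspace_eq_continuous _ D _ g f) => [z|].
  by rewrite inE => Dz; exact: fg.
exact: continuous_subspaceT.
Qed.

Section feynman_kac.
Context {R : realType} {d : measure_display} {Omega : measurableType d}.
Variables (P : probability Omega R) (F : R -> set (set Omega)) (W : R -> Omega -> R).
Hypotheses (FP : usual_filtration P F) (WP : brownian_motion P F W).
Variables (a b c T : R) (Y : R -> R -> R -> Omega -> R).
Hypotheses (T0 : 0 < T) (YP : ou_flow W a b c T Y).
Local Notation cl := (clamp T).
Local Notation X := (fun w s => Y 0 0 (cl s) w).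
Variables (u1 u2 u3 v : R -> Cx R) (p1 p2 p3 q : nat -> R).
Hypotheses (cu1 : ccont_on `[0, T] u1) (cu2 : ccont_on `[0, T] u2)
  (cu3 : ccont_on `[0, T] u3).
Hypotheses (sp1 : superexp p1) (sp2 : superexp p2) (sp3 : superexp p3) (sq : superexp q).

(** [r] is the real or the imaginary part: as the series are real, both parts of the exponent have
    the same shape. *)
Let V (r : Cx R -> R) k (s y : R) : R :=
  potential (fun s => r (u1 (cl s))) p1 k s y + potential (fun s => r (u2 (cl s))) p2 k s y
  + potential (fun s => r (u3 (cl s))) p3 k s y.
Let Q (r : Cx R -> R) : nat -> R -> R -> R := potential (fun=> r (v T)) q.
Let VA := V (@complex.Re R).
Let VB := V (@complex.Im R).
Let QA := Q (@complex.Re R).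
Let QB := Q (@complex.Im R).

Hypothesis VA_le0 : forall s y, VA 0 s y <= 0.
Hypothesis QA_le0 : forall s y, QA 0 s y <= 0.

Let T0' : 0 <= T. Proof. exact: ltW. Qed.
Let cX w : continuous (X w). Proof. exact: (ou_continuous T0 YP). Qed.
Let sX : SubG P (fun s w => X w s). Proof. exact: (ou_SubG FP WP T0 YP). Qed.

Let jVA : jet VA.
Proof.
exact: (jet_D (jet_D (jet_potential T0 cu1.1 sp1) (jet_potential T0 cu2.1 sp2))
  (jet_potential T0 cu3.1 sp3)).
Qed.

Let jVB : jet VB.
Proof.
exact: (jet_D (jet_D (jet_potential T0 cu1.2 sp1) (jet_potential T0 cu2.2 sp2))
  (jet_potential T0 cu3.2 sp3)).
Qed.

Let jQ r : jet (Q r).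
Proof.
have cg : {within `[0, T], continuous (fun=> r (v T))}.
  by apply: continuous_subspaceT; exact: cont_cst.
exact: (jet_potential T0 cg sq).
Qed.

Let jQA : jet QA. Proof. exact: jQ. Qed.
Let jQB : jet QB. Proof. exact: jQ. Qed.

Local Notation meanX := (mean_eval b T P X VA QA VB QB).
Let f := fk_f P Y T u1 u2 u3 v p1 p2 p3 q.

Let exponentE (r : Cx R -> R) (t x : R) w : 0 <= t <= T -> jet (V r) ->
  RI t T (fun s => r (u1 s) * pser p1 (Y t x s w) + r (u2 s) * pser p2 (Y t x s w)
    + r (u3 s) * pser p3 (Y t x s w)) + r (v T) * pser q (Y t x T w) =
  functional b T (V r) (Q r) 0 t (flow b T (X w) t x).
Proof.
move=> tT jV; have /andP[t0 tT'] := tT.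
have cxi : continuous (flow b T (X w) t x) by exact: flow_slice_cont.
have E s : t <= s <= T -> Y t x s w = flow b T (X w) t x s.
  by move=> ts; exact: (ou_flowE WP T0 YP).
have ET : Y t x T w = flow b T (X w) t x T by apply: E; rewrite tT' lexx.
have ER : RI t T (fun s => r (u1 s) * pser p1 (Y t x s w) + r (u2 s) * pser p2 (Y t x s w)
    + r (u3 s) * pser p3 (Y t x s w)) = RI t T (fun s => V r 0 s (flow b T (X w) t x s)).
  apply: eq_RI => s ts; rewrite -(E s ts) /V /potential/= clamp_id//.
  by move/andP: ts => [ts ->]; rewrite (le_trans t0).
by rewrite (functional_RI b (Q r) jV cxi tT) ER ET.
Qed.

Let fE (t x : R) : 0 <= t <= T -> f t x = mkC (meanX XC t x) (meanX XS t x).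
Proof.
move=> tT; rewrite /f /fk_f /cexpectation.
have ReE w : cRe (cintegral (fun s => u1 s * cR (pser p1 (Y t x s w))
    + u2 s * cR (pser p2 (Y t x s w)) + u3 s * cR (pser p3 (Y t x s w))) t T
    + v T * cR (pser q (Y t x T w))) = functional b T VA QA 0 t (flow b T (X w) t x).
  rewrite cReD cReMr -exponentE//; congr (_ + _); apply: eq_Rintegral => s _.
  by rewrite !cReD !cReMr.
have ImE w : cIm (cintegral (fun s => u1 s * cR (pser p1 (Y t x s w))
    + u2 s * cR (pser p2 (Y t x s w)) + u3 s * cR (pser p3 (Y t x s w))) t T
    + v T * cR (pser q (Y t x T w))) = functional b T VB QB 0 t (flow b T (X w) t x).
  rewrite cImD cImMr -exponentE//; congr (_ + _); apply: eq_Rintegral => s _.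
  by rewrite !cImD !cImMr.
by congr mkC; apply: eq_Rintegral => w _; rewrite /cexp /= ReE ImE.
Qed.

(** Order 0 is [f] itself, because [fx 0 = f] is an equality of functions while the clamped
    expression is known to agree with [f] on [[0, T]] only. *)
Let fx (n : nat) (t x : R) : Cx R :=
  if n is 0 then f t x
  else mkC (meanX (iter n deriv_expr XC) t x) (meanX (iter n deriv_expr XS) t x).

Let fxE n (t x : R) : 0 <= t <= T ->
  fx n t x = mkC (meanX (iter n deriv_expr XC) t x) (meanX (iter n deriv_expr XS) t x).
Proof. by case: n => //; exact: fE. Qed.

Let mean_cont e : continuous (fun z : R * R => meanX e z.1 z.2).
Proof.
exact: (@mean_eval_continuous R b T T0' _ _ P _ cX sX _ _ _ _ jVA jQA jVB jQB VA_le0 QA_le0 e).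
Qed.

(** Minus the time derivative of the real part, as given by the limit of increments; the equation
    then reduces to algebra. *)
Let dRe (t x : R) : R := VA 0 t x * meanX XC t x - VB 0 t x * meanX XS t x
  + (a + b * x) * meanX (deriv_expr XC) t x
  + c ^+ 2 / 2 * meanX (deriv_expr (deriv_expr XC)) t x.

Let dIm (t x : R) : R := VA 0 t x * meanX XS t x + VB 0 t x * meanX XC t x
  + (a + b * x) * meanX (deriv_expr XS) t x
  + c ^+ 2 / 2 * meanX (deriv_expr (deriv_expr XS)) t x.

Let dRe_cont : continuous (fun z : R * R => dRe z.1 z.2).
Proof.
have [cVA _ _] := jVA; have [cVB _ _] := jVB.
have cd : continuous (fun z : R * R => a + b * z.2).
  apply: contD; first exact: cont_cst; apply: contM; first exact: cont_cst.
  exact: cont_snd.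
apply: contD; last by apply: contM; [exact: cont_cst|exact: mean_cont].
apply: contD; last by apply: contM => //; exact: mean_cont.
by apply: contB; apply: contM => //; exact: mean_cont.
Qed.

Let dIm_cont : continuous (fun z : R * R => dIm z.1 z.2).
Proof.
have [cVA _ _] := jVA; have [cVB _ _] := jVB.
have cd : continuous (fun z : R * R => a + b * z.2).
  apply: contD; first exact: cont_cst; apply: contM; first exact: cont_cst.
  exact: cont_snd.
apply: contD; last by apply: contM; [exact: cont_cst|exact: mean_cont].
apply: contD; last by apply: contM => //; exact: mean_cont.
by apply: contD; apply: contM => //; exact: mean_cont.
Qed.

Let dt_Re (t x : R) : 0 <= t <= T ->
  deriv_within `[0, T] (fun s => cRe (f s x)) t (- dRe t x).
Proof.
move=> tT; apply: (deriv_within_increments tT) => lo hi lo0 lohi hiT clo chi.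
rewrite opprK.
have E n : (hi n - lo n)^-1 * (cRe (f (lo n) x) - cRe (f (hi n) x)) =
    (hi n - lo n)^-1 * (meanX XC (lo n) x - meanX XC (hi n) x).
  rewrite !fE//; first by rewrite hiT (le_trans (lo0 n)) ?ltW.
  by rewrite lo0 (le_trans (ltW (lohi n))).
under eq_fun do rewrite E.
exact: (mean_eval_increment FP WP T0 YP jVA jQA jVB jQB VA_le0 QA_le0 lo0 lohi hiT tT clo chi).
Qed.

Let dt_Im (t x : R) : 0 <= t <= T ->
  deriv_within `[0, T] (fun s => cIm (f s x)) t (- dIm t x).
Proof.
move=> tT; apply: (deriv_within_increments tT) => lo hi lo0 lohi hiT clo chi.
rewrite opprK.
have mS e e' : (forall t xi, eval b T VA QA VB (shift_phase QB) e t xi =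
    eval b T VA QA VB QB e' t xi) ->
    forall s, mean_eval b T P X VA QA VB (shift_phase QB) e s x = meanX e' s x.
  by move=> ee s; congr (mE P _); apply/funext => w; exact: ee.
have E n : (hi n - lo n)^-1 * (cIm (f (lo n) x) - cIm (f (hi n) x)) =
    (hi n - lo n)^-1 * (mean_eval b T P X VA QA VB (shift_phase QB) XC (lo n) x -
      mean_eval b T P X VA QA VB (shift_phase QB) XC (hi n) x).
  rewrite !(mS _ _ (@eval_shift_XC R b T VA QA VB QB)).
  rewrite !fE//; first by rewrite hiT (le_trans (lo0 n)) ?ltW.
  by rewrite lo0 (le_trans (ltW (lohi n))).
under eq_fun do rewrite E.
have := mean_eval_increment FP WP T0 YP jVA jQA jVB (jet_shift_phase jQB) VA_le0 QA_le0
  lo0 lohi hiT tT clo chi (x := x).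
rewrite (mS _ _ (@eval_shift_XC R b T VA QA VB QB)) (mS _ _ (@eval_shift_D1 R b T VA QA VB QB)).
rewrite (mS _ _ (@eval_shift_D2 R b T VA QA VB QB)).
(* The shifted sine is minus the cosine, which turns [- VB * XS] into the [+ VB * XC] of [dIm]. *)
rewrite (mS _ (XOpp XC) (@eval_shift_XS R b T VA QA VB QB)).
have -> : meanX (XOpp XC) t x = - meanX XC t x.
  rewrite /mean_eval -mulN1r -mE_Z; last first.
    have sx : SubG P (fun (_ : unit) (_ : Omega) => x).
      by apply: (SubG_cst _ (c := fun=> x) (M := `|x|)).
    exact: (eval_BddF b T0' cX sX jVA jQA jVB jQB VA_le0 QA_le0 XC (fun=> t) sx).
  by congr (mE P _); apply/funext => w; rewrite mulN1r.
by rewrite mulrN opprK.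
Qed.

Lemma feynman_kac_solution :
  (exists fx : nat -> R -> R -> Cx R,
     [/\ fx 0%N = f,
         (forall n : nat, ccont2_on (`[0, T] `*` setT) (fx n)),
         (forall (n : nat) (t x : R), (0 <= t <= T) ->
            is_derive x (1 : R) (fun y => cRe (fx n t y)) (cRe (fx n.+1 t x)) /\
            is_derive x (1 : R) (fun y => cIm (fx n t y)) (cIm (fx n.+1 t x))) &
     exists ft : R -> R -> Cx R,
       [/\ ccont2_on (`[0, T] `*` setT) ft,
           (forall t x, (0 <= t <= T) ->
              deriv_within `[0, T] (fun s => cRe (f s x)) t (cRe (ft t x)) /\
              deriv_within `[0, T] (fun s => cIm (f s x)) t (cIm (ft t x))) &
           (forall t x, (0 <= t <= T) ->
              ft t x + fx 1%N t x * cR (a + b * x) + cR (c ^+ 2 / 2) * fx 2%N t x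
              + f t x * (u1 t * cR (pser p1 x) + u2 t * cR (pser p2 x)
                         + u3 t * cR (pser p3 x)) = 0)]])
  /\ (forall x, f T x = cexp (v T * cR (pser q x))).
Proof.
split; last first.
  move=> x; have TT : 0 <= T <= T by rewrite T0' lexx.
  (* At [t = T] the rescaled integral has factor [T - T], and the exponent is deterministic. *)
  have FT (r : Cx R -> R) w : functional b T (V r) (Q r) 0 T (flow b T (X w) T x) =
      r (v T) * pser q x.
    by rewrite /functional clamp_id// subrr mul0r add0r expr0 mul1r flow_diag.
  rewrite fE// /cexp cReMr cImMr; congr mkC.
    by rewrite -[RHS](mE_cst P); congr (mE P _); apply/funext => w; rewrite /= !FT.
  by rewrite -[RHS](mE_cst P); congr (mE P _); apply/funext => w; rewrite /= !FT.
exists fx; split.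
- by [].
- move=> n; split; [pose e := iter n deriv_expr XC|pose e := iter n deriv_expr XS].
    apply: (@continuous_within _ _ _ _ (fun z => meanX e z.1 z.2)); last exact: mean_cont.
    by move=> [t x] [/=]; rewrite in_itv/= => tT _; rewrite fxE.
  apply: (@continuous_within _ _ _ _ (fun z => meanX e z.1 z.2)); last exact: mean_cont.
  by move=> [t x] [/=]; rewrite in_itv/= => tT _; rewrite fxE.
- move=> n t x tT; split.
    rewrite (funext (fun y => congr1 (@complex.Re R) (fxE n y tT))) fxE//.
    exact: (mean_eval_derive b T0' cX sX jVA jQA jVB jQB VA_le0 QA_le0).
  rewrite (funext (fun y => congr1 (@complex.Im R) (fxE n y tT))) fxE//.
  exact: (mean_eval_derive b T0' cX sX jVA jQA jVB jQB VA_le0 QA_le0).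
exists (fun t x => mkC (- dRe t x) (- dIm t x)); split.
- split; apply: continuous_subspaceT; apply: contN; [exact: dRe_cont|exact: dIm_cont].
- by move=> t x tT; split; [exact: dt_Re|exact: dt_Im].
- move=> t x tT; rewrite (fE x tT) /fx.
  have VE (r : Cx R -> R) : V r 0 t x =
      r (u1 t) * pser p1 x + r (u2 t) * pser p2 x + r (u3 t) * pser p3 x.
    by rewrite /V /potential/= clamp_id.
  apply: mkC_eq0.
    by rewrite !(cReD, cImD, cReM, cImM) /dRe /VA /VB !VE /=; ring.
  by rewrite !(cReD, cImD, cReM, cImM) /dIm /VA /VB !VE /=; ring.
Qed.

End feynman_kac.

Theorem theorem6p11 (R : realType) (d : measure_display) (Omega : measurableType d)
  (P : probability Omega R) (F : R -> set (set Omega)) (W : R -> Omega -> R)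
  (a b c T : R) (u1 u2 u3 v : R -> Cx R) (p p2 p3 q : nat -> R)
  (Y : R -> R -> R -> Omega -> R) :
  usual_filtration P F -> brownian_motion P F W ->
  c != 0 -> 0 < T ->
  ccont_on `[0, T] u1 -> ccont_on `[0, T] u2 -> ccont_on `[0, T] u3 -> ccont_on `[0, T] v ->
  (forall s, (0 <= s <= T) -> cRe (u1 s) <= 0) ->
  (forall s, (0 <= s <= T) -> cRe (u2 s) = 0) ->
  (forall s, (0 <= s <= T) -> cRe (u3 s) = 0) ->
  (forall s, (0 <= s <= T) -> cRe (v s) = 0) ->
  negligible_df p -> negligible_df p2 -> negligible_df p3 -> negligible_df q ->
  ou_flow W a b c T Y ->
  let p1 := pser_sq p in
  let f := fk_f P Y T u1 u2 u3 v p1 p2 p3 q in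
  (* f is C^infinity in x: derivatives fx n of all orders, jointly continuous *)
  (exists fx : nat -> R -> R -> Cx R,
     [/\ fx 0%N = f,
         (forall n : nat, ccont2_on (`[0, T] `*` setT) (fx n)),
         (forall (n : nat) (t x : R), (0 <= t <= T) ->
            is_derive x (1 : R) (fun y => cRe (fx n t y)) (cRe (fx n.+1 t x)) /\
            is_derive x (1 : R) (fun y => cIm (fx n t y)) (cIm (fx n.+1 t x))) &
     (* f is C^1 in t (one-sided derivatives at t = 0, T) and solves the PDE *)
     exists ft : R -> R -> Cx R,
       [/\ ccont2_on (`[0, T] `*` setT) ft,
           (forall t x, (0 <= t <= T) ->
              deriv_within `[0, T] (fun s => cRe (f s x)) t (cRe (ft t x)) /\
              deriv_within `[0, T] (fun s => cIm (f s x)) t (cIm (ft t x))) &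
           (forall t x, (0 <= t <= T) ->
              ft t x + fx 1%N t x * cR (a + b * x) + cR (c ^+ 2 / 2) * fx 2%N t x
              + f t x * (u1 t * cR (pser p1 x) + u2 t * cR (pser p2 x)
                         + u3 t * cR (pser p3 x)) = 0)]])
  /\ (forall x, f T x = cexp (v T * cR (pser q x))).
Proof.
move=> FP WP _ T0 cu1 cu2 cu3 _ u1_le0 u2_0 u3_0 v_0 np np2 np3 nq YP p1 f.
have sp := negligible_df_superexp np.
have cT s := clamp_itv (ltW T0) s.
apply: (feynman_kac_solution FP WP T0 YP cu1 cu2 cu3 (superexp_sq sp)
  (negligible_df_superexp np2) (negligible_df_superexp np3) (negligible_df_superexp nq)).
(* The terms of [u2] and [u3] have no real part, and that of [u1] is a nonpositive number times a
   square. *)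
- move=> s y; rewrite /potential/= u2_0// u3_0// !mul0r !addr0 pser_sqE//.
  by rewrite mulr_le0_ge0 ?sqr_ge0// u1_le0.
- have TT : 0 <= T <= T by rewrite ltW//=.
  by move=> s y; rewrite /potential/= (v_0 T TT) mul0r.
Qed.
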